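(* Let $\rho\in]0,+\infty[$ and $\lambda\in]0,n-1[$. Let $\Omega$ be a bounded open Lipschitz subset of $\mathbb{R}^n$ such that $\mathrm{cl}\,\Omega\subseteq Q$. Let $\Omega_1$ be a nonempty open subset of $\mathbb{R}^n$ such that $\mathrm{cl}\,\Omega_1\subseteq\Omega$. Let $G$ be an open relatively compact neighborhood of the set $$\{t-s:\ t\in\mathrm{cl}\,\Omega_1,\ s\in\partial\Omega\}$$ such that $(\mathrm{cl}\,G)\cap q\mathbb{Z}^n=\emptyset$. Then the following statements hold. (i) For all pairs $(h,\varphi)\in H_q^{\lambda,\rho}(G)\times C^0_{\omega,\rho}(\mathrm{cl}\,\Omega)$ the restriction of $\mathcal{P}^+[h,\varphi]$ to $\mathrm{cl}\,\mathbb{S}[\Omega_1]$ belongs to $C^0_{q,\omega,\rho}(\mathrm{cl}\,\mathbb{S}[\Omega_1])$, and the map from $H_q^{\lambda,\rho}(G)\times C^0_{\omega,\rho}(\mathrm{cl}\,\Omega)$ to $C^0_{q,\omega,\rho}(\mathrm{cl}\,\mathbb{S}[\Omega_1])$ which takes $(h,\varphi)$ to $\mathcal{P}^+[h,\varphi]_{|\mathrm{cl}\,\mathbb{S}[\Omega_1]}$ is bilinear and continuous. (ii) For all pairs $(h,\varphi)\in H_q^{\lambda,\rho}(G)\times C^0_{q,\omega,\rho}(\mathrm{cl}\,\mathbb{S}[\Omega]^-)$ the restriction of $\mathcal{P}^-[h,\varphi_{|Q\setminus\mathrm{cl}\,\Omega}]$ to $\mathrm{cl}\,\mathbb{S}[\Omega_1]$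 belongs to $C^0_{q,\omega,\rho}(\mathrm{cl}\,\mathbb{S}[\Omega_1])$, and the map from $H_q^{\lambda,\rho}(G)\times C^0_{q,\omega,\rho}(\mathrm{cl}\,\mathbb{S}[\Omega]^-)$ to $C^0_{q,\omega,\rho}(\mathrm{cl}\,\mathbb{S}[\Omega_1])$ which takes $(h,\varphi)$ to $\mathcal{P}^-[h,\varphi_{|Q\setminus\mathrm{cl}\,\Omega}]_{|\mathrm{cl}\,\mathbb{S}[\Omega_1]}$ is bilinear and continuous.
   Context: Fix a natural number $n\ge 2$ and $(q_{11},\dots,q_{nn})\in]0,+\infty[^n$. Let $Q=\prod_{j=1}^n]0,q_{jj}[$, $\tilde Q=\prod_{j=1}^n]-q_{jj}/2,q_{jj}/2[$, let $q$ be the diagonal matrix with entries $q_{11},\dots,q_{nn}$, and $q\mathbb{Z}^n=\{qz: z\in\mathbb{Z}^n\}$. $\mathrm{cl}$ denotes closure and $\mathbb{N}$ includes $0$. Functions are complex-valued. A function is $q$-periodic if it is invariant under translations by elements of $q\mathbb{Z}^n$ (on a domain invariant under such translations). For $\Omega\subseteq\mathbb{R}^n$ open with $\mathrm{cl}\,\Omega\subseteq Q$, set $\mathbb{S}[\Omega]=\bigcup_{z\in\mathbb{Z}^n}(qz+\Omega)$ and $\mathbb{S}[\Omega]^-=\mathbb{R}^n\setminus\mathrm{cl}\,\mathbb{S}[\Omega]$; $\mathrm{cl}\,\mathbb{S}[\Omega]^-$ is the closure of $\mathbb{S}[\Omega]^-$. For an open set $U$, $C^m(\mathrm{cl}\,U)$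 is the set of $m$ times continuously differentiable functions on $U$ whose derivatives of order $\le m$ extend continuously to $\mathrm{cl}\,U$ ($m\in\mathbb{N}\cup\{\infty\}$). For $U=\mathbb{S}[\Omega]$ or $U=\mathbb{S}[\Omega]^-$, $C^\infty_q(\mathrm{cl}\,U)$ is the set of $q$-periodic functions in $C^\infty(\mathrm{cl}\,U)$ all of whose derivatives are bounded. $C^k_q(\mathbb{R}^n\setminus q\mathbb{Z}^n)$ is the set of $q$-periodic functions of class $C^k$ on $\mathbb{R}^n\setminus q\mathbb{Z}^n$. Roumieu classes ($\rho>0$). For $\Omega$ bounded open, $C^0_{\omega,\rho}(\mathrm{cl}\,\Omega)$ is the Banach space of $u\in C^\infty(\mathrm{cl}\,\Omega)$ with finite norm $$\|u\|=\sup_{\beta\in\mathbb{N}^n}\frac{\rho^{|\beta|}}{|\beta|!}\sup_{\mathrm{cl}\,\Omega}|D^\beta u|.$$ If $\mathrm{cl}\,\Omega\subseteq Q$, $C^0_{q,\omega,\rho}(\mathrm{cl}\,\mathbb{S}[\Omega])$ is the Banach space of $u\in C^\infty_q(\mathrm{cl}\,\mathbb{S}[\Omega])$ for which the same norm (sup over $\mathrm{cl}\,\Omega$) is finite, and $C^0_{q,\omega,\rho}(\mathrm{cl}\,\mathbb{S}[\Omega]^-)$ is the Banach space of $u\in C^\infty_q(\mathrm{cl}\,\mathbb{S}[\Omega]^-)$ with finite norm $$\|u\|=\sup_{\beta\in\mathbb{N}^n}\frac{\rho^{|\beta|}}{|\beta|!}\sup_{(\mathrm{cl}\,Q)\setminus\Omega}|D^\beta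 u|.$$ Kernels. For $\lambda>0$, $A^0_{q,\lambda}$ is the Banach space of $h\in C^0_q(\mathbb{R}^n\setminus q\mathbb{Z}^n)$ with finite norm $\|h\|_{A^0_{q,\lambda}}=\sup_{x\in\tilde Q\setminus\{0\}}|h(x)||x|^\lambda$. $A^1_{q,\lambda}$ is the Banach space of $h\in C^1_q(\mathbb{R}^n\setminus q\mathbb{Z}^n)$ such that $h\in A^0_{q,\lambda}$ and $\partial h/\partial x_j\in A^0_{q,\lambda+1}$ for all $j$, with norm $\|h\|_{A^1_{q,\lambda}}=\|h\|_{A^0_{q,\lambda}}+\sum_{j=1}^n\|\partial h/\partial x_j\|_{A^0_{q,\lambda+1}}$. For $G\subseteq\mathbb{R}^n$ open with $\mathrm{cl}\,G$ bounded and contained in $\mathbb{R}^n\setminus q\mathbb{Z}^n$, $H_q^{\lambda,\rho}(G)$ is the Banach space of $h\in A^1_{q,\lambda}$ with $h_{|\mathrm{cl}\,G}\in C^0_{\omega,\rho}(\mathrm{cl}\,G)$, with norm $\|h\|_{A^1_{q,\lambda}}+\|h\|_{C^0_{\omega,\rho}(\mathrm{cl}\,G)}$. Potentials. For $h\in A^0_{q,\lambda}$ with $0<\lambda<n$ and bounded measurable $\varphi$ on the relevant set, and for $x\in\mathbb{R}^n$, $$\mathcal{P}^+[h,\varphi](x)=\int_\Omega h(x-y)\varphi(y)\,dy,\qquad \mathcal{P}^-[h,\varphi](x)=\int_{Q\setminus\mathrm{cl}\,\Omega}h(x-y)\varphi(y)\,dy.$$ A product of normed spaces carries the sum norm. 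*)

(* Defs.v *)
From HB Require Import structures.
From mathcomp Require Import all_boot all_order all_algebra.
From mathcomp Require Import complex.
From mathcomp Require Import all_classical all_reals all_analysis.

Set Implicit Arguments.
Unset Strict Implicit.
Unset Printing Implicit Defensive.

Import Order.TTheory GRing.Theory Num.Theory.
Import numFieldNormedType.Exports.

Local Open Scope classical_set_scope.
Local Open Scope ring_scope.

(* The complex numbers are taken as the real normed space [Rcomplex R], so that
   [derive] applies to complex-valued functions of a real vector and the modulus
   [`|z|] lies in [R]. The ring structure of [Rcomplex R] is that of [R[i]]. *)
Section Rcomplex_normedModType.
Variable R : realType.

Lemma Rcomplex_normrZ (l : R) (z : Rcomplex R) : `|l *: z| = `|l| * `|z|.
Proof.
case: z => a b; rewrite /Num.norm /= !exprMn -mulrDr.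
by rewrite sqrtrM ?sqr_ge0// sqrtr_sqr.
Qed.

HB.instance Definition _ :=
  PseudoMetric.copy (Rcomplex R) (pseudoMetric_normed (Rcomplex R)).
HB.instance Definition _ := isPointed.Build (Rcomplex R) 0.
HB.instance Definition _ :=
  NormedZmod_PseudoMetric_eq.Build R (Rcomplex R) erefl.
HB.instance Definition _ :=
  PseudoMetricNormedZmod_Lmodule_isNormedModule.Build R (Rcomplex R)
    Rcomplex_normrZ.

End Rcomplex_normedModType.

(* Lebesgue measure on the Borel sets of R^n, by iterating the binary product
   measure along [R * R^n ~ R^(n.+1)]. *)
Section lebesgue_tuple.
Variable R : realType.
Local Notation T := (measurableTypeR R).

Definition tuple_cons n (p : T * n.-tuple T) : n.+1.-tuple T :=
  [tuple of p.1 :: p.2].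

Lemma measurable_tuple_cons n : measurable_fun setT (@tuple_cons n).
Proof. exact: measurable_cons. Qed.


Lemma measurable_tuple_uncons n :
  measurable_fun setT (fun t : n.+1.-tuple T => (thead t, [tuple of behead t])).
Proof.
by apply/measurable_fun_pairP; split;
  [exact: measurable_tnth|exact: measurable_behead].
Qed.

Section step.
Variables (n : nat) (mu : {sigma_finite_measure set (n.-tuple T) -> \bar R}).

Definition lebesgue_tupleS : set (n.+1.-tuple T) -> \bar R :=
  pushforward (lebesgue_measure \x mu)%E (@tuple_cons n).

Let lebesgue_tupleS0 : lebesgue_tupleS set0 = 0%E.
Proof. by rewrite /lebesgue_tupleS /pushforward preimage_set0 measure0. Qed.

Let lebesgue_tupleS_ge0 A : (0 <= lebesgue_tupleS A)%E.
Proof. by rewrite /lebesgue_tupleS /pushforward measure_ge0. Qed.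

Let lebesgue_tupleS_sigma_additive : semi_sigma_additive lebesgue_tupleS.
Proof.
by apply: measure_semi_sigma_additive; exact: measurable_tuple_cons.
Qed.

HB.instance Definition _ := isMeasure.Build _ _ _ lebesgue_tupleS
  lebesgue_tupleS0 lebesgue_tupleS_ge0 lebesgue_tupleS_sigma_additive.

Let lebesgue_tupleS_sigma_finite : sigma_finite setT lebesgue_tupleS.
Proof.
have /sigma_finiteP[F [FT ndF Foo]] :=
  sigma_finiteT (@lebesgue_measure R : {sigma_finite_measure set T -> \bar R}).
have /sigma_finiteP[G [GT ndG Goo]] := sigma_finiteT mu.
pose u (t : n.+1.-tuple T) := (thead t, [tuple of behead t]).
have uK : cancel (@tuple_cons n) u.
  by move=> [x t]; congr pair; apply/val_inj.
exists (fun k => u @^-1` (F k `*` G k)).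
  apply/seteqP; split=> // t _.
  have [i _ Fi] : (\bigcup_i F i) (thead t) by rewrite -FT.
  have [j _ Gj] : (\bigcup_j G j) [tuple of behead t] by rewrite -GT.
  exists (maxn i j) => //; split => /=.
  - by move: Fi; exact/subsetPset/ndF/leq_maxl.
  - by move: Gj; exact/subsetPset/ndG/leq_maxr.
move=> k; have [mF Fk] := Foo k; have [mG Gk] := Goo k.
have mFG : measurable (F k `*` G k) by exact: measurableX.
split; first by rewrite -[X in measurable X]setTI; exact: measurable_tuple_uncons.
rewrite /lebesgue_tupleS /pushforward -comp_preimage.
rewrite (_ : u \o _ = id); last by apply/funext => p; exact: uK.
by rewrite preimage_id product_measure1E// lte_mul_pinfty// ge0_fin_numE.
Qed.

HB.instance Definition _ := Measure_isSigmaFinite.Build _ _ _ lebesgue_tupleS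
  lebesgue_tupleS_sigma_finite.

End step.

Fixpoint lebesgue_tuple n : {sigma_finite_measure set (n.-tuple T) -> \bar R} :=
  if n is n'.+1 then lebesgue_tupleS (lebesgue_tuple n')
  else dirac [tuple].

Lemma lebesgue_tuple_box n (A : 'I_n -> set T) :
  (forall i, measurable (A i)) ->
  lebesgue_tuple n [set t | forall i, A i (tnth t i)] =
  (\prod_(i < n) lebesgue_measure (A i))%E.
Proof.
elim: n A => [|n IH] A mA.
  by rewrite big_ord0 /= diracE mem_set//; case.
rewrite big_ord_recl -IH//= /lebesgue_tupleS /pushforward.
rewrite -product_measure1E//; last first.
  rewrite (_ : mkset _ = \bigcap_(i in setT)
      ((fun t : n.-tuple T => tnth t i) @^-1` A (lift ord0 i))); last first.
    by apply/seteqP; split=> [t tA i _|t tA i]; exact: tA.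
  apply: fin_bigcap_measurable => [|i _]; first exact: finite_finset.
  rewrite -[X in measurable X]setTI.
  exact: measurable_tnth.
congr (product_measure1 _ _ _); apply/seteqP; split=> [[x t] /= xtA|[x t] /= [xA tA] i].
  split; first exact: (xtA ord0).
  by move=> i; have := xtA (lift ord0 i); rewrite /tuple_cons tnthS.
by case: (unliftP ord0 i) => [j ->|->]; rewrite /tuple_cons ?tnthS.
Qed.

End lebesgue_tuple.

Section spaces.
Variables (R : realType) (n : nat).
Local Notation V := 'rV[R]_n.
Local Notation C := (Rcomplex R).
Implicit Types (q : 'I_n -> R) (D U K Om : set V) (f g h phi : V -> C).

(* The norm of ['rV[R]_n] in the library is the sup norm. *)
Definition enorm m (x : 'rV[R]_m) : R := Num.sqrt (\sum_i x ord0 i ^+ 2).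

Definition cell q : set V := [set x | forall i, 0 < x ord0 i < q i].

Definition centered_cell q : set V :=
  [set x | forall i, - (q i / 2) < x ord0 i < q i / 2].

Definition qmul q (z : 'rV[int]_n) : V := \row_i (q i * (z ord0 i)%:~R).

Definition lattice q : set V := range (qmul q).

Definition periodization q Om : set V :=
  \bigcup_z [set qmul q z + x | x in Om].

Definition periodization_ext q Om : set V := ~` closure (periodization q Om).

Definition boundary D : set V := closure D `\` interior D.

(* Near each boundary point [p], up to a rigid motion ([A] is orthogonal and
   [k] is the distinguished coordinate), [Om] is the strict hypograph of a
   Lipschitz function of the remaining [n - 1] coordinates. *)
Definition lipschitz_set Om : Prop :=
  forall p, boundary Om p ->
  exists (A : 'M[R]_n) (k : 'I_n) (r delta : R) (gamma : 'rV[R]_n.-1 -> R),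
  let B := [set eta : 'rV[R]_n.-1 | enorm eta < r] in
  [/\ A *m A^T = 1%:M, 0 < r, 0 < delta, gamma 0 = 0 &
   [/\ [lipschitz gamma eta | eta in B],
     (forall eta, B eta -> `|gamma eta| < delta) &
     forall y : V, B (col' k y) -> `|y ord0 k| < delta ->
       (Om (p + y *m A) <-> y ord0 k < gamma (col' k y))]].

Definition partial (j : 'I_n) f : V -> C := 'D_(delta_mx 0 j) f.

Definition mderiv (beta : 'I_n -> nat) f : V -> C :=
  foldr (fun j g => iter (beta j) (partial j) g) f (enum 'I_n).

Definition mlength (beta : 'I_n -> nat) : nat := (\sum_i beta i)%N.

Fixpoint class_C (m : nat) U f : Prop :=
  (forall x, U x -> {for x, continuous f}) /\
  if m is m'.+1 then
    forall j, (forall x, U x -> derivable f x (delta_mx 0 j)) /\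
              class_C m' U (partial j f)
  else True.

(* A function on a subset [D] of R^n is represented by any total function with
   the prescribed values on [D]; membership and norms only depend on these values.
   For a function on [closure U], derivatives are taken in the open set [U] and
   [cl_deriv U beta f] is the continuous extension of [D^beta f] to [closure U]
   when it exists. *)
Definition cl_deriv U beta f : V -> C :=
  fun x => lim (mderiv beta f @ within U (nbhs x)).

Definition class_Cinf_cl U f : Prop :=
  [/\ {within closure U, continuous f}, forall m, class_C m U f &
    forall beta, exists g, {within closure U, continuous g} /\
                           {in U, g =1 mderiv beta f}].

Definition periodic_on q D f : Prop :=
  forall x z, D x -> f (x + qmul q z) = f x.

Definition class_Cinfq_cl q U f : Prop :=
  [/\ class_Cinf_cl U f, periodic_on q (closure U) f &
    forall beta, exists M : R, forall x, closure U x -> `|cl_deriv U beta f x| <= M].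

(* A normed space of functions defined on [nf_dom] and represented as above. *)
Record nfspace := NFSpace {
  nf_dom : set V ;
  nf_mem : set (V -> C) ;
  nf_norm : (V -> C) -> \bar R }.

Definition roumieu_norm (rho : R) U K f : \bar R :=
  ereal_sup (range (fun beta : 'I_n -> nat =>
    (rho ^+ mlength beta / ((mlength beta)`!)%:R)%:E *
    ereal_sup [set `|cl_deriv U beta f x|%:E | x in K])%E).

Definition roumieu (rho : R) Om : nfspace :=
  let N := roumieu_norm rho Om (closure Om) in
  NFSpace (closure Om) [set f | class_Cinf_cl Om f /\ (N f < +oo)%E] N.

Definition roumieu_per q (rho : R) Om : nfspace :=
  let U := periodization q Om in
  let N := roumieu_norm rho U (closure Om) in
  NFSpace (closure U) [set f | class_Cinfq_cl q U f /\ (N f < +oo)%E] N.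

Definition roumieu_per_ext q (rho : R) Om : nfspace :=
  let U := periodization_ext q Om in
  let N := roumieu_norm rho U (closure (cell q) `\` Om) in
  NFSpace (closure U) [set f | class_Cinfq_cl q U f /\ (N f < +oo)%E] N.

Definition A0_norm q (lambda : R) h : \bar R :=
  ereal_sup [set (`|h x| * enorm x `^ lambda)%:E | x in centered_cell q `\ 0].

Definition space_A0 q (lambda : R) : nfspace :=
  NFSpace (~` lattice q)
    [set h | [/\ class_C 0 (~` lattice q) h, periodic_on q (~` lattice q) h &
                 (A0_norm q lambda h < +oo)%E]]
    (A0_norm q lambda).

Definition A1_norm q (lambda : R) h : \bar R :=
  (A0_norm q lambda h + \sum_(j < n) A0_norm q (lambda + 1) (partial j h))%E.

Definition space_A1 q (lambda : R) : nfspace :=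
  NFSpace (~` lattice q)
    [set h | [/\ class_C 1 (~` lattice q) h, periodic_on q (~` lattice q) h,
                 nf_mem (space_A0 q lambda) h &
                 forall j, nf_mem (space_A0 q (lambda + 1)) (partial j h)]]
    (A1_norm q lambda).

Definition space_H q (lambda rho : R) (G : set V) : nfspace :=
  NFSpace (~` lattice q)
    (nf_mem (space_A1 q lambda) `&` nf_mem (roumieu rho G))
    (fun h => nf_norm (space_A1 q lambda) h + nf_norm (roumieu rho G) h)%E.

Definition maps_into (E F H : nfspace) (B : (V -> C) -> (V -> C) -> (V -> C)) :=
  forall u v, nf_mem E u -> nf_mem F v -> nf_mem H (B u v).

Definition bilinear_into (E F H : nfspace)
    (B : (V -> C) -> (V -> C) -> (V -> C)) : Prop :=
  (forall (a : C) u1 u2 v, nf_mem E u1 -> nf_mem E u2 -> nf_mem F v ->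
     forall x, nf_dom H x ->
       B (fun y => a * u1 y + u2 y) v x = a * B u1 v x + B u2 v x) /\
  (forall (a : C) u v1 v2, nf_mem E u -> nf_mem F v1 -> nf_mem F v2 ->
     forall x, nf_dom H x ->
       B u (fun y => a * v1 y + v2 y) x = a * B u v1 x + B u v2 x).

Definition continuous_into (E F H : nfspace)
    (B : (V -> C) -> (V -> C) -> (V -> C)) : Prop :=
  forall u0 v0, nf_mem E u0 -> nf_mem F v0 ->
  forall eps : R, 0 < eps -> exists2 delta : R, 0 < delta &
  forall u v, nf_mem E u -> nf_mem F v ->
    (nf_norm E (u \- u0)%R + nf_norm F (v \- v0)%R < delta%:E)%E ->
    (nf_norm H (B u v \- B u0 v0)%R < eps%:E)%E.

Definition vec_of_tuple (t : n.-tuple (measurableTypeR R)) : V := \row_i tnth t i.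

Definition volume_integral D f : C :=
  Complex
    (\int[lebesgue_tuple R n]_(t in vec_of_tuple @^-1` D) complex.Re (f (vec_of_tuple t)))
    (\int[lebesgue_tuple R n]_(t in vec_of_tuple @^-1` D) complex.Im (f (vec_of_tuple t))).

Definition Pplus Om h phi : V -> C :=
  fun x => volume_integral Om (fun y => h (x - y) * phi y).

Definition Pminus q Om h phi : V -> C :=
  fun x => volume_integral (cell q `\` closure Om) (fun y => h (x - y) * phi y).

End spaces.

(* Main.v *)
Require Import Defs.
From mathcomp Require Import all_boot all_order all_algebra.
From mathcomp Require Import complex ring lra zify.
From mathcomp Require Import all_classical all_reals all_analysis measurable_realfun.

Set Implicit Arguments.
Unset Strict Implicit.
Unset Printing Implicit Defensive.

Import Order.TTheory GRing.Theory Num.Theory.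
Import numFieldNormedType.Exports.

Local Open Scope classical_set_scope.
Local Open Scope ring_scope.

(** The points of [closure Om1] and of the boundary of [Om] differ by elements
    of [G], where the kernel [h] is smooth with Roumieu bounds; elsewhere [h] is
    only integrable over a cell. The potential is therefore split by a cutoff.
    Let [D] be the periodic open set that carries the density, [S[Om]] or its
    exterior, and let [O] be a small neighborhood of the boundary of [Om]. There
    is a periodic function [chi] of class C^1, supported in [D] and equal to 1 on
    the part of [D] that lies in the cell off [O] ([periodic_cutoff]). Then
    << int h(x-y) phi(y) dy = int h(x-y) (chi phi)(y) dy
                              + int_O h(x-y) ((1-chi) phi)(y) dy. >>
    In the first term the density is periodic and of class C^1 on the whole
    space, so translation invariance of the integral over the cell moves a
    derivative from [h] to [chi phi] ([conv_is_derive]). In the second term, for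
    [x] near [closure Om1], the differences [x - y] stay in [G] and the derivative
    acts on [h] ([smooth_conv_is_derive]). A derivative that falls on [chi]
    produces an integral over [O] as well, in which all the following derivatives
    act on [h]. Along a word [w] of coordinate directions this gives
    << D_w P = int h(x-y) chi D_w phi
               + sum_(w = u ++ k :: v) int_O (D_u h)(x-y) (d_k chi) D_v phi
               + int_O (D_w h)(x-y) (1-chi) phi, >>
    so that no surface integral and no regularity of the boundary are needed, and
    one derivative of the cutoff is enough at every order.

    The Roumieu bounds of [h] and [phi] bound the factors of the middle terms by
    [|u|! / rho^|u|] and [|v|! / rho^|v|] with [|u| + |v| = |w| - 1]. As
    [|u|! |v|! <= (|w| - 1)!], the sum of the [|w|] terms is bounded by
    [|w| (|w| - 1)! / rho^(|w| - 1)], that is, by [rho] times the required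
    [|w|! / rho^|w|] ([potential_bound]). The resulting estimate is bilinear in
    the norms of the kernel and of the density ([potential_estimate]).
    Continuity follows by applying it to
    << B(u,v) - B(u0,v0) = B(u-u0,v-v0) + B(u-u0,v0) + B(u0,v-v0). >>

    A multi-index is spelled as a nondecreasing word of coordinate indices, so
    that prefixes and suffixes of such a word are again multi-indices and the
    order of differentiation never has to be changed. The kernel is integrable
    because [lambda < n - 1] ([kernel_integral_bound]). *)

(** * Complex numbers as a real normed space *)

Section Rcomplex_facts.
Variable R : realType.
Local Notation C := (Rcomplex R).
Implicit Types z w : C.

Lemma Rcomplex_normE z : `|z| = Num.sqrt (complex.Re z ^+ 2 + complex.Im z ^+ 2).
Proof. by case: z. Qed.

Lemma Rcomplex_normM z w : `|z * w : C| = `|z| * `|w|.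
Proof.
rewrite !Rcomplex_normE -sqrtrM ?addr_ge0 ?sqr_ge0//; congr Num.sqrt.
by case: z w => [a b] [c d] /=; ring.
Qed.

Lemma norm_Re_le z : `|complex.Re z| <= `|z|.
Proof. by rewrite Rcomplex_normE -sqrtr_sqr ler_wsqrtr// lerDl sqr_ge0. Qed.

Lemma norm_Im_le z : `|complex.Im z| <= `|z|.
Proof. by rewrite Rcomplex_normE -sqrtr_sqr ler_wsqrtr// lerDr sqr_ge0. Qed.

Lemma Rcomplex_norm_le z : `|z| <= `|complex.Re z| + `|complex.Im z|.
Proof.
rewrite Rcomplex_normE -[leRHS]ger0_norm ?addr_ge0// -sqrtr_sqr ler_wsqrtr//.
rewrite sqrrD !real_normK ?num_real//.
have := mulr_ge0 (normr_ge0 (complex.Re z)) (normr_ge0 (complex.Im z)).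
by set a := _ * _; lra.
Qed.

Lemma Re_mul z w :
  complex.Re (z * w) = complex.Re z * complex.Re w - complex.Im z * complex.Im w.
Proof. by case: z w => [a b] [c d]. Qed.

Lemma Im_mul z w :
  complex.Im (z * w) = complex.Re z * complex.Im w + complex.Im z * complex.Re w.
Proof. by case: z w => [a b] [c d] /=; rewrite [LHS]addrC addrC. Qed.

Lemma Re_scale (a : R) z : complex.Re (a *: z) = a * complex.Re z.
Proof. by case: z. Qed.

Lemma Im_scale (a : R) z : complex.Im (a *: z) = a * complex.Im z.
Proof. by case: z. Qed.

Lemma Re_add z w : complex.Re (z + w) = complex.Re z + complex.Re w.
Proof. by case: z w => [a b] [c d]. Qed.

Lemma Im_add z w : complex.Im (z + w) = complex.Im z + complex.Im w.
Proof. by case: z w => [a b] [c d]. Qed.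

Lemma Re_opp z : complex.Re (- z) = - complex.Re z.
Proof. by case: z. Qed.

Lemma Im_opp z : complex.Im (- z) = - complex.Im z.
Proof. by case: z. Qed.

Lemma Rcomplex_scaleAl (a : R) z w : a *: (z * w) = (a *: z) * w.
Proof. by case: z w => [x y] [c d]; congr Complex => /=; ring. Qed.

Lemma Rcomplex_scaleAr (a : R) z w : a *: (z * w) = z * (a *: w).
Proof. by case: z w => [x y] [c d]; congr Complex => /=; ring. Qed.

Lemma continuous_Re (T : topologicalType) (f : T -> C) (x : T) :
  {for x, continuous f} -> {for x, continuous (fun y => complex.Re (f y))}.
Proof.
move=> /cvgrPdist_lt cf; apply/cvgrPdist_lt => e e0; near=> w.
rewrite -Re_opp -Re_add (le_lt_trans (norm_Re_le _))//.
by near: w; exact: cf.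
Unshelve. all: end_near. Qed.

Lemma continuous_Im (T : topologicalType) (f : T -> C) (x : T) :
  {for x, continuous f} -> {for x, continuous (fun y => complex.Im (f y))}.
Proof.
move=> /cvgrPdist_lt cf; apply/cvgrPdist_lt => e e0; near=> w.
rewrite -Im_opp -Im_add (le_lt_trans (norm_Im_le _))//.
by near: w; exact: cf.
Unshelve. all: end_near. Qed.

End Rcomplex_facts.

(** * Uniformity on compact sets and directional derivatives *)

Lemma continuous_atP (R : realType) (V W : normedModType R) (f : V -> W) (x : V) :
  {for x, continuous f} <-> forall e : R, 0 < e ->
  exists2 d : R, 0 < d & forall v, `|v| < d -> `|f (x + v) - f x| <= e.
Proof.
split=> [/cvgrPdist_le cf e /cf/nbhs_ballP[d /= d0 dP]|H].
  exists d => // v vd; rewrite distrC; apply: dP.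
  by rewrite -ball_normE /ball_/= opprD addNKr normrN.
apply/cvgrPdist_le => e /H[d d0 dP]; apply/nbhs_ballP; exists d => // y.
rewrite -ball_normE /ball_/= distrC => xy.
by rewrite distrC -(subrKC x y); apply: dP.
Qed.

Section compact_uniform.
Variables (R : realType) (n : nat).
Local Notation V := 'rV[R]_n.
Local Notation C := (Rcomplex R).
Implicit Types (f : V -> C) (K U : set V).

(** A compact subset of an open set has a uniform neighborhood in it. *)
Lemma compact_open_uniform K U : compact K -> open U -> K `<=` U ->
  exists2 d : R, 0 < d & forall y v, K y -> `|v| < d -> U (y + v).
Proof.
move=> /compact_near_coveringP cK oU KU.
have /nbhs_ballP[d /= d0 dP] : nbhs (0 : V) [set v | K `<=` (fun y => U (y + v))].
  apply: (cK V (nbhs (0 : V)) (fun v y => U (y + v))).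
  move=> x Kx; have : nbhs (x + 0) U by rewrite addr0; apply: open_nbhs_nbhs; split=> //; exact: KU.
  move/(@add_continuous V (x, 0)) => [[A B] /= [Ax B0] AB].
  exists (A, B); first by split.
  move=> [a b] [/= Aa Bb].
  by have := AB (a, b); apply.
exists d => // y v Ky vd.
by apply: (dP v) => //; rewrite -ball_normE /ball_/= sub0r normrN.
Qed.

Lemma compact_uniform_continuous K f : compact K ->
  (forall x, K x -> {for x, continuous f}) ->
  forall e : R, 0 < e -> exists2 d : R, 0 < d &
    forall y v, K y -> `|v| < d -> `|f (y + v) - f y| <= e.
Proof.
move=> /compact_near_coveringP cK cf e e0.
have /nbhs_ballP[d /= d0 dP] :
    nbhs (0 : V) [set v | K `<=` (fun y => `|f (y + v) - f y| <= e)].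
  apply: (cK V (nbhs (0 : V)) (fun v y => `|f (y + v) - f y| <= e)).
  move=> x Kx; have /cvgrPdist_lt/(_ (e / 2)) := cf x Kx.
  rewrite divr_gt0// => /(_ isT) fx.
  have : nbhs (x + 0) [set t | `|f x - f t| < e / 2] by rewrite addr0.
  move/(@add_continuous V (x, 0)) => [[A B] /= [Ax B0] AB].
  exists (A `&` [set t | `|f x - f t| < e / 2], B).
    by split => //; apply: filterI.
  move=> [a b] /= [[Aa fa] Bb]; have /= fab := AB (a, b) (conj Aa Bb).
  rewrite -[X in `|X|](subrKA (f x)) (le_trans (ler_normD _ _))//.
  by rewrite (splitr e) lerD// ltW// distrC.
exists d => // y v Ky vd.
by apply: (dP v) => //; rewrite -ball_normE /ball_/= sub0r normrN.
Qed.

Lemma compact_norm_bounded K f : compact K ->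
  (forall x, K x -> {for x, continuous f}) ->
  exists M : R, forall y, K y -> `|f y| <= M.
Proof.
move=> /compact_near_coveringP cK cf.
have [M [_ MP]] : \forall M \near +oo%R, K `<=` (fun y => `|f y| <= M).
  apply: (cK R +oo%R (fun M y => `|f y| <= M)).
  move=> x Kx; have /cvgrPdist_lt/(_ 1 ltr01) fx := cf x Kx.
  exists ([set t | `|f x - f t| < 1], [set M | `|f x| + 1 <= M]).
    by split=> //; apply: nbhs_pinfty_ge; rewrite num_real.
  move=> [a b] /= [fa]; apply: le_trans.
  rewrite -[X in `|X|](subrK (f x)) (le_trans (ler_normD _ _))// addrC lerD2l.
  by rewrite distrC ltW.
exists (M + 1) => y Ky.
by apply: MP => //; rewrite ltrDl.
Qed.

End compact_uniform.

(** A directional derivative as a first order expansion along the line. *)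
Lemma is_deriveP (R : realType) (V W : normedModType R) (f : V -> W) (x v : V)
    (c : W) : is_derive x v f c <->
  forall e : R, 0 < e -> exists2 d : R, 0 < d &
    forall t, `|t| < d -> `|f (x + t *: v) - f x - t *: c| <= e * `|t|.
Proof.
have E (t : R) (b : W) : t != 0 ->
    `|t^-1 *: (f (t *: v + x) - f x) - b| = `|t|^-1 * `|f (x + t *: v) - f x - t *: b|.
  move=> t0; rewrite -[X in _ - X](scalerK t0 b) -scalerBr normrZ normfV.
  by rewrite [t *: v + x]addrC.
split.
  move=> [dfx <-] e e0; move: dfx => /cvg_ex[l]; rewrite -[derive _ _ _]/(lim _).
  move=> fl; rewrite (cvg_lim _ fl)//.
  have /cvgrPdist_lt/(_ e e0) := fl.
  move=> [d /= d0 dP]; exists d => // t td.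
  have [->|t0] := eqVneq t 0; first by rewrite !scale0r addr0 subrr subr0 !normr0 mulr0.
  have : `|t^-1 *: (f (t *: v + x) - f x) - l| < e.
    by rewrite distrC; apply: dP => //=; rewrite /ball_ sub0r normrN.
  rewrite E// => /ltW; rewrite ler_pdivrMl ?normr_gt0//.
  by rewrite mulrC.
move=> H.
have fl : (fun t => t^-1 *: ((f \o shift x) (t *: v) - f x)) t @[t --> 0^'] --> c.
  apply/cvgrPdist_le => e e0; have [d d0 dP] := H e e0.
  exists d => // t td0 t0.
  have td : `|t| < d by move: td0; rewrite /ball_/= sub0r normrN.
  rewrite distrC -[leLHS]/(`|t^-1 *: (f (t *: v + x) - f x) - c|).
  rewrite E// ler_pdivrMl ?normr_gt0// mulrC; exact: dP.
split; first by apply/cvg_ex; exists c.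
exact: cvg_lim fl.
Qed.

Section directional.
Variables (R : realType) (n : nat).
Local Notation V := 'rV[R]_n.
Local Notation C := (Rcomplex R).
Implicit Types (f g : V -> C) (x v : V) (c : C).

Lemma is_derive_near f g x v c (d : R) : 0 < d ->
  (forall y, `|y - x| < d -> f y = g y) -> is_derive x v f c ->
  is_derive x v g c.
Proof.
move=> d0 fg /is_deriveP fc; apply/is_deriveP => e e0.
have [d1 d10 H] := fc e e0.
have v0 : 0 < `|v| + 1 by rewrite ltr_wpDl.
exists (Num.min d1 (d / (`|v| + 1))); first by rewrite lt_min d10 divr_gt0.
move=> t; rewrite lt_min => /andP[t1 t2].
rewrite -!fg; first exact: H.
  by rewrite subrr normr0.
rewrite addrC addKr normrZ (@le_lt_trans _ _ (`|t| * (`|v| + 1)))//.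
  by rewrite ler_wpM2l// lerDl.
by rewrite -ltr_pdivlMr.
Qed.

Lemma is_derive_cvg (W : normedModType R) (f : V -> W) x v (c : W) :
  is_derive x v f c <->
  (fun t : R => t^-1 *: (f (t *: v + x) - f x)) t @[t --> 0^'] --> c.
Proof.
split=> [[dfx <-]|fl]; last first.
  by split; [apply/cvg_ex; exists c|exact: cvg_lim fl].
move: dfx => /cvg_ex[l]; rewrite -[derive _ _ _]/(lim _) => fl.
by rewrite (cvg_lim _ fl).
Qed.

Lemma is_derive_scaleM (chi : V -> R) f x v (a : R) c :
  {for x, continuous chi} ->
  is_derive x v chi a -> is_derive x v f c ->
  is_derive x v (fun y => chi y *: f y) (chi x *: c + a *: f x).
Proof.
move=> chix /is_derive_cvg ca /is_derive_cvg cc; apply/is_derive_cvg.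
rewrite [X in X @ _ --> _](_ : _ = fun t : R =>
    chi (t *: v + x) *: (t^-1 *: (f (t *: v + x) - f x)) +
    (t^-1 *: (chi (t *: v + x) - chi x)) *: f x); last first.
  apply/funext => t; rewrite scalerA [chi _ * _]mulrC -scalerA -[_ *: _ *: f x]scalerA.
  by rewrite -scalerDr; congr (_ *: _); rewrite scalerBr scalerBl subrKA.
apply: cvgD; apply: cvgZ => //; last exact: cvg_cst.
apply: (@cvg_comp _ _ _ (fun t : R => t *: v + x) chi _ (nbhs x)) => //.
have : (fun t : R => t *: v + x) t @[t --> 0] --> 0 *: v + x.
  by apply: cvgD; [apply: cvgZ; [exact: cvg_id|exact: cvg_cst]|exact: cvg_cst].
by rewrite scale0r add0r; apply: cvg_within_filter.
Qed.

(** The mean value inequality; the factor 2 comes from treating real and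
    imaginary parts separately. *)
Lemma mean_value_ineq f x v c (e t : R) :
  (forall s, `|s| <= `|t| -> derivable f (x + s *: v) v /\
     `|'D_v f (x + s *: v) - c| <= e) ->
  `|f (x + t *: v) - f x - t *: c| <= 2 * e * `|t|.
Proof.
move=> H.
have der (s : R) : `|s| <= `|t| ->
    is_derive (x + s *: v) v f ('D_v f (x + s *: v)).
  by move=> /H[? _]; split.
have rl (p : C -> R) : (forall y z, p (y + z) = p y + p z) ->
    (forall a z, p (a *: z) = a * p z) -> (forall z, `|p z| <= `|z|) ->
    `|p (f (x + t *: v) - f x - t *: c)| <= e * `|t|.
  move=> pD pZ pn.
  have pB y z : p (y - z) = p y - p z by rewrite pD -scaleN1r pZ mulN1r.
  pose g (s : R) := p (f (x + s *: v)) - s * p c.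
  pose dg (s : R) := p ('D_v f (x + s *: v) - c).
  have gd (s : R) : `|s| <= `|t| -> is_derive s 1 g (dg s).
    move=> st; have /is_deriveP fd := der _ st.
    have gE : (fun h : R => h^-1 *: (g (h *: 1 + s) - g s)) h @[h --> 0^'] --> dg s.
      apply/cvgrPdist_le => eps eps0; have [d d0 dP] := fd eps eps0.
      exists d => // h hd0 h0.
      have hd : `|h| < d by move: hd0; rewrite /ball_/= sub0r normrN.
      have hn : 0 < `|h| by rewrite normr_gt0.
      rewrite distrC -(ler_pM2r hn) -normrM.
      have -> : (h^-1 *: (g (h *: 1 + s) - g s) - dg s) * h =
          g (s + h) - g s - h * dg s.
        rewrite -[h^-1 *: _]/(h^-1 * _) -[h *: 1]/(h * 1) mulr1 [h + s]addrC.
        by field.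
      apply: le_trans (dP h hd).
      apply: le_trans (pn _).
      rewrite /g /dg !pB pZ scalerDl addrA.
      by rewrite le_eqVlt; apply/orP; left; apply/eqP; congr `|_|; ring.
    by split; [apply/cvg_ex; exists (dg s)|exact: cvg_lim gE].
  have key (a b : R) : a < b -> `|a| <= `|t| -> `|b| <= `|t| ->
      `|g b - g a| <= e * (b - a).
    move=> ab at_ bt.
    have abt s : a <= s <= b -> `|s| <= `|t|.
      move: at_ bt; rewrite !ler_norml => /andP[? ?] /andP[? ?] /andP[? ?].
      by apply/andP; split; lra.
    have gc : {within `[a, b], continuous g}.
      apply: derivable_within_continuous => s; rewrite in_itv/= => sab.
      by have [] := gd s (abt s sab).
    have gab s : s \in `]a, b[%R -> is_derive s 1 g (dg s).
      by rewrite in_itv/= => /andP[? ?]; apply: gd; apply: abt; rewrite !ltW.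
    have [s sab ->] := MVT ab gab gc.
    have ba : 0 <= b - a by rewrite subr_ge0 ltW.
    rewrite normrM (ger0_norm ba) ler_wpM2r//; apply: le_trans (pn _) _.
    apply: (H s _).2; apply: abt; move: sab; rewrite in_itv/= => /andP[? ?].
    by rewrite !ltW.
  have -> : p (f (x + t *: v) - f x - t *: c) = g t - g 0.
    by rewrite /g !pB pZ scale0r addr0 mul0r subr0; ring.
  have [t0|t0|<-] := ltgtP 0 t.
  - by rewrite (le_trans (key 0 t _ _ _)) ?normr0// subr0 ger0_norm// ltW.
  - rewrite distrC (le_trans (key t 0 _ _ _)) ?normr0// sub0r ltr0_norm//.
  - by rewrite subrr !normr0 mulr0.
rewrite (le_trans (Rcomplex_norm_le _))// -mulrA mulr2n [leRHS]mulrDl mul1r.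
apply: lerD; apply: rl.
- exact: Re_add.
- exact: Re_scale.
- exact: norm_Re_le.
- exact: Im_add.
- exact: Im_scale.
- exact: norm_Im_le.
Qed.

End directional.

(** * Iterated partial derivatives *)

Section words.
Variables (R : realType) (n : nat).
Local Notation V := 'rV[R]_n.
Local Notation C := (Rcomplex R).
Local Notation e_ j := (delta_mx 0 j : 'rV[R]_n).
Implicit Types (f g : V -> C) (U : set V) (w : seq 'I_n) (x : V).

(** The derivative along a word of coordinate indices, the last letter acting
    first. *)
Definition wderiv w f : V -> C := foldr (@partial R n) f w.

(** Smoothness on [U]: every iterated partial derivative, in any order of
    differentiation, is continuous and partially derivable on [U]. *)
Definition csmooth U f := forall w x, U x ->
  {for x, continuous (wderiv w f)} /\
  forall j, derivable (wderiv w f) x (e_ j).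

Lemma wderiv_rcons w j f : wderiv w (partial j f) = wderiv (rcons w j) f.
Proof. by rewrite /wderiv -cats1 foldr_cat. Qed.

Lemma csmoothP U f : csmooth U f <-> forall m, class_C m U f.
Proof.
split=> [H m|].
  elim: m f H => [|m IH] f H /=.
    by split => // x Ux; have [] := H [::] x Ux.
  split=> [x Ux|j]; first by have [] := H [::] x Ux.
  split=> [x Ux|]; first by have [_] := H [::] x Ux; apply.
  by apply: IH => w x Ux; rewrite wderiv_rcons; apply: H.
move=> H w; elim/last_ind: w f H => [|w j IH] f H x Ux.
  have /= [cf df] := H 1%N; split; first exact: cf.
  by move=> j; apply: (df j).1.
rewrite -wderiv_rcons; apply: IH => // m.
by have /= [_ /(_ j)[]] := H m.+1.
Qed.

Lemma is_derive_wderiv U f w j x : csmooth U f -> U x ->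
  is_derive x (e_ j) (wderiv w f) (wderiv (j :: w) f x).
Proof. by move=> H Ux; have [_ /(_ j) ?] := H w x Ux; split. Qed.

Lemma csmooth_cont U f w x : csmooth U f -> U x ->
  {for x, continuous (wderiv w f)}.
Proof. by move=> H Ux; have [] := H w x Ux. Qed.

Lemma csmooth_sub U U' f : U' `<=` U -> csmooth U f -> csmooth U' f.
Proof. by move=> UU H w x /UU; apply: H. Qed.

Lemma open_ball_sub U x : open U -> U x ->
  exists2 d : R, 0 < d & forall y, `|y - x| < d -> U y.
Proof.
move=> oU Ux; have /nbhs_ballP[d /= d0 dP] : nbhs x U by apply: open_nbhs_nbhs.
by exists d => // y yx; apply: dP; rewrite -ball_normE /ball_/= distrC.
Qed.

Lemma continuous_near_eq (W : normedModType R) U (f g : V -> W) x : open U -> U x ->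
  (forall y, U y -> f y = g y) -> {for x, continuous f} -> {for x, continuous g}.
Proof.
move=> oU Ux fg /continuous_atP cf; apply/continuous_atP => e /cf[d d0 dP].
have [d' d'0 Ud'] := open_ball_sub oU Ux.
exists (Num.min d d'); first by rewrite lt_min d0.
move=> v; rewrite lt_min => /andP[vd vd']; rewrite -!fg//; first exact: dP.
by apply: Ud'; rewrite addrC addKr.
Qed.

(** A family of continuous functions indexed by words, each obtained from the
    preceding ones by one differentiation, is the family of all derivatives of
    its first member. *)
Lemma csmooth_family U (F : seq 'I_n -> V -> C) : open U ->
  (forall w x, U x -> {for x, continuous (F w)}) ->
  (forall w j x, U x -> is_derive x (e_ j) (F w) (F (j :: w) x)) ->
  csmooth U (F [::]) /\ forall w x, U x -> wderiv w (F [::]) x = F w x.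
Proof.
move=> oU Fc Fd.
have E w : forall x, U x -> wderiv w (F [::]) x = F w x.
  elim: w => [//|j w IH] x Ux.
  have [d d0 dU] := open_ball_sub oU Ux.
  have [_ <-] : is_derive x (e_ j) (wderiv w (F [::])) (F (j :: w) x) => //.
  by apply: (is_derive_near d0 _ (Fd w j x Ux)) => y /dU Uy; rewrite IH.
split=> // w x Ux; split.
  by apply: (continuous_near_eq oU Ux _ (Fc w x Ux)) => y Uy; rewrite E.
have [d d0 dU] := open_ball_sub oU Ux.
move=> j; have [] // : is_derive x (e_ j) (wderiv w (F [::])) (F (j :: w) x).
by apply: (is_derive_near d0 _ (Fd w j x Ux)) => y /dU Uy; rewrite E.
Qed.

Lemma csmooth_eq U f g : open U -> (forall x, U x -> f x = g x) ->
  csmooth U f -> csmooth U g /\ forall w x, U x -> wderiv w g x = wderiv w f x.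
Proof.
move=> oU fg sf; pose F w := if w is [::] then g else wderiv w f.
have FE w x : U x -> F w x = wderiv w f x.
  by case: w => [|j w] //= /fg ->.
have [] // := @csmooth_family U F oU.
- move=> w x Ux; apply: (continuous_near_eq oU Ux _ (csmooth_cont sf Ux)).
  by move=> y Uy; rewrite FE.
- move=> w j x Ux; have [d d0 dU] := open_ball_sub oU Ux.
  apply: (is_derive_near d0 _ (is_derive_wderiv w j sf Ux)) => y /dU Uy.
  by rewrite FE.
- by move=> sF E; split=> // w x Ux; rewrite E// FE.
Qed.

Lemma csmoothD U f g : open U -> csmooth U f -> csmooth U g ->
  csmooth U (f \+ g) /\
  forall w x, U x -> wderiv w (f \+ g) x = wderiv w f x + wderiv w g x.
Proof.
move=> oU sf sg.
apply: (@csmooth_family U (fun w => wderiv w f \+ wderiv w g) oU).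
- move=> w x Ux; apply: (@continuousD _ C V).
    exact: csmooth_cont sf Ux.
  exact: csmooth_cont sg Ux.
- move=> w j x Ux; apply: is_deriveD; exact: is_derive_wderiv Ux.
Qed.

Lemma csmoothB U f g : open U -> csmooth U f -> csmooth U g ->
  csmooth U (f \- g) /\
  forall w x, U x -> wderiv w (f \- g) x = wderiv w f x - wderiv w g x.
Proof.
move=> oU sf sg.
apply: (@csmooth_family U (fun w => wderiv w f \- wderiv w g) oU).
- move=> w x Ux; apply: (@continuousB _ C V).
    exact: csmooth_cont sf Ux.
  exact: csmooth_cont sg Ux.
- move=> w j x Ux; apply: is_deriveB; exact: is_derive_wderiv Ux.
Qed.

(** The nondecreasing word that spells a multi-index. *)
Definition mword (beta : 'I_n -> nat) : seq 'I_n :=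
  flatten [seq nseq (beta j) j | j <- enum 'I_n].

(** Nondecreasing words, which correspond to multi-indices. *)
Definition ord_sorted w := sorted (fun i j : 'I_n => (i <= j)%N) w.

Lemma mderivE beta f : mderiv beta f = wderiv (mword beta) f.
Proof.
rewrite /mderiv /mword /wderiv; elim: (enum 'I_n) => //= j s IH.
rewrite foldr_cat -IH; elim: (beta j) => //= k IHk; exact: congr1.
Qed.

Lemma size_mword beta : size (mword beta) = mlength beta.
Proof.
rewrite /mword size_flatten /shape -map_comp sumnE big_map /mlength.
by rewrite big_enum /=; apply: eq_bigr => j _; rewrite size_nseq.
Qed.

Lemma mword_sorted beta : ord_sorted (mword beta).
Proof.
rewrite /ord_sorted sorted_pairwise; last by move=> i j k; apply: leq_trans.
have : pairwise (fun i j : 'I_n => (i <= j)%N) (enum 'I_n).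
  rewrite -sorted_pairwise; last by move=> i j k; apply: leq_trans.
  have := iota_sorted 0 n; rewrite -val_enum_ord sorted_map.
  by apply: sub_sorted.
rewrite /mword; elim: (enum 'I_n) => //= j s IH /andP[js ps].
rewrite pairwise_cat IH// andbT; apply/andP; split.
  apply/allrelP => a b; rewrite mem_nseq => /andP[_ /eqP ->].
  move=> /flattenP[_ /mapP[i si ->]]; rewrite mem_nseq => /andP[_ /eqP ->].
  exact: (allP js).
elim: (beta j) => //= k ->; rewrite andbT; apply/allP => b.
by rewrite mem_nseq => /andP[_ /eqP ->].
Qed.

Lemma count_mword beta j : count_mem j (mword beta) = beta j.
Proof.
rewrite /mword count_flatten sumnE -map_comp big_map big_enum/=.
rewrite (bigD1 j)//= count_nseq /= eqxx mul1n big1 ?addn0// => i ij.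
by rewrite count_nseq /= (negbTE ij) mul0n.
Qed.

(** A sorted word is the spelling of the multi-index counting its letters. *)
Lemma sorted_mword w : ord_sorted w -> w = mword (fun j => count_mem j w).
Proof.
move=> sw; apply: (@sorted_eq _ (fun i j : 'I_n => (i <= j)%N)) => //.
- by move=> i j k; apply: leq_trans.
- by move=> i j /anti_leq/val_inj.
- exact: mword_sorted.
- by apply/allP => j _ /=; rewrite count_mword.
Qed.

(** In the Leibniz formula along a sorted word the two factors are again
    differentiated along sorted words. *)
Lemma ord_sorted_infix w u j v : w = u ++ j :: v -> ord_sorted w ->
  ord_sorted u /\ ord_sorted v.
Proof.
move=> -> s; split.
  by apply: (subseq_sorted _ (prefix_subseq u (j :: v))) s => i k l; apply: leq_trans.
apply: (@subseq_sorted _ _ _ v (u ++ j :: v)) s => [i k l|]; first exact: leq_trans.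
by rewrite (subseq_trans (subseq_cons v j))// suffix_subseq.
Qed.

(** ** Periodic functions *)

Variable q : 'I_n -> R.

(** Periodicity on the whole space. *)
Definition per f := forall x z, f (x + qmul q z) = f x.

Lemma qmulN z : qmul q (- z) = - qmul q z.
Proof. by apply/rowP => i; rewrite !mxE rmorphN mulrN. Qed.

Lemma qmulD z z' : qmul q (z + z') = qmul q z + qmul q z'.
Proof. by apply/rowP => i; rewrite !mxE rmorphD mulrDr. Qed.

Lemma qmul0 : qmul q 0 = 0.
Proof. by apply/rowP => i; rewrite !mxE mulr0. Qed.

Lemma periodizationP U x :
  periodization q U x <-> exists z, U (x - qmul q z).
Proof.
split=> [[z _ [y Uy <-]]|[z Uz]]; first by exists z; rewrite addrAC subrr add0r.
by exists z => //; exists (x - qmul q z) => //; rewrite addrC subrK.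
Qed.

Lemma per_partial f j : per f -> per (partial j f).
Proof.
move=> pf x z; rewrite /partial /derive; set F := (X in lim (X @ _)).
suff -> : F = fun h : R => h^-1 *: ((f \o shift x) (h *: delta_mx 0 j) - f x).
  by [].
by apply/funext => h; rewrite /F /= addrA !pf.
Qed.

Lemma per_wderiv f w : per f -> per (wderiv w f).
Proof. by move=> pf; elim: w => //= j w; apply: per_partial. Qed.

Lemma per_sub f x z : per f -> f (x - qmul q z) = f x.
Proof. by move=> pf; rewrite -[RHS](pf _ (- z)) qmulN. Qed.

Lemma per_continuous f x z : per f -> {for x - qmul q z, continuous f} ->
  {for x, continuous f}.
Proof.
move=> pf /continuous_atP cf; apply/continuous_atP => e /cf[d d0 dP].
by exists d => // v /dP; rewrite addrAC !per_sub.
Qed.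

Lemma per_csmooth U f : per f -> csmooth U f -> csmooth (periodization q U) f.
Proof.
move=> pf sf w x /periodizationP[z Uz]; have [cf df] := sf w _ Uz; split.
  exact: per_continuous (per_wderiv w pf) cf.
move=> j; rewrite /derivable; set F := (X in cvg (X @ _)).
suff -> : F = fun h : R => h^-1 *: ((wderiv w f \o shift (x - qmul q z))
    (h *: delta_mx 0 j) - wderiv w f (x - qmul q z)).
  exact: df j.
by apply/funext => h; rewrite /F /= addrA !(per_sub _ _ (per_wderiv w pf)).
Qed.

Lemma open_periodization U : open U -> open (periodization q U).
Proof.
move=> oU; rewrite openE => x /periodizationP[z Uz].
have [d d0 dP] := open_ball_sub oU Uz.
apply/nbhs_ballP; exists d => // y; rewrite -ball_normE /ball_/= distrC => xy.
by apply/periodizationP; exists z; apply: dP; rewrite opprB addrA subrK.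
Qed.

(** On the closure of [U] the continuous extension of a derivative is the
    derivative itself when the function is smooth around the closure. *)
Lemma cl_derivE U U' beta f x : csmooth U' f -> U' x -> closure U x ->
  cl_deriv U beta f x = mderiv beta f x.
Proof.
move=> sf Ux cx; rewrite /cl_deriv mderivE.
have P := @within_nbhs_proper _ U x cx.
apply: cvg_lim; first exact: norm_hausdorff.
by apply: cvg_within_filter; exact: (csmooth_cont sf Ux).
Qed.

End words.

(** * Lebesgue measure on R^n *)

Section measurability.
Variables (R : realType) (n : nat).
Local Notation V := 'rV[R]_n.
Local Notation T := (n.-tuple (measurableTypeR R)).
Local Notation vot := (@vec_of_tuple R n).
Local Notation leb := (lebesgue_tuple R n).
Implicit Types (U D : set V).

Lemma vec_of_tupleE (t : T) i : vot t ord0 i = tnth t i.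
Proof. by rewrite mxE. Qed.

Lemma measurable_coord_preimage (i : 'I_n) (B : set (measurableTypeR R)) :
  measurable B -> measurable [set t : T | B (tnth t i)].
Proof. by move=> mB; rewrite -[X in measurable X]setTI; exact: measurable_tnth. Qed.

Lemma measurable_tuple_box (A : 'I_n -> set (measurableTypeR R)) :
  (forall i, measurable (A i)) -> measurable [set t : T | forall i, A i (tnth t i)].
Proof.
move=> mA; rewrite (_ : mkset _ = \bigcap_(i in setT) [set t : T | A i (tnth t i)]).
  apply: fin_bigcap_measurable => [|i _]; first exact: finite_finset.
  exact: measurable_coord_preimage.
by apply/seteqP; split=> [t tA i _|t tA i]; exact: tA.
Qed.

(** An open set is a countable union of boxes with rational endpoints. *)
Lemma open_measurable_vec U : open U -> measurable (vot @^-1` U).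
Proof.
move=> oU.
pose B (c : {ffun 'I_n -> rat * rat}) : set V :=
  [set x | forall i, x ord0 i \in `](ratr (c i).1 : R), ratr (c i).2[].
have mB c : measurable (vot @^-1` B c).
  rewrite (_ : _ @^-1` _ = [set t : T | forall i,
      `](ratr (c i).1 : R), ratr (c i).2[%classic (tnth t i)]).
    apply: (@measurable_tuple_box (fun i => `](ratr (c i).1 : R), ratr (c i).2[%classic)).
    by move=> i; exact: measurable_itv.
  by apply/seteqP; split=> t /= Bt i; have := Bt i; rewrite vec_of_tupleE.
rewrite (_ : _ @^-1` _ = \bigcup_c (if `[< B c `<=` U >] then vot @^-1` B c else set0)).
  apply: (@countable_bigcupT_measurable _ _ {ffun 'I_n -> rat * rat}).
    exact: countableP.
  by move=> c; case: ifP.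
apply/seteqP; split=> [t /= Ut|t [c _]]; last by case: asboolP => // cU /cU.
have [d d0 dU] := open_ball_sub oU Ut.
have ex i : exists c : rat * rat, [/\ tnth t i - d < ratr c.1, ratr c.1 < tnth t i,
    tnth t i < ratr c.2 & ratr c.2 < tnth t i + d].
  have /rat_in_itvoo[a] : tnth t i - d < tnth t i by rewrite ltrBlDr ltrDl.
  have /rat_in_itvoo[b] : tnth t i < tnth t i + d by rewrite ltrDl.
  by rewrite !in_itv/= => /andP[? ?] /andP[? ?]; exists (a, b).
have [c cP] := choice ex; exists [ffun i => c i] => //.
rewrite asboolT/=.
  by move=> i; rewrite ffunE vec_of_tupleE in_itv/=; have [_ -> ->] := cP i.
move=> y By; apply: dU; rewrite /Num.norm/= mx_normrE.
apply/bigmax_ltP; split=> //= -[a i] _; rewrite !mxE/= ord1.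
have := By i; rewrite ffunE in_itv/= => /andP[]; have [] := cP i.
rewrite ltr_norml; move=> *; apply/andP; split; lra.
Qed.

Lemma continuous_measurable_vec U (f : V -> R) : open U ->
  (forall x, U x -> {for x, continuous f}) ->
  measurable_fun (vot @^-1` U) (f \o vot).
Proof.
move=> oU cf; apply: (measurability _ (RGenOInfty.measurableE R)).
move=> _ [_ [a ->] <-].
rewrite (_ : _ `&` _ = vot @^-1` (U `&` f @^-1` `]a, +oo[%classic)).
  apply: (@open_measurable_vec (U `&` f @^-1` `]a, +oo[%classic)).
  rewrite openE => x [Ux fx].
  apply: filterI; first exact: open_nbhs_nbhs.
  by apply: (cf x Ux); apply: open_nbhs_nbhs; split => //; exact: interval_open.
by apply/seteqP; split.
Qed.

End measurability.

Section product_maps.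
Variable R : realType.
Local Notation T := (measurableTypeR R).

(** Coordinatewise application of maps of the line. *)
Definition tuple_map n (tau : 'I_n -> T -> T) (t : n.-tuple T) : n.-tuple T :=
  [tuple tau i (tnth t i) | i < n].

Lemma measurable_tuple_map n (tau : 'I_n -> T -> T) :
  (forall i, measurable_fun setT (tau i)) -> measurable_fun setT (tuple_map tau).
Proof.
move=> mt; apply/measurable_fun_tnthP => i.
rewrite (_ : _ \o _ = fun t : n.-tuple T => tau i (tnth t i)).
  by apply: measurableT_comp (mt i) _; exact: measurable_tnth.
by apply/funext => t /=; rewrite tnth_mktuple.
Qed.

(** Applying a measure preserving map of the line to each coordinate preserves
    Lebesgue measure, by uniqueness of the product measure. *)
Lemma lebesgue_tuple_map n (tau : 'I_n -> T -> T) :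
  (forall i, measurable_fun setT (tau i)) ->
  (forall i A, measurable A -> lebesgue_measure (tau i @^-1` A) = lebesgue_measure A) ->
  forall A, measurable A ->
  lebesgue_tuple R n (tuple_map tau @^-1` A) = lebesgue_tuple R n A.
Proof.
elim: n tau => [|n IH] tau mt pt A mA.
  rewrite (_ : tuple_map tau = id) ?preimage_id//.
  by apply/funext => t; rewrite [LHS]tuple0 [RHS]tuple0.
pose tau' i := tau (lift ord0 i).
pose S (p : T * n.-tuple T) := (tau ord0 p.1, tuple_map tau' p.2).
have mS : measurable_fun setT S.
  apply/measurable_fun_pairP; split.
    by apply: measurableT_comp (mt _) _; exact: measurable_fst.
  apply: measurableT_comp (measurable_tuple_map _) _; last exact: measurable_snd.
  by move=> i; exact: mt.
have mcA : measurable (@tuple_cons R n @^-1` A).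
  by rewrite -[X in measurable X]setTI; exact: measurable_tuple_cons.
have E p : tuple_map tau (tuple_cons p) = tuple_cons (S p).
  case: p => x t; apply/eq_from_tnth => i; rewrite tnth_mktuple.
  by case: (unliftP ord0 i) => [j|] ->; rewrite /tuple_cons/= ?tnthS ?tnth_mktuple.
rewrite /= /lebesgue_tupleS /pushforward.
rewrite (_ : _ @^-1` (_ @^-1` A) = S @^-1` (@tuple_cons R n @^-1` A)); last first.
  apply/seteqP; split=> p.
    by change (A (tuple_map tau (tuple_cons p)) -> A (tuple_cons (S p))); rewrite E.
  by change (A (tuple_cons (S p)) -> A (tuple_map tau (tuple_cons p))); rewrite E.
pose m' : {measure set (T * n.-tuple T) -> \bar R} :=
  measure_function_pushforward__canonical__measure_function_Measure
    (lebesgue_measure \x lebesgue_tuple R n)%E mS.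
apply/esym; apply: (product_measure_unique (m' := m')) => // B D mB mD.
rewrite /m' /= /pushforward.
rewrite (_ : _ @^-1` _ = (tau ord0 @^-1` B) `*` (tuple_map tau' @^-1` D)); last first.
  by apply/seteqP; split.
have mtB : measurable (tau ord0 @^-1` B).
  by rewrite -[X in measurable X]setTI; exact: mt.
have mtD : measurable (tuple_map tau' @^-1` D).
  by rewrite -[X in measurable X]setTI; apply: measurable_tuple_map => // i; exact: mt.
rewrite product_measure1E//; congr (_ * _)%E; first exact: pt.
by apply: IH => // i; [exact: mt|exact: pt].
Qed.

End product_maps.

(** * Integrals of periodic functions over a cell *)

Section line_maps.
Variable R : realType.
Local Notation T := (measurableTypeR R).
Local Notation mu := (@lebesgue_measure R).

Lemma lebesgue_measure_shift (c : R) (A : set T) : measurable A ->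
  mu ((fun x : T => x + c) @^-1` A) = mu A.
Proof.
move=> mA.
have mf : measurable_fun setT (fun x : T => (x + c : T)).
  by apply: measurable_funD => //; exact: measurable_cst.
pose m' : {measure set T -> \bar R} :=
  measure_function_pushforward__canonical__measure_function_Measure mu mf.
apply/esym; apply: (@lebesgue_measure_unique _ m') => // X [[a b] _ <-].
rewrite /m' /= /pushforward.
rewrite (_ : _ @^-1` _ = `]a - c, b - c]%classic).
  by rewrite !lebesgue_measure_itv/= !lte_fin ltrD2r -!EFinB opprB addrA subrK.
by apply/seteqP; split=> x /=; rewrite !in_itv/= ltrBlDr lerBrDr.
Qed.

Lemma lebesgue_measure_reflect (c : R) (A : set T) : measurable A ->
  mu ((fun x : T => c - x) @^-1` A) = mu A.
Proof.
move=> mA.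
have mf : measurable_fun setT (fun x : T => (c - x : T)).
  by apply: measurable_funB => //; exact: measurable_cst.
pose m' : {measure set T -> \bar R} :=
  measure_function_pushforward__canonical__measure_function_Measure mu mf.
apply/esym; apply: (@lebesgue_measure_unique _ m') => // X [[a b] _ <-].
rewrite /m' /= /pushforward.
rewrite (_ : _ @^-1` _ = `[c - b, c - a[%classic).
  rewrite !lebesgue_measure_itv/= !lte_fin ltrD2l ltrN2 -!EFinB.
  by congr (if _ then _%:E else _); ring.
by apply/seteqP; split=> x /=; rewrite !in_itv/= ltrBrDr lerBlDr => /andP[? ?];
  apply/andP; split; lra.
Qed.

(** Translation by [c] modulo [q] on [[0, q[], extended by the identity. *)
Definition modshift (q c x : R) : R :=
  if 0 <= x < q - c then x + c else if q - c <= x < q then x + (c - q) else x.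

Lemma modshift_lo (q c x : R) : 0 <= x -> x < q - c -> modshift q c x = x + c.
Proof. by move=> x0 xc; rewrite /modshift x0 xc. Qed.

Lemma modshift_hi (q c x : R) : q - c <= x -> x < q ->
  modshift q c x = x + (c - q).
Proof. by move=> xc xq; rewrite /modshift ltNge xc andbF xq. Qed.

Lemma modshift_out (q c x : R) : 0 <= c < q -> ~~ (0 <= x < q) ->
  modshift q c x = x.
Proof.
move=> /andP[c0 cq] xq; rewrite /modshift !ifF//; apply: contraNF xq => /andP[? ?];
by apply/andP; split; lra.
Qed.

Lemma modshift_in (q c x : R) : 0 <= c < q -> 0 <= x < q ->
  0 <= modshift q c x < q.
Proof.
move=> /andP[c0 cq] /andP[x0 xq]; have [xc|xc] := ltP x (q - c).
  by rewrite modshift_lo//; apply/andP; split; lra.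
by rewrite modshift_hi//; apply/andP; split; lra.
Qed.

Lemma modshift_eq (q c x : R) : 0 <= x < q ->
  exists z : int, modshift q c x = x + c + q * z%:~R.
Proof.
move=> /andP[x0 xq]; have [xc|xc] := ltP x (q - c).
  by exists 0; rewrite modshift_lo// mulr0 addr0.
by exists (-1); rewrite modshift_hi// mulrN1 addrA.
Qed.

Lemma measurable_modshift (q c : R) : measurable_fun setT (modshift q c : T -> T).
Proof.
have mD (a : R) : measurable_fun setT (fun x : T => (x + a : T)).
  by apply: measurable_funD => //; exact: measurable_cst.
have mI (a b : R) : measurable_fun setT (fun x : T => a <= x < b).
  apply: measurable_and; first exact: measurable_fun_ler.
  exact: measurable_fun_ltr.
apply: measurable_fun_ifT => //.
by apply: measurable_fun_ifT => //; exact: measurable_id.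
Qed.

(** The two half-open intervals exchanged by [modshift] are merely translated. *)
Lemma lebesgue_measure_modshift (q c : R) (A : set T) : 0 <= c < q ->
  measurable A -> mu (modshift q c @^-1` A) = mu A.
Proof.
move=> cq mA; have /andP[c0 cq'] := cq.
pose I a b : set T := `[a, b[%classic.
have mI a b : measurable (I a b) by exact: measurable_itv.
have split3 (B1 B2 B3 : set T) : measurable B1 -> measurable B2 -> measurable B3 ->
    B1 `&` B2 = set0 -> (B1 `|` B2) `&` B3 = set0 ->
    mu (B1 `|` B2 `|` B3) = (mu B1 + mu B2 + mu B3)%E.
  by move=> m1 m2 m3 d1 d2; rewrite !measureU//; exact: measurableU.
have mshift a (B : set T) : measurable B -> measurable ((fun x : T => x + a) @^-1` B).
  move=> mB; rewrite -[X in measurable X]setTI.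
  suff : measurable_fun setT (fun x : T => (x + a : T)) by apply.
  by apply: measurable_funD => //; exact: measurable_cst.
have -> : modshift q c @^-1` A = (A `\` I 0 q) `|`
    ((fun x : T => x + c) @^-1` (A `&` I c q)) `|`
    ((fun x : T => x + (c - q)) @^-1` (A `&` I 0 c)).
  apply/seteqP; split=> x.
    rewrite /I /= !in_itv/=; have [/andP[x0 xq]|xq] := boolP (0 <= x < q).
      have [xc|xc] := ltP x (q - c) => Ax.
        left; right; rewrite -(modshift_lo x0 xc); split => //.
        by rewrite modshift_lo//; apply/andP; split; lra.
      right; rewrite -(modshift_hi xc xq); split => //.
      by rewrite modshift_hi//; apply/andP; split; lra.
    by rewrite modshift_out// => Ax; left; left.
  rewrite /I /= !in_itv/= => -[[[Ax /negP]|[Ax /andP[? ?]]]|[Ax /andP[? ?]]].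
  - by move=> xq; rewrite modshift_out.
  - by rewrite modshift_lo//; lra.
  - by rewrite modshift_hi//; lra.
rewrite split3; last 5 first.
- exact: measurableD.
- by apply: mshift; exact: measurableI.
- by apply: mshift; exact: measurableI.
- apply/seteqP; split=> // x; rewrite /I /= !in_itv/= => -[[_ h] [_ /andP[? ?]]].
  by apply: h; apply/andP; split; lra.
- apply/seteqP; split=> // x; rewrite /I /= !in_itv/=.
  move=> [[[_ h]|[_ /andP[? ?]]] [_ /andP[? ?]]]; last by lra.
  by apply: h; apply/andP; split; lra.
rewrite !lebesgue_measure_shift; [|exact: measurableI..].
rewrite -split3; last 5 first.
- exact: measurableD.
- exact: measurableI.
- exact: measurableI.
- apply/seteqP; split=> // x; rewrite /I /= !in_itv/= => -[[_ h] [_ /andP[? ?]]].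
  by apply: h; apply/andP; split; lra.
- apply/seteqP; split=> // x; rewrite /I /= !in_itv/=.
  move=> [[[_ h]|[_ /andP[? ?]]] [_ /andP[? ?]]]; last by lra.
  by apply: h; apply/andP; split; lra.
congr (mu _); apply/seteqP; split=> x; rewrite /I /= !in_itv/=; first by tauto.
move=> Ax; have [xq|xq] := boolP (0 <= x < q); last by left; left; split => //; apply/negP.
move: xq => /andP[x0 xq]; have [cx|xc] := leP c x.
  by left; right; split => //; apply/andP; split.
by right; split => //; apply/andP; split.
Qed.

End line_maps.

Section periodic_integral.
Variables (R : realType) (n : nat) (q : 'I_n -> R).
Hypothesis q0 : forall i, 0 < q i.
Local Notation V := 'rV[R]_n.
Local Notation T := (n.-tuple (measurableTypeR R)).
Local Notation vot := (@vec_of_tuple R n).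
Local Notation leb := (lebesgue_tuple R n).

Lemma ge0_integral_tuple_map (tau : 'I_n -> measurableTypeR R -> measurableTypeR R)
    (D : set T) (f : T -> \bar R) :
  (forall i, measurable_fun setT (tau i)) ->
  (forall i A, measurable A -> lebesgue_measure (tau i @^-1` A) = lebesgue_measure A) ->
  measurable D -> measurable_fun D f -> (forall t, D t -> (0 <= f t)%E) ->
  (\int[leb]_(t in tuple_map tau @^-1` D) f (tuple_map tau t) =
   \int[leb]_(t in D) f t)%E.
Proof.
move=> mt pt mD mf f0.
have mT := measurable_tuple_map mt.
rewrite -[LHS](@ge0_integral_pushforward _ _ _ _ _ _ mT)//.
  by apply: eq_measure_integral => A mA _; exact: lebesgue_tuple_map.
by move=> t; rewrite inE; exact: f0.
Qed.

(** The fundamental domain [[0, q_1[ x ... x [0, q_n[], on which translations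
    modulo the lattice act as bijections; it differs from [cell q] by a null set. *)
Definition halfopen_cell : set V := [set x | forall i, 0 <= x ord0 i < q i].

Lemma measurable_box_vec (I : 'I_n -> interval R) :
  measurable (vot @^-1` [set x | forall i, x ord0 i \in I i]).
Proof.
rewrite (_ : _ @^-1` _ = [set t : T | forall i, [set` I i] (tnth t i)]).
  by apply: (@measurable_tuple_box R n (fun i => [set` I i])) => i; exact: measurable_itv.
by apply/seteqP; split=> t /= It i; have := It i; rewrite vec_of_tupleE.
Qed.

Lemma lebesgue_box_vec (I : 'I_n -> interval R) :
  leb (vot @^-1` [set x | forall i, x ord0 i \in I i]) =
  (\prod_(i < n) lebesgue_measure [set` I i])%E.
Proof.
rewrite -lebesgue_tuple_box; last by move=> i; exact: measurable_itv.
by congr (leb _); apply/seteqP; split=> t /= It i; have := It i; rewrite vec_of_tupleE.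
Qed.

Lemma cellE : cell q = [set x | forall i, x ord0 i \in `]0, q i[].
Proof. by apply/seteqP; split=> x /= xq i; have := xq i; rewrite in_itv. Qed.

Lemma halfopen_cellE : halfopen_cell = [set x | forall i, x ord0 i \in `[0, q i[].
Proof. by apply/seteqP; split=> x /= xq i; have := xq i; rewrite in_itv. Qed.

Lemma centered_cellE :
  centered_cell q = [set x | forall i, x ord0 i \in `]- (q i / 2), q i / 2[].
Proof. by apply/seteqP; split=> x /= xq i; have := xq i; rewrite in_itv. Qed.

Lemma measurable_cell : measurable (vot @^-1` cell q).
Proof. by rewrite cellE; apply: measurable_box_vec. Qed.

Lemma measurable_halfopen_cell : measurable (vot @^-1` halfopen_cell).
Proof. by rewrite halfopen_cellE; apply: measurable_box_vec. Qed.

Lemma measurable_centered_cell : measurable (vot @^-1` centered_cell q).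
Proof. by rewrite centered_cellE; apply: measurable_box_vec. Qed.

Lemma lebesgue_cell : leb (vot @^-1` cell q) = (\prod_(i < n) q i)%:E.
Proof.
rewrite cellE lebesgue_box_vec -prodEFin; apply: eq_bigr => i _.
by rewrite lebesgue_measure_itv/= lte_fin q0 oppr0 adde0.
Qed.

Lemma lebesgue_halfopen_cell : leb (vot @^-1` halfopen_cell) = (\prod_(i < n) q i)%:E.
Proof.
rewrite halfopen_cellE lebesgue_box_vec -prodEFin; apply: eq_bigr => i _.
by rewrite lebesgue_measure_itv/= lte_fin q0 oppr0 adde0.
Qed.

Section ge0.
Variable f : V -> \bar R.
Hypotheses (mf : measurable_fun setT (f \o vot)) (f0 : forall x, (0 <= f x)%E).

Lemma integral_halfopen_cell :
  (\int[leb]_(t in vot @^-1` halfopen_cell) f (vot t) =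
   \int[leb]_(t in vot @^-1` cell q) f (vot t))%E.
Proof.
pose N := (vot @^-1` halfopen_cell) `\` (vot @^-1` cell q).
have mN : measurable N.
  by apply: measurableD; [exact: measurable_halfopen_cell|exact: measurable_cell].
have sub : vot @^-1` cell q `<=` vot @^-1` halfopen_cell.
  by move=> t /= tq i; have /andP[/ltW -> ->] := tq i.
rewrite (ge0_negligible_integral mN)//.
- by rewrite /N setDD setIC setIidl.
- exact: measurable_halfopen_cell.
- exact: measurable_funTS.
- have E : leb N = (leb (vot @^-1` halfopen_cell) - leb (vot @^-1` cell q))%E.
    rewrite /N -[in RHS](setIidr sub); apply: measureD.
    + exact: measurable_halfopen_cell.
    + exact: measurable_cell.
    + by rewrite [X in (X < _)%E]lebesgue_halfopen_cell ltry.
  by apply: (etrans E); rewrite lebesgue_halfopen_cell lebesgue_cell -EFinB subrr.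
Qed.

Hypothesis pf : forall x z, f (x + qmul q z) = f x.

(** For a periodic function the translation by [v] agrees with the translation
    modulo [q], which preserves both the measure and the half-open cell. *)
Lemma ge0_integral_cell_shift v :
  (\int[leb]_(t in vot @^-1` halfopen_cell) f (vot t + v)%R =
   \int[leb]_(t in vot @^-1` halfopen_cell) f (vot t))%E.
Proof.
pose c i := v ord0 i - q i * (Num.floor (v ord0 i / q i))%:~R.
have cq i : 0 <= c i < q i.
  rewrite /c; have /andP[] := mem_rg1_floor (v ord0 i / q i).
  rewrite ler_pdivlMr ?q0// ltr_pdivrMr ?q0// mulrDl mul1r => ? ?.
  by rewrite mulrC; apply/andP; split; lra.
pose tau i : measurableTypeR R -> measurableTypeR R := modshift (q i) (c i).
have inv : tuple_map tau @^-1` (vot @^-1` halfopen_cell) = vot @^-1` halfopen_cell.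
  apply/seteqP; split=> t /= tq i; have := tq i; rewrite !vec_of_tupleE tnth_mktuple.
    by apply: contraTT => h; rewrite /tau modshift_out.
  exact: modshift_in.
rewrite -[RHS](@ge0_integral_tuple_map tau _ (f \o vot)).
- rewrite inv; apply: eq_integral => t; rewrite inE /= => tq.
  have /choice[z zE] : forall i, exists z : int,
      modshift (q i) (c i) (tnth t i) = tnth t i + c i + q i * z%:~R.
    by move=> i; apply: modshift_eq; have := tq i; rewrite vec_of_tupleE.
  rewrite -[LHS](pf _ (\row_i (z i - Num.floor (v ord0 i / q i)))).
  congr f; apply/rowP => i; rewrite !mxE tnth_mktuple /tau zE /c.
  by rewrite rmorphB/=; ring.
- by move=> i; exact: measurable_modshift.
- by move=> i A mA; exact: lebesgue_measure_modshift.
- exact: measurable_halfopen_cell.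
- exact: measurable_funTS.
- by move=> t _; exact: f0.
Qed.

Lemma vec_tuple_map_shift (v : V) (t : T) :
  vot (tuple_map (fun i (x : measurableTypeR R) => (x + v ord0 i : R)) t) = vot t + v.
Proof. by apply/rowP => i; rewrite !mxE tnth_mktuple. Qed.

Lemma vec_tuple_map_reflect (v : V) (t : T) :
  vot (tuple_map (fun i (x : measurableTypeR R) => (v ord0 i - x : R)) t) = v - vot t.
Proof. by apply/rowP => i; rewrite !mxE tnth_mktuple. Qed.

Lemma measurable_line_shift (a : R) :
  measurable_fun setT (fun x : measurableTypeR R => (x + a : measurableTypeR R)).
Proof. by apply: measurable_funD => //; exact: measurable_cst. Qed.

Lemma measurable_line_reflect (a : R) :
  measurable_fun setT (fun x : measurableTypeR R => (a - x : measurableTypeR R)).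
Proof. by apply: measurable_funB => //; exact: measurable_cst. Qed.

Lemma measurable_vec_shift (d : measure_display) (Y : measurableType d)
    (g : V -> Y) v :
  measurable_fun setT (g \o vot) -> measurable_fun setT (fun t => g (vot t + v)).
Proof.
move=> mg.
rewrite (_ : (fun t => _) = (g \o vot) \o
  tuple_map (fun i (x : measurableTypeR R) => (x + v ord0 i : measurableTypeR R))).
  apply: measurableT_comp => //; apply: measurable_tuple_map => i.
  exact: measurable_line_shift.
by apply/funext => t /=; rewrite vec_tuple_map_shift.
Qed.

Lemma measurable_vec_reflect (d : measure_display) (Y : measurableType d)
    (g : V -> Y) v :
  measurable_fun setT (g \o vot) -> measurable_fun setT (fun t => g (v - vot t)).
Proof.
move=> mg.
rewrite (_ : (fun t => _) = (g \o vot) \o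
  tuple_map (fun i (x : measurableTypeR R) => (v ord0 i - x : measurableTypeR R))).
  apply: measurableT_comp => //; apply: measurable_tuple_map => i.
  exact: measurable_line_reflect.
by apply/funext => t /=; rewrite vec_tuple_map_reflect.
Qed.

Lemma ge0_integral_cell_reflect :
  (\int[leb]_(t in vot @^-1` cell q) f (- vot t)%R =
   \int[leb]_(t in vot @^-1` cell q) f (vot t))%E.
Proof.
pose tau i : measurableTypeR R -> measurableTypeR R := fun x => (q i - x : R).
have inv : tuple_map tau @^-1` (vot @^-1` cell q) = vot @^-1` cell q.
  apply/seteqP; split=> t /= tq i; have := tq i;
  by rewrite !vec_of_tupleE tnth_mktuple /tau subr_gt0 gtrBl andbC.
rewrite -[RHS](@ge0_integral_tuple_map tau _ (f \o vot)).
- rewrite inv; apply: eq_integral => t; rewrite inE /= => tq.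
  rewrite -[LHS](pf _ (\row_i 1)); congr f.
  by apply/rowP => i; rewrite !mxE tnth_mktuple mulr1 addrC.
- by move=> i; exact: measurable_line_reflect.
- by move=> i A mA; exact: lebesgue_measure_reflect.
- exact: measurable_cell.
- exact: measurable_funTS.
- by move=> t _; exact: f0.
Qed.

Lemma ge0_integral_centered_cell :
  (\int[leb]_(t in vot @^-1` cell q) f (vot t - \row_i (q i / 2)%R)%R =
   \int[leb]_(t in vot @^-1` centered_cell q) f (vot t))%E.
Proof.
pose tau i : measurableTypeR R -> measurableTypeR R := fun x => (x + - (q i / 2) : R).
have inv : tuple_map tau @^-1` (vot @^-1` centered_cell q) = vot @^-1` cell q.
  apply/seteqP; split=> t /= tq i; have := tq i;
  rewrite !vec_of_tupleE tnth_mktuple /tau => /andP[? ?];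
  by apply/andP; split; lra.
rewrite -[RHS](@ge0_integral_tuple_map tau _ (f \o vot)).
- rewrite inv; apply: eq_integral => t _; congr f.
  by apply/rowP => i; rewrite !mxE tnth_mktuple.
- by move=> i; exact: measurable_line_shift.
- by move=> i A mA; exact: lebesgue_measure_shift.
- exact: measurable_centered_cell.
- exact: measurable_funTS.
- by move=> t _; exact: f0.
Qed.

End ge0.

Lemma ge0_integral_cell_translate (f : V -> \bar R) v :
  measurable_fun setT (f \o vot) -> (forall x, (0 <= f x)%E) ->
  (forall x z, f (x + qmul q z) = f x) ->
  (\int[leb]_(t in vot @^-1` cell q) f (vot t + v)%R =
   \int[leb]_(t in vot @^-1` cell q) f (vot t))%E.
Proof.
move=> mf f0 pf; rewrite -[RHS]integral_halfopen_cell//.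
rewrite -[LHS](@integral_halfopen_cell (fun y => f (y + v)))//.
  exact: ge0_integral_cell_shift.
exact: measurable_vec_shift.
Qed.

(** The integral over the cell of a periodic function of [x - y] does not
    depend on [x]. *)
Lemma ge0_integral_cell_conv (f : V -> \bar R) x :
  measurable_fun setT (f \o vot) -> (forall x, (0 <= f x)%E) ->
  (forall x z, f (x + qmul q z) = f x) ->
  (\int[leb]_(t in vot @^-1` cell q) f (x - vot t)%R =
   \int[leb]_(t in vot @^-1` centered_cell q) f (vot t))%E.
Proof.
move=> mf f0 pf.
transitivity (\int[leb]_(t in vot @^-1` cell q) f (vot t))%E.
  rewrite -(ge0_integral_cell_translate x mf f0 pf).
  rewrite -(@ge0_integral_cell_reflect (fun y => f (y + x)))//.
  - by apply: eq_integral => t _; rewrite addrC.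
  - exact: measurable_vec_shift.
  - by move=> y z; rewrite addrAC pf.
rewrite -ge0_integral_centered_cell//.
by rewrite (ge0_integral_cell_translate (- \row_i (q i / 2)) mf f0 pf).
Qed.

Lemma Rintegral_cell_translate (f : V -> R) v :
  measurable_fun setT (f \o vot : T -> measurableTypeR R) ->
  (forall x z, f (x + qmul q z) = f x) ->
  \int[leb]_(t in vot @^-1` cell q) f (vot t + v)%R =
  \int[leb]_(t in vot @^-1` cell q) f (vot t).
Proof.
move=> mf pf; rewrite /Rintegral; congr fine.
rewrite integralE [RHS]integralE; congr (_ - _)%E.
- have H := @ge0_integral_cell_translate ((EFin \o f)^\+)%E v.
  under eq_integral do rewrite funeposE -[X in maxe X]/((EFin \o f) _) -funeposE.
  under [RHS]eq_integral do rewrite funeposE -[X in maxe X]/((EFin \o f) _) -funeposE.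
  apply: H.
  + by rewrite -funepos_comp; apply: measurable_funepos; exact/measurable_EFinP.
  + by move=> x; exact: funepos_ge0.
  + by move=> x z; rewrite !funeposE /= pf.
- have H := @ge0_integral_cell_translate ((EFin \o f)^\-)%E v.
  under eq_integral do rewrite funenegE -[X in oppe X]/((EFin \o f) _) -funenegE.
  under [RHS]eq_integral do rewrite funenegE -[X in oppe X]/((EFin \o f) _) -funenegE.
  apply: H.
  + by rewrite -funeneg_comp; apply: measurable_funeneg; exact/measurable_EFinP.
  + by move=> x; exact: funeneg_ge0.
  + by move=> x z; rewrite !funenegE /= pf.
Qed.

End periodic_integral.

(** * Integrability of the kernel and complex integrals *)

Section kernel.
Variables (R : realType) (n : nat) (q : 'I_n -> R).
Hypothesis q0 : forall i, 0 < q i.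
Local Notation V := 'rV[R]_n.
Local Notation T := (n.-tuple (measurableTypeR R)).
Local Notation vot := (@vec_of_tuple R n).
Local Notation leb := (lebesgue_tuple R n).

Lemma coord_le_norm (x : V) i : `|x ord0 i| <= `|x|.
Proof.
rewrite [leRHS]/Num.norm /= mx_normrE; apply/bigmax_geP; right => /=.
by exists (ord0, i).
Qed.

Lemma norm_coord_ex (x : V) (a : R) : 0 < a -> a <= `|x| ->
  exists i, a <= `|x ord0 i|.
Proof.
move=> a0; rewrite [leRHS]/Num.norm /= mx_normrE => /bigmax_geP[].
  by move=> /(lt_le_trans a0); rewrite ltxx.
by move=> [[j i] _ /=]; rewrite ord1 => ?; exists i.
Qed.

Lemma norm_lt_coord (x : V) (a : R) : 0 < a ->
  `|x| < a <-> forall i, `|x ord0 i| < a.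
Proof.
move=> a0; split=> [xa i|H]; first exact: le_lt_trans (coord_le_norm x i) xa.
rewrite ltNge; apply/negP => xa; have [i ai] := norm_coord_ex a0 xa.
by move: ai; rewrite leNgt H.
Qed.

Lemma coord_le_enorm (x : V) i : `|x ord0 i| <= enorm x.
Proof.
rewrite /enorm -sqrtr_sqr ler_wsqrtr// (bigD1 i)//= lerDl.
by apply: sumr_ge0 => j _; exact: sqr_ge0.
Qed.

(** As [lambda < n - 1], on the dyadic shell where the sup norm lies between
    [a k.+1] and [a k] the kernel is at most a constant times [A / a k.+1 ^+ (n - 1)],
    while the cube of half side [a k] has volume of order [a k ^+ n]; hence the
    kernel is dominated by a sum of indicators of cubes whose integrals form a
    geometric series. *)
Lemma kernel_integral_bound (lambda : R) : (2 <= n)%N -> 0 < lambda < n%:R - 1 ->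
  exists2 K : R, 0 <= K & forall (A : R) (g : V -> R),
    measurable_fun (vot @^-1` centered_cell q) (g \o vot : T -> measurableTypeR R) ->
    (forall x, 0 <= g x) -> g 0 = 0 -> 0 <= A ->
    (forall x, centered_cell q x -> x != 0 -> g x * enorm x `^ lambda <= A) ->
    (\int[leb]_(t in vot @^-1` centered_cell q) (g (vot t))%:E <= (A * K)%:E)%E.
Proof.
move=> n2 /andP[l0 ln].
pose N := n.-1; have nN : n = N.+1 by rewrite /N prednK// (leq_trans _ n2).
have lN : lambda < N%:R by move: ln; rewrite nN -natr1 addrK.
pose r : R := \sum_i q i.
have r0 : 0 < r.
  have i0 : 'I_n by rewrite nN; exact: ord0.
  rewrite /r (bigD1 i0)//= ltr_wpDr//; apply: sumr_ge0 => i _; exact: ltW.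
pose a k : R := r / 2 ^+ k.
have a0 k : 0 < a k by rewrite divr_gt0// exprn_gt0.
pose c k : R := r `^ (N%:R - lambda) / a k.+1 ^+ N.
have c0 k : 0 <= c k by rewrite divr_ge0 ?powR_ge0// exprn_ge0// ltW.
pose B k : set T := vot @^-1` [set x | forall i, x ord0 i \in `]- a k, a k[].
have mB k : measurable (B k) by apply: measurable_box_vec.
have BE k t : B k t <-> `|vot t| < a k.
  rewrite norm_lt_coord//; split=> + i => /(_ i); by rewrite in_itv/= ltr_norml.
pose E : R := r `^ (N%:R - lambda) * (r * 2 ^+ (2 * N + 2)).
have E0 : 0 <= E by rewrite mulr_ge0 ?powR_ge0// mulr_ge0 ?exprn_ge0// ltW.
exists E => // A g mg g0 g00 A0 gA.
have mC := measurable_centered_cell q.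
pose G k (t : T) : \bar R := ((A * c k) * \1_(B k) t)%:E.
have G0 k t : (0 <= G k t)%E by rewrite lee_fin mulr_ge0// mulr_ge0.
have mG k : measurable_fun (vot @^-1` centered_cell q) (G k).
  apply/measurable_EFinP; apply: measurable_funM; first exact: measurable_cst.
  by apply: measurable_funTS; exact: measurable_indic.
have dom t : (vot @^-1` centered_cell q) t ->
    ((g (vot t))%:E <= \sum_(k <oo) G k t)%E.
  move=> /= tC; set x := vot t.
  have [x0|x0] := eqVneq x 0.
    by rewrite x0 g00; apply: nneseries_ge0 => k _ _; exact: G0.
  have xr : `|x| < a 0%N.
    rewrite /a expr0 divr1; apply/norm_lt_coord => // i.
    have /andP[x1 x2] := tC i; apply: (@lt_le_trans _ _ (q i)).
      have qi := q0 i; by rewrite ltr_norml; apply/andP; split; rewrite /x; lra.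
    rewrite /r (bigD1 i)//= lerDl; apply: sumr_ge0 => j _; exact: ltW.
  have [k ak] : exists k, a k <= `|x|.
    have x1 : 0 < `|x| by rewrite normr_gt0.
    exists (Num.truncn (r / `|x|)).+1; rewrite /a ler_pdivrMr ?exprn_gt0//.
    rewrite mulrC -ler_pdivrMr//.
    have := truncnS_gt (r / `|x|); move=> /ltW /le_trans; apply.
    by rewrite -natrX ler_nat ltnW// ltn_expl.
  have [[|k'] /= kx kmin] := @ex_minnP (fun k => a k <= `|x|) (ex_intro _ k ak).
    by move: kx; rewrite leNgt xr.
  have kx' : `|x| < a k'.
    by rewrite ltNge; apply/negP => /kmin; rewrite ltnn.
  have gc : g x <= A * c k'.
    rewrite /c mulrA ler_pdivlMr ?exprn_gt0//.
    have [i ai] := norm_coord_ex (a0 _) kx.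
    have ae : a k'.+1 <= enorm x by exact: le_trans ai (coord_le_enorm x i).
    have e0 : 0 <= enorm x by exact: le_trans (ltW (a0 _)) ae.
    have gl : g x * a k'.+1 `^ lambda <= A.
      apply: le_trans (gA x tC x0); rewrite ler_wpM2l//.
      by apply: ge0_ler_powR; rewrite ?nnegrE// ltW.
    have -> : a k'.+1 ^+ N = a k'.+1 `^ lambda * a k'.+1 `^ (N%:R - lambda).
      rewrite -powRD; last by apply/implyP => _; rewrite gt_eqF.
      by rewrite addrC subrK powR_mulrn// ltW.
    rewrite mulrA; apply: ler_pM => //; rewrite ?mulr_ge0 ?powR_ge0//.
    apply: ge0_ler_powR; rewrite ?nnegrE ?subr_ge0 ltW//.
    rewrite /a ltr_pdivrMr ?exprn_gt0// ltr_pMr//.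
    by rewrite exprn_egt1// ltr1n.
  apply: (@le_trans _ _ (G k' t)).
    rewrite /G lee_fin indicE mem_set ?mulr1//; exact/BE.
  apply: le_trans (nneseries_lim_ge k'.+1 _) => [|k0 _ _]; last exact: G0.
  by rewrite big_nat_recr//= leeDr// sume_ge0.
apply: (@le_trans _ _ (\int[leb]_(t in vot @^-1` centered_cell q) \sum_(k <oo) G k t)%E).
  apply: ge0_le_integral => //.
  - by move=> t _; rewrite lee_fin.
  - exact/measurable_EFinP.
  - exact: (@ge0_emeasurable_sum _ _ _ _ G xpredT (fun k t _ _ => G0 k t)
      (fun k _ => mG k)).
rewrite integral_nneseries//.
apply: le_trans (epsilon_trick0 xpredT (mulr_ge0 A0 E0)).
apply: lee_nneseries; first by move=> *; apply: integral_ge0.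
move=> k _.
rewrite /G; under eq_integral do rewrite EFinM.
have mI : measurable_fun (vot @^-1` centered_cell q) (fun t => (\1_(B k) t)%:E : \bar R).
  by apply/measurable_EFinP; apply: measurable_funTS; exact: measurable_indic.
rewrite ge0_integralZl_EFin//; last exact: mulr_ge0.
rewrite integral_indic//.
apply: (@le_trans _ _ ((A * c k)%:E * leb (B k))%E).
  apply: lee_wpmul2l; first by rewrite lee_fin mulr_ge0.
  by apply: le_measure; rewrite ?inE//; exact: measurableI.
rewrite /B lebesgue_box_vec (eq_bigr (fun _ => (2 * a k)%:E)); last first.
  move=> i _; rewrite lebesgue_measure_itv/= lte_fin gtrN// -EFinB.
  by congr EFin; ring.
rewrite prodEFin -EFinM lee_fin prodr_const card_ord nN.
rewrite le_eqVlt; apply/orP; left; apply/eqP; rewrite /c /E /a.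
have -> : (2 ^ k.+1)%:R = 2 * 2 ^+ k :> R by rewrite natrX exprS.
rewrite [2 ^+ k.+1]exprS exprD mulnC exprM [in RHS]exprS.
rewrite expr_div_n exprMn exprS exprMn expr_div_n.
have p0 : 2 ^+ k != 0 :> R by rewrite expf_neq0.
have w0 : 2 ^+ N != 0 :> R by rewrite expf_neq0.
have u0 : r ^+ N != 0 by rewrite expf_neq0// gt_eqF.
have s0 : (2 ^+ k) ^+ N != 0 :> R by rewrite expf_neq0.
move: p0 w0 u0 s0; set P := r `^ _; set p := 2 ^+ k; set w := 2 ^+ N.
set u := r ^+ N; set s := p ^+ N => p0 w0 u0 s0.
field.
by rewrite p0 w0 u0 s0.
Qed.

End kernel.

Section volume.
Variables (R : realType) (n : nat).
Local Notation V := 'rV[R]_n.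
Local Notation C := (Rcomplex R).
Local Notation T := (n.-tuple (measurableTypeR R)).
Local Notation vot := (@vec_of_tuple R n).
Local Notation leb := (lebesgue_tuple R n).
Local Notation vol := (@volume_integral R n).
Implicit Types (D : set V) (f g : V -> C).

(** Measurability and integrability of complex functions, componentwise. *)
Definition cmeas D f :=
  measurable_fun (vot @^-1` D) (fun t => complex.Re (f (vot t)) : measurableTypeR R) /\
  measurable_fun (vot @^-1` D) (fun t => complex.Im (f (vot t)) : measurableTypeR R).

Definition cint D f :=
  leb.-integrable (vot @^-1` D) (fun t => (complex.Re (f (vot t)))%:E) /\
  leb.-integrable (vot @^-1` D) (fun t => (complex.Im (f (vot t)))%:E).

Lemma cmeas_continuous U f : open U -> (forall x, U x -> {for x, continuous f}) ->
  cmeas U f.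
Proof.
move=> oU cf; split.
  apply: (@continuous_measurable_vec _ _ U (fun y => complex.Re (f y))) => // x Ux.
  by apply: continuous_Re; exact: cf.
apply: (@continuous_measurable_vec _ _ U (fun y => complex.Im (f y))) => // x Ux.
by apply: continuous_Im; exact: cf.
Qed.

Lemma cmeasS D D' f : measurable (vot @^-1` D) -> D' `<=` D -> cmeas D f -> cmeas D' f.
Proof.
by move=> mD DD [mr mi]; split; apply: measurable_funS mD _ _ => // t; exact: DD.
Qed.

Lemma cmeasM D f g : cmeas D f -> cmeas D g -> cmeas D (fun y => f y * g y).
Proof.
move=> [fr fi] [gr gi]; split.
  rewrite (_ : (fun t => _) = fun t => complex.Re (f (vot t)) * complex.Re (g (vot t)) -
    complex.Im (f (vot t)) * complex.Im (g (vot t))).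
    by apply: measurable_funB; apply: measurable_funM.
  by apply/funext => t; rewrite Re_mul.
rewrite (_ : (fun t => _) = fun t => complex.Re (f (vot t)) * complex.Im (g (vot t)) +
  complex.Im (f (vot t)) * complex.Re (g (vot t))).
  by apply: measurable_funD; apply: measurable_funM.
by apply/funext => t; rewrite Im_mul.
Qed.

Lemma cmeas_cst D (c : C) : cmeas D (fun=> c).
Proof. by split; exact: measurable_cst. Qed.

Lemma cmeas_ext D f g : (forall x, D x -> f x = g x) -> cmeas D f -> cmeas D g.
Proof.
move=> fg [fr fi]; split.
  by apply: eq_measurable_fun fr => t; rewrite inE /= => Dt; rewrite fg.
by apply: eq_measurable_fun fi => t; rewrite inE /= => Dt; rewrite fg.
Qed.

Lemma cint_meas D f : cint D f -> cmeas D f.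
Proof.
by move=> [/integrableP[+ _] /integrableP[+ _]] => /measurable_EFinP ? /measurable_EFinP.
Qed.

Lemma eq_vol D f g : (forall x, D x -> f x = g x) -> vol D f = vol D g.
Proof.
move=> fg; rewrite /volume_integral; congr Complex; apply: eq_Rintegral => t;
by rewrite inE /= => Dt; rewrite fg.
Qed.

Lemma cint_ext D f g : measurable (vot @^-1` D) -> (forall x, D x -> f x = g x) ->
  cint D f -> cint D g.
Proof.
move=> mD fg [fr fi]; split.
  by apply: eq_integrable fr => // t; rewrite inE => Dt; rewrite fg.
by apply: eq_integrable fi => // t; rewrite inE => Dt; rewrite fg.
Qed.

Lemma cintD D f g : measurable (vot @^-1` D) -> cint D f -> cint D g ->
  cint D (fun y => f y + g y).
Proof.
move=> mD [fr fi] [gr gi]; split.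
  under eq_fun do rewrite Re_add EFinD.
  exact: integrableD.
under eq_fun do rewrite Im_add EFinD.
exact: integrableD.
Qed.

Lemma volD D f g : measurable (vot @^-1` D) -> cint D f -> cint D g ->
  vol D (fun y => f y + g y) = vol D f + vol D g.
Proof.
move=> mD [fr fi] [gr gi]; rewrite /volume_integral.
under eq_Rintegral do rewrite Re_add.
rewrite RintegralD//.
under [X in Complex _ X]eq_Rintegral do rewrite Im_add.
by rewrite RintegralD.
Qed.

Lemma cintZ D (c : C) f : measurable (vot @^-1` D) -> cint D f ->
  cint D (fun y => c * f y).
Proof.
move=> mD [fr fi]; split.
  under eq_fun do rewrite Re_mul EFinB !EFinM.
  by apply: integrableB => //; apply: integrableZl.
under eq_fun do rewrite Im_mul EFinD !EFinM.
by apply: integrableD => //; apply: integrableZl.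
Qed.

Lemma volZ D (c : C) f : measurable (vot @^-1` D) -> cint D f ->
  vol D (fun y => c * f y) = c * vol D f.
Proof.
move=> mD [fr fi]; rewrite /volume_integral.
under eq_Rintegral do rewrite Re_mul.
rewrite RintegralB//; [|exact: (integrableZl mD _ fr)|exact: (integrableZl mD _ fi)].
rewrite !RintegralZl//.
under [X in Complex _ X]eq_Rintegral do rewrite Im_mul.
rewrite RintegralD//; [|exact: (integrableZl mD _ fi)|exact: (integrableZl mD _ fr)].
rewrite !RintegralZl//.
by case: c => a b; congr Complex => /=; rewrite addrC.
Qed.

Lemma Rcomplex_scaleE (a : R) (z : C) : a *: z = (Complex a 0 : C) * z.
Proof. by case: z => x y; congr Complex => /=; ring. Qed.

Lemma Rcomplex_oppE (z : C) : - z = (-1 : C) * z.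
Proof. by rewrite mulN1r. Qed.

Lemma volB D f g : measurable (vot @^-1` D) -> cint D f -> cint D g ->
  vol D (fun y => f y - g y) = vol D f - vol D g.
Proof.
move=> mD fi gi; rewrite Rcomplex_oppE -volZ// -volD//; last exact: cintZ.
by apply: eq_vol => x _; rewrite Rcomplex_oppE.
Qed.

Lemma cintB D f g : measurable (vot @^-1` D) -> cint D f -> cint D g ->
  cint D (fun y => f y - g y).
Proof.
move=> mD fi gi; apply: (cint_ext mD _ (cintD mD fi (cintZ (-1) mD gi))) => x _.
by rewrite -Rcomplex_oppE.
Qed.

(** Domination of the integrand by [M * k] bounds the integral; the factor 2 comes
    from treating real and imaginary parts separately. *)
Lemma vol_bound D f (k : V -> R) (M c : R) : measurable (vot @^-1` D) -> cmeas D f ->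
  measurable_fun (vot @^-1` D) (k \o vot : T -> measurableTypeR R) ->
  (forall y, D y -> 0 <= k y) ->
  (\int[leb]_(t in vot @^-1` D) (k (vot t))%:E <= c%:E)%E -> 0 <= M ->
  (forall y, D y -> `|f y| <= M * k y) ->
  cint D f /\ `|vol D f| <= 2 * (M * c).
Proof.
move=> mD [mr mi] mk k0 kc M0 fk.
have key (p : V -> R) : measurable_fun (vot @^-1` D) (p \o vot : T -> measurableTypeR R) ->
    (forall y, D y -> `|p y| <= M * k y) ->
    leb.-integrable (vot @^-1` D) (fun t => (p (vot t))%:E) /\
    `|\int[leb]_(t in vot @^-1` D) p (vot t)| <= M * c.
  move=> mp pk.
  have L : (\int[leb]_(t in vot @^-1` D) `|(p (vot t))%:E| <= (M * c)%:E)%E.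
    apply: (@le_trans _ _ (\int[leb]_(t in vot @^-1` D) (M%:E * (k (vot t))%:E))%E).
      apply: ge0_le_integral => //.
      - by apply: measurableT_comp => //; exact/measurable_EFinP.
      - by apply: measurable_funeM; exact/measurable_EFinP.
      - by move=> t Dt; rewrite -EFinM lee_fin pk.
    rewrite ge0_integralZl_EFin//.
    - by rewrite EFinM lee_wpmul2l// lee_fin.
    - by move=> t Dt; rewrite lee_fin k0.
    - exact/measurable_EFinP.
  have I : leb.-integrable (vot @^-1` D) (fun t => (p (vot t))%:E).
    apply/integrableP; split; first exact/measurable_EFinP.
    by apply: le_lt_trans L _; rewrite ltry.
  split=> //; apply: le_trans (le_normr_Rintegral mD I) _.
  rewrite -lee_fin; apply: le_trans L.
  rewrite /Rintegral fineK//.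
  by apply: integrable_fin_num => //; exact: (integrable_norm I).
have [ir br] := key (fun y => complex.Re (f y)) mr
  (fun y Dy => le_trans (norm_Re_le _) (fk y Dy)).
have [ii bi] := key (fun y => complex.Im (f y)) mi
  (fun y Dy => le_trans (norm_Im_le _) (fk y Dy)).
split; first by split.
rewrite (le_trans (Rcomplex_norm_le _))//= mulr2n [leRHS]mulrDl mul1r.
exact: lerD.
Qed.

Lemma vol_restrict D D' f : measurable (vot @^-1` D) -> D' `<=` D ->
  (forall y, D y -> ~ D' y -> f y = 0) -> vol D f = vol D' f.
Proof.
move=> mD DD f0; have key (p : C -> R) : p 0 = 0 ->
    \int[leb]_(t in vot @^-1` D) p (f (vot t)) = \int[leb]_(t in vot @^-1` D') p (f (vot t)).
  move=> p0; rewrite Rintegral_mkcond [RHS]Rintegral_mkcond; apply: eq_Rintegral => t _.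
  rewrite !patchE; case: ifPn; case: ifPn => //; rewrite ?inE ?notin_setE /=.
  - by move=> nD' Dt; rewrite f0.
  - by move=> /DD.
by rewrite /volume_integral !key.
Qed.

Lemma vol_eq_null D f g N : measurable (vot @^-1` D) -> cmeas D f -> cmeas D g ->
  measurable (vot @^-1` N) -> leb (vot @^-1` N) = 0%E ->
  (forall y, D y -> ~ N y -> f y = g y) -> vol D f = vol D g.
Proof.
move=> mD [fr fi] [gr gi] mN N0 fg.
have key (p : C -> R) :
    measurable_fun (vot @^-1` D) (fun t => p (f (vot t)) : measurableTypeR R) ->
    measurable_fun (vot @^-1` D) (fun t => p (g (vot t)) : measurableTypeR R) ->
    \int[leb]_(t in vot @^-1` D) p (f (vot t)) = \int[leb]_(t in vot @^-1` D) p (g (vot t)).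
  move=> mf mg; rewrite /Rintegral; congr fine; apply: ae_eq_integral => //.
  - exact/measurable_EFinP.
  - exact/measurable_EFinP.
  - exists (vot @^-1` N); split => // t /= /not_implyP[Dt H].
    by apply: contrapT => nN; apply: H; rewrite fg.
by rewrite /volume_integral (key _ fr gr) (key _ fi gi).
Qed.

Lemma vol_translate (q : 'I_n -> R) f v : (forall i, 0 < q i) -> cmeas setT f ->
  per q f -> vol (cell q) (fun y => f (y + v)) = vol (cell q) f.
Proof.
move=> q0 [fr fi] pf; rewrite /volume_integral; congr Complex.
  apply: (@Rintegral_cell_translate _ _ q q0 (fun y => complex.Re (f y))) => //.
  by move=> x z; rewrite pf.
apply: (@Rintegral_cell_translate _ _ q q0 (fun y => complex.Im (f y))) => //.
by move=> x z; rewrite pf.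
Qed.

Lemma coord_countable_null (i : 'I_n) (B : set R) : countable B ->
  measurable (B : set (measurableTypeR R)) ->
  leb (vot @^-1` [set x | B (x ord0 i)]) = 0%E.
Proof.
move=> cB mB.
pose A j : set (measurableTypeR R) := if j == i then B else setT.
have mA j : measurable (A j) by rewrite /A; case: ifP.
have -> : vot @^-1` [set x | B (x ord0 i)] = [set t | forall j, A j (tnth t j)].
  apply/seteqP; split=> t /=; rewrite vec_of_tupleE.
    by move=> Bt j; rewrite /A; case: eqP => // ->.
  by move=> /(_ i); rewrite /A eqxx.
by rewrite lebesgue_tuple_box// (bigD1 i)//= {1}/A eqxx countable_lebesgue_measure0// mul0e.
Qed.

End volume.

(** * Periodic cutoff functions *)

Section cutoff.
Variables (R : realType) (n : nat) (q : 'I_n -> R).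
Hypothesis q0 : forall i, 0 < q i.
Local Notation V := 'rV[R]_n.
Local Notation e_ j := (delta_mx 0 j : 'rV[R]_n).
Implicit Types (f g : V -> R) (D A Z : set V).

(** Real functions of class C^1 with given partial derivatives. *)
Definition c1 f (df : 'I_n -> V -> R) :=
  continuous f /\ forall j x, is_derive x (e_ j) f (df j x) /\
                              {for x, continuous (df j)}.

Lemma c1_cst a : c1 (fun=> a) (fun _ _ => 0).
Proof.
split=> [|j x]; first exact: cst_continuous.
by split; [exact: is_derive_cst|exact: cst_continuous].
Qed.

Lemma c1D f g df dg : c1 f df -> c1 g dg ->
  c1 (fun x => f x + g x) (fun j x => df j x + dg j x).
Proof.
move=> [cf df'] [cg dg']; split=> [x|j x]; first exact: (continuousD (cf x) (cg x)).
have [d1 c1] := df' j x; have [d2 c2] := dg' j x.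
by split; [exact: is_deriveD|exact: (continuousD c1 c2)].
Qed.

Lemma c1_sum (I : Type) (r : seq I) (F : I -> V -> R) dF :
  (forall i, c1 (F i) (dF i)) ->
  c1 (fun x => \sum_(i <- r) F i x) (fun j x => \sum_(i <- r) dF i j x).
Proof.
move=> H; elim: r => [|a r IH].
  under eq_fun do rewrite big_nil.
  under [X in c1 _ X]eq_fun do under eq_fun do rewrite big_nil.
  exact: c1_cst.
under eq_fun do rewrite big_cons.
under [X in c1 _ X]eq_fun do under eq_fun do rewrite big_cons.
exact: c1D.
Qed.

Lemma is_derive_line f x v (c : R) :
  is_derive x v f c <-> is_derive (0 : R) 1 (fun s : R => f (x + s *: v)) c.
Proof.
have E (t : R) : x + (0 + t *: 1) *: v = x + t *: v.
  by rewrite add0r [t *: 1]mulr1.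
split=> /is_deriveP H; apply/is_deriveP => e /H[d d0 dP]; exists d => // t /dP;
by rewrite E scale0r addr0.
Qed.

Lemma c1_comp (g dg : R -> R) f df : c1 f df ->
  (forall t : R, is_derive t 1 g (dg t)) -> continuous dg ->
  c1 (fun x => g (f x)) (fun j x => dg (f x) * df j x).
Proof.
move=> [cf df'] gd cdg.
have cg : continuous g.
  move=> t; apply: differentiable_continuous; apply/derivable1_diffP.
  by have [] := gd t.
split=> [x|j x]; first exact: (continuous_comp (cf x) (cg (f x))).
have [d1 c1] := df' j x; split.
  apply/is_derive_line.
  apply: (@is_derive1_comp _ g (fun s => f (x + s *: e_ j))).
    by rewrite scale0r addr0; exact: gd.
  exact/is_derive_line.
apply: continuousM => //.
exact: (continuous_comp (cf x) (cdg (f x))).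
Qed.

Lemma c1_coord i : c1 (fun x => x ord0 i) (fun j _ => (i == j)%:R).
Proof.
split=> [x|j x]; first exact: coord_continuous.
split; last exact: cst_continuous.
apply/is_deriveP => e e0; exists 1 => // t _.
have -> : (x + t *: e_ j) ord0 i - x ord0 i - t *: ((i == j)%:R : R) = 0.
  by rewrite !mxE eqxx /= eq_sym [X in X - _ - _]addrC addrK [t *: _]/(t * _) subrr.
by rewrite normr0 mulr_ge0// ltW.
Qed.

(** The square of the positive part: of class C^1 and zero on the nonpositive
    half-line. *)
Definition possq (t : R) : R := Num.max 0 t ^+ 2.

Lemma possq_derive (t : R) : is_derive t 1 possq (2 * Num.max 0 t).
Proof.
apply/is_deriveP => e e0; exists e => // h he.
have -> : h *: (2 * Num.max 0 t) = h * (2 * Num.max 0 t) :> R by [].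
rewrite [h *: 1]mulr1 (@le_trans _ _ (`|h| * `|h|))//; last first.
  by rewrite ler_wpM2r// ltW.
rewrite -normrM [leRHS]ger0_norm -?expr2 ?sqr_ge0// ler_norml /possq.
by case: (leP 0 t) => ?; case: (leP 0 (t + h)) => ?; apply/andP; split; nra.
Qed.

Lemma possq_dcontinuous : continuous (fun t : R => 2 * Num.max 0 t).
Proof.
move=> t; apply/continuous_atP => e e0; exists (e / 2); first exact: divr_gt0.
move=> h he; rewrite (@le_trans _ _ (2 * `|h|))//; last by lra.
rewrite -mulrBr normrM ger0_norm// ler_pM2l// ler_norml.
have := ler_norm h; have := ler_norm (- h); rewrite normrN => ? ?.
by case: (leP 0 t) => ?; case: (leP 0 (t + h)) => ?; apply/andP; split; lra.
Qed.

Lemma possq_ge0 t : 0 <= possq t. Proof. exact: sqr_ge0. Qed.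

Lemma possq_le0 t : t <= 0 -> possq t = 0.
Proof. by move=> t0; rewrite /possq max_l// expr0n. Qed.

Lemma possq_gt0 t : 0 < t -> 0 < possq t.
Proof. by move=> t0; rewrite /possq max_r ?ltW// exprn_gt0. Qed.

(** A periodic function that measures the distance to the lattice. *)
Definition lattice_dist (y : V) : R :=
  \sum_i (1 - cos (2 * pi / q i * y ord0 i)).

Lemma cos_int (t : R) (z : int) : cos (t + 2 * pi * z%:~R) = cos t.
Proof.
have H (s : R) (k : nat) : cos (s + 2 * pi * k%:R) = cos s.
  elim: k s => [|k IH] s; first by rewrite mulr0 addr0.
  rewrite -[k.+1%:R]natr1 mulrDr mulr1 addrA -[RHS](IH s).
  by have := cosD2pi (s + 2 * pi * k%:R); rewrite mulr2n mulrDl mul1r.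
case: z => k; first exact: H.
rewrite NegzE rmorphN /= mulrN -[LHS](H _ k.+1) -addrA addNr addr0 //.
Qed.

Lemma lattice_dist_per y z : lattice_dist (y + qmul q z) = lattice_dist y.
Proof.
apply: eq_bigr => i _; rewrite !mxE mulrDr; congr (1 - _).
rewrite -[RHS](cos_int _ (z ord0 i)); congr (cos (_ + _)).
by field; rewrite gt_eqF.
Qed.

Lemma lattice_dist0 : lattice_dist 0 = 0.
Proof. by apply: big1 => i _; rewrite mxE mulr0 cos0 subrr. Qed.

Lemma lattice_dist_c1 a : exists df, c1 (fun x => lattice_dist (x - a)) df.
Proof.
have H i : c1 (fun x : V => 1 + - cos (2 * pi / q i * (x ord0 i - a ord0 i)))
    (fun j x => 0 + (2 * pi / q i * sin (2 * pi / q i * (x ord0 i - a ord0 i))) *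
       (i == j)%:R).
  apply: c1D; first exact: c1_cst.
  set k := 2 * pi / q i; pose b := a ord0 i.
  apply: (@c1_comp (fun t => - cos (k * (t - b))) (fun t => k * sin (k * (t - b))) _ _
    (c1_coord i)).
    move=> t; have L : is_derive t 1 (fun t : R => k * (t - b)) k.
      apply/is_deriveP => e e0; exists 1 => // h _.
      have -> : k * (t + h *: 1 - b) - k * (t - b) - h *: k = 0.
        by rewrite [h *: 1]mulr1 -[h *: k]/(h * k); ring.
      by rewrite normr0 mulr_ge0// ltW.
    have D := @is_derive1_comp R cos (fun t => k * (t - b)) t _ _
      (is_derive_cos (k * (t - b))) L.
    by have := is_deriveN D; rewrite mulNr opprK mulrC; apply.
  move=> t; apply: cvgM; first exact: cvg_cst.
  apply: (@continuous_comp _ _ _ (fun t : R => k * (t - b)) sin); last exact: continuous_sin.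
  by apply: cvgM; [exact: cvg_cst|apply: cvgB; [exact: cvg_id|exact: cvg_cst]].
eexists; rewrite (_ : (fun x => _) = fun x : V =>
    \sum_i (1 + - cos (2 * pi / q i * (x ord0 i - a ord0 i)))).
  exact: (c1_sum (index_enum _) H).
by apply/funext => x; apply: eq_bigr => i _; rewrite !mxE.
Qed.

Lemma nearest_int (t : R) : exists z : int, - (1 / 2) <= t - z%:~R <= 1 / 2.
Proof.
exists (Num.floor (t + 1 / 2)); have /andP[] := mem_rg1_floor (t + 1 / 2).
by move=> ? ?; apply/andP; split; lra.
Qed.

(** Smallness of [lattice_dist] forces closeness to the lattice. *)
Lemma lattice_dist_small (d : R) : 0 < d -> exists2 r : R, 0 < r &
  forall y, lattice_dist y <= r -> exists z, `|y - qmul q z| < d.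
Proof.
move=> d0; pose di i := Num.min d (q i / 2).
have di0 i : 0 < di i by rewrite lt_min d0 divr_gt0.
have k0 i : 0 < 2 * pi / q i by rewrite divr_gt0// mulr_gt0// pi_gt0.
have inpi i u : 0 <= u -> u <= q i / 2 -> 2 * pi / q i * u \in `[0, pi].
  move=> u0 uq; rewrite in_itv/= mulr_ge0 ?(ltW (k0 i))//=.
  apply: le_trans (ler_wpM2l (ltW (k0 i)) uq) _.
  by rewrite le_eqVlt; apply/orP; left; apply/eqP; field; rewrite gt_eqF.
pose b i := 1 - cos (2 * pi / q i * di i).
have b0 i : 0 < b i.
  rewrite subr_gt0 -[ltRHS]cos0 ltr_cos; first exact: mulr_gt0.
    by rewrite in_itv/= lexx pi_ge0.
  by apply: inpi; [exact: ltW|rewrite ge_min lexx orbT].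
pose r := \big[Num.min/1]_i b i / 2.
have r2 : 0 < \big[Num.min/1]_i b i.
  by elim/big_ind: _ => // x y x0 y0; rewrite lt_min x0.
exists r; first by rewrite divr_gt0.
move=> y yr.
have /choice[z zP] : forall i, exists z : int,
    - (1 / 2) <= y ord0 i / q i - z%:~R <= 1 / 2 by move=> i; exact: nearest_int.
exists (\row_i z i).
suff H i : `|(y - qmul q (\row_i z i)) ord0 i| < d.
  rewrite /Num.norm/= mx_normrE; apply/bigmax_ltP; split=> //= -[a i] _ /=.
  by rewrite ord1.
set u := _ ord0 i.
have uE : u = q i * (y ord0 i / q i - (z i)%:~R).
  by rewrite /u !mxE; field; rewrite gt_eqF.
have uq : `|u| <= q i / 2.
  rewrite uE normrM gtr0_norm// ler_pM2l// ler_norml.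
  by move: (zP i); rewrite div1r.
have : 1 - cos (2 * pi / q i * `|u|) < b i.
  have -> : 1 - cos (2 * pi / q i * `|u|) = 1 - cos (2 * pi / q i * y ord0 i).
    congr (1 - _); rewrite -[in LHS](gtr0_norm (k0 i)) -normrM.
    have -> (s : R) : cos `|s| = cos s by case: (ger0P s); rewrite ?cosN.
    rewrite -[LHS](cos_int _ (z i)); congr cos.
    by rewrite /u !mxE; field; rewrite gt_eqF.
  apply: (@le_lt_trans _ _ (lattice_dist y)).
    rewrite /lattice_dist (bigD1 i)//= lerDl.
    by apply: sumr_ge0 => j _; rewrite subr_ge0 cos_le1.
  apply: le_lt_trans yr _; rewrite /r ltr_pdivrMr//.
  apply: (@le_lt_trans _ _ (b i)); last by rewrite ltr_pMr// ltr1n.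
  exact: bigmin_le_cond.
rewrite ltrD2l ltrN2 ltr_cos; last 2 first.
- exact: inpi.
- by apply: inpi; [exact: ltW|rewrite ge_min lexx orbT].
rewrite ltr_pM2l// => /lt_le_trans; apply.
by rewrite ge_min lexx.
Qed.

(** Nonnegative periodic functions of class C^1 supported in [D]. *)
Definition bump D g := [/\ exists dg, c1 g dg, forall x, 0 <= g x,
  forall x z, g (x + qmul q z) = g x &
  exists Z, [/\ closed Z, Z `<=` D & forall x, ~ Z x -> g x = 0]].

Lemma bumpD D f g : bump D f -> bump D g -> bump D (fun x => f x + g x).
Proof.
move=> [[df cf] f0 pf [Z [cZ ZD Zf]]] [[dg cg] g0 pg [Y [cY YD Yg]]]; split.
- by exists (fun j x => df j x + dg j x); exact: c1D.
- by move=> x; rewrite addr_ge0.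
- by move=> x z; rewrite pf pg.
- exists (Z `|` Y); split; first exact: closedU.
  + by move=> x [/ZD|/YD].
  + by move=> x /not_orP[nZ nY]; rewrite Zf// Yg// addr0.
Qed.

(** The bump is a positive multiple of the square of the positive part of
    [r - lattice_dist (x - a)]. *)
Lemma bump_at D a : open D -> (forall x z, D x -> D (x + qmul q z)) -> D a ->
  exists2 g, bump D g & 1 < g a.
Proof.
move=> oD pD Da; have [d d0 dD] := open_ball_sub oD Da.
have [r r0 rd] := lattice_dist_small d0.
have [ds cs] := lattice_dist_c1 a.
pose c := 2 / possq r; have c0 : 0 < c by rewrite divr_gt0// possq_gt0.
exists (fun x => c * possq (r - lattice_dist (x - a))); last first.
  by rewrite subrr lattice_dist0 subr0 /c divfK ?gt_eqF ?possq_gt0// ltr1n.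
split.
- have H1 : forall t : R, is_derive t 1 (fun t => c * possq (r - t))
      (c * - (2 * Num.max 0 (r - t))).
    move=> t; have L : is_derive t 1 (fun t : R => r - t) (-1).
      by have := is_deriveB (is_derive_cst r t 1) (is_derive_id t 1); rewrite sub0r.
    have D2 := @is_derive1_comp R possq (fun t => r - t) t _ _ (possq_derive (r - t)) L.
    by have := is_deriveZ c D2; rewrite mulrN1; apply.
  have H2 : continuous (fun t : R => c * - (2 * Num.max 0 (r - t))).
    move=> t; apply: cvgM; first exact: cvg_cst.
    apply: cvgN.
    apply: (@continuous_comp _ _ _ (fun t : R => r - t) (fun t => 2 * Num.max 0 t)).
      by apply: cvgB; [exact: cvg_cst|exact: cvg_id].
    exact: possq_dcontinuous.
  by eexists; exact: (c1_comp cs H1 H2).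
- by move=> x; rewrite mulr_ge0 ?possq_ge0// ltW.
- by move=> x z; rewrite addrAC lattice_dist_per.
- exists [set x | lattice_dist (x - a) <= r]; split.
  + have : closed ((fun x => lattice_dist (x - a)) @^-1` [set t | t <= r]).
      by apply: preimage_closed; [move=> x _; exact: (proj1 cs)|exact: closed_le].
    by [].
  + move=> x /= /rd[z zd]; rewrite -[x](subrK (qmul q z)); apply: pD; apply: dD.
    by rewrite addrAC.
  + move=> x /= /negP; rewrite -ltNge => rx.
    by rewrite possq_le0 ?mulr0// subr_le0 ltW.
Qed.

(** Compactness is applied to the filter generated by the sets of bumps above a
    given bump; this is a filter because bumps are stable under sums. *)
Lemma bump_cover D A : open D -> (forall x z, D x -> D (x + qmul q z)) ->
  compact A -> A `<=` D -> exists2 g, bump D g & forall x, A x -> 1 <= g x.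
Proof.
move=> oD pD /compact_near_coveringP cA AD.
have bump0 : bump D (fun=> 0).
  split=> //; first by exists (fun _ _ => 0); exact: c1_cst.
  by exists set0; split => //; exact: closed0.
pose F := filter_from (bump D) (fun g => [set f | bump D f /\ forall x, g x <= f x]).
have FF : Filter F.
  apply: filter_from_filter; first by exists (fun=> 0).
  move=> f g bf bg; exists (fun x => f x + g x); first exact: bumpD.
  have [_ f0 _ _] := bf; have [_ g0 _ _] := bg.
  move=> k [bk fgk]; split; split=> // x; apply: le_trans (fgk x).
    by rewrite lerDl.
  by rewrite lerDr.
have [g bg H] : F [set g | A `<=` (fun x => 1 <= g x)].
  apply: (cA (V -> R) F (fun g x => 1 <= g x)) => a Aa.
  have [g bg ga] := bump_at oD pD (AD a Aa).
  have [[dg [cg _]] _ _ _] := bg.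
  exists ([set x | 1 < g x], [set f | bump D f /\ forall x, g x <= f x]).
    split; last by exists g.
    apply: (cg a [set t : R | 1 < t]); apply: open_nbhs_nbhs.
    by split; [apply: (@open_gt R 1)|exact: ga].
  by move=> [x f] /= [gx [_ gf]]; exact: le_trans (ltW gx) (gf x).
by exists g => //; exact: H.
Qed.

(** A compact subset of a periodic open set [D] carries a periodic cutoff of
    class C^1 supported in [D]. *)
Lemma periodic_cutoff D A : open D -> (forall x z, D x -> D (x + qmul q z)) ->
  compact A -> A `<=` D -> exists (chi : V -> R) dchi Z,
  [/\ c1 chi dchi, forall x, 0 <= chi x <= 1, forall x z, chi (x + qmul q z) = chi x,
      forall x, A x -> chi x = 1 &
      [/\ closed Z, Z `<=` D & forall x, ~ Z x -> chi x = 0]].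
Proof.
move=> oD pD cA AD; have [g [[dg cg] g0 pg [Z [cZ ZD Zg]]] gA] := bump_cover oD pD cA AD.
have H1 : forall t : R, is_derive t 1 (fun t => 1 - possq (1 - t))
    (2 * Num.max 0 (1 - t)).
  move=> t; have L : is_derive t 1 (fun t : R => 1 - t) (-1).
    by have := is_deriveB (is_derive_cst (1 : R) t 1) (is_derive_id t 1); rewrite sub0r.
  have D2 := @is_derive1_comp R possq (fun t => 1 - t) t _ _ (possq_derive (1 - t)) L.
  by have := is_deriveB (is_derive_cst (1 : R) t 1) D2; rewrite mulrN1 opprK add0r; apply.
have H2 : continuous (fun t : R => 2 * Num.max 0 (1 - t)).
  move=> t.
  apply: (@continuous_comp _ _ _ (fun t : R => 1 - t) (fun t => 2 * Num.max 0 t)).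
    by apply: cvgB; [exact: cvg_cst|exact: cvg_id].
  exact: possq_dcontinuous.
exists (fun x => 1 - possq (1 - g x)); eexists; exists Z; split.
- exact: (c1_comp cg H1 H2).
- move=> x; rewrite gerBl possq_ge0 andbT subr_ge0 /possq.
  by have := g0 x; case: (leP 0 (1 - g x)) => ? ?; [nra|rewrite expr0n].
- by move=> x z; rewrite pg.
- by move=> x Ax; rewrite possq_le0 ?subr0// subr_le0 gA.
- split=> // x nZ; rewrite Zg// subr0 /possq max_r// expr1n subrr //.
Qed.

End cutoff.

(** * Differentiation of integrals *)

Section integral_calculus.
Variables (R : realType) (n : nat).
Local Notation V := 'rV[R]_n.
Local Notation C := (Rcomplex R).
Local Notation T := (n.-tuple (measurableTypeR R)).
Local Notation vot := (@vec_of_tuple R n).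
Local Notation leb := (lebesgue_tuple R n).
Local Notation vol := (@volume_integral R n).
Local Notation e_ j := (delta_mx 0 j : 'rV[R]_n).
Implicit Types (E K U : set V) (f g : V -> C).

(** First order expansions are uniform on compact sets. *)
Lemma compact_uniform_derive U K (g g' : V -> C) v : open U -> compact K -> K `<=` U ->
  (forall z, U z -> is_derive z v g (g' z)) ->
  (forall z, U z -> {for z, continuous g'}) ->
  forall e : R, 0 < e -> exists2 d : R, 0 < d & forall z t, K z -> `|t| < d ->
    `|g (z + t *: v) - g z - t *: g' z| <= e * `|t|.
Proof.
move=> oU cK KU gd cg e e0.
have [d1 d10 H1] := compact_open_uniform cK oU KU.
have [d2 d20 H2] := compact_uniform_continuous cK (fun z Kz => cg z (KU z Kz))
  (divr_gt0 e0 (ltr0n _ 2)).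
have v0 : 0 < `|v| + 1 by rewrite ltr_wpDl.
exists (Num.min d1 d2 / (`|v| + 1)); first by rewrite divr_gt0// lt_min d10.
move=> z t Kz; rewrite ltr_pdivlMr// lt_min => /andP[t1 t2].
have sv s : `|s| <= `|t| -> `|s *: v| <= `|t| * (`|v| + 1).
  by move=> st; rewrite normrZ ler_pM// lerDl.
have := @mean_value_ineq R n g z v (g' z) (e / 2) t.
have -> : 2 * (e / 2) = e by field.
apply => s st.
have Us : U (z + s *: v) by apply: H1 => //; exact: le_lt_trans (sv s st) t1.
have [ds dE] := gd _ Us; split=> //; rewrite dE.
by apply: H2 => //; exact: le_lt_trans (sv s st) t2.
Qed.

Section domination.
Variables (E : set V) (k : V -> R) (c : R).
Hypotheses (mE : measurable (vot @^-1` E))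
  (mk : measurable_fun (vot @^-1` E) (k \o vot : T -> measurableTypeR R))
  (k0 : forall y, E y -> 0 <= k y)
  (kc : (\int[leb]_(t in vot @^-1` E) (k (vot t))%:E <= c%:E)%E).

(** The constant is chosen so that [vol_bound] absorbs the factor 2 and [c]. *)
Lemma vol_small (f : V -> C) (e : R) : 0 <= e -> cint E f ->
  (forall y, E y -> `|f y| <= e / (2 * (`|c| + 1)) * k y) -> `|vol E f| <= e.
Proof.
move=> e0 If fk.
have c1 : 0 < 2 * (`|c| + 1) by rewrite mulr_gt0// ltr_wpDl.
have [_ H] := vol_bound mE (cint_meas If) mk k0 kc (divr_ge0 e0 (ltW c1)) fk.
apply: le_trans H _; rewrite mulrCA mulrA.
apply: (@le_trans _ _ (e / (2 * (`|c| + 1)) * (2 * (`|c| + 1)))).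
  rewrite -mulrA ler_wpM2l// ?divr_ge0 ?(ltW c1)// ler_pM2l//.
  by rewrite (le_trans (ler_norm _))// lerDl.
by rewrite divfK// gt_eqF.
Qed.

(** Differentiation under the integral sign when the first order expansion of
    the integrand is uniform relative to the integrable weight [k]. *)
Lemma is_derive_vol (F : V -> C) x v (Phi : R -> V -> C) (Phi' : V -> C) (d0 : R) :
  0 < d0 ->
  (forall t, `|t| < d0 -> cint E (Phi t) /\ F (x + t *: v) = vol E (Phi t)) ->
  cint E Phi' ->
  (forall e : R, 0 < e -> exists2 d : R, 0 < d & forall t y, `|t| < d -> E y ->
    `|Phi t y - Phi 0 y - t *: Phi' y| <= e * `|t| * k y) ->
  is_derive x v F (vol E Phi').
Proof.
move=> d00 FE I' H; apply/is_deriveP => e e0.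
have c1 : 0 < 2 * (`|c| + 1) by rewrite mulr_gt0// ltr_wpDl.
have [d dp Hd] := H _ (divr_gt0 e0 c1).
exists (Num.min d d0); first by rewrite lt_min dp.
move=> t; rewrite lt_min => /andP[td td0].
have [It ->] := FE t td0.
have [I0] := FE 0 (etrans (congr1 (fun u => u < d0) (normr0 _)) d00).
rewrite scale0r addr0 => ->.
rewrite Rcomplex_scaleE -volZ// -!volB//; [|exact: cintB|exact: cintZ].
apply: vol_small; first by rewrite mulr_ge0// ltW.
  by apply: cintB => //; [exact: cintB|exact: cintZ].
move=> y Ey; rewrite -Rcomplex_scaleE.
by rewrite [X in _ <= X * _]mulrAC; exact: Hd.
Qed.

Lemma continuous_vol (F : V -> C) x (Phi : V -> V -> C) (d0 : R) : 0 < d0 ->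
  (forall v, `|v| < d0 -> cint E (Phi v) /\ F (x + v) = vol E (Phi v)) ->
  (forall e : R, 0 < e -> exists2 d : R, 0 < d & forall v y, `|v| < d -> E y ->
    `|Phi v y - Phi 0 y| <= e * k y) ->
  {for x, continuous F}.
Proof.
move=> d00 FE H; apply/continuous_atP => e e0.
have c1 : 0 < 2 * (`|c| + 1) by rewrite mulr_gt0// ltr_wpDl.
have [d dp Hd] := H _ (divr_gt0 e0 c1).
exists (Num.min d d0); first by rewrite lt_min dp.
move=> v; rewrite lt_min => /andP[vd vd0].
have [It ->] := FE v vd0.
have [I0] := FE 0 (etrans (congr1 (fun u => u < d0) (normr0 _)) d00).
rewrite addr0 => ->; rewrite -volB//; apply: vol_small; [exact: ltW|exact: cintB|].
by move=> y Ey; exact: Hd.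
Qed.

End domination.
End integral_calculus.

(** * Convolution with a periodic singular kernel *)

Section singular_kernel.
Variables (R : realType) (n : nat) (q : 'I_n -> R).
Hypothesis q0 : forall i, 0 < q i.
Local Notation V := 'rV[R]_n.
Local Notation C := (Rcomplex R).
Local Notation T := (n.-tuple (measurableTypeR R)).
Local Notation vot := (@vec_of_tuple R n).
Local Notation leb := (lebesgue_tuple R n).
Local Notation vol := (@volume_integral R n).
Local Notation e_ j := (delta_mx 0 j : 'rV[R]_n).
Implicit Types (h psi : V -> C) (E : set V).

Lemma open_off_lattice : open (~` lattice q).
Proof.
rewrite openE => x /= nx.
have [i xi] : exists i, forall z : int, x ord0 i <> q i * z%:~R.
  apply: contrapT => H; apply: nx.
  have /choice[z zP] : forall i, exists z : int, x ord0 i = q i * z%:~R.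
    move=> i; apply: contrapT => Hi; apply: H; exists i => z xz.
    by apply: Hi; exists z.
  by exists (\row_i z i) => //; apply/rowP => i; rewrite !mxE zP.
pose m := Num.floor (x ord0 i / q i).
have /andP[] := mem_rg1_floor (x ord0 i / q i).
rewrite ler_pdivlMr// ltr_pdivrMr// -/m => m1 m2.
have m1' : m%:~R * q i < x ord0 i.
  by rewrite lt_neqAle m1 andbT; apply/eqP => e; apply: (xi m); rewrite -e mulrC.
pose d := Num.min (x ord0 i - m%:~R * q i) ((m%:~R + 1) * q i - x ord0 i).
have d0 : 0 < d by rewrite lt_min !subr_gt0 m1' m2.
apply/nbhs_ballP; exists d => // y; rewrite -ball_normE /ball_/= => xy [z _ zy].
have := le_lt_trans (coord_le_norm (x - y) i) xy.
rewrite -zy !mxE lt_min !ltr_norml => /andP[/andP[h1 h2] /andP[h3 h4]].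
have z1 : m%:~R * q i < (z ord0 i)%:~R * q i by lra.
have z2 : (z ord0 i)%:~R * q i < (m + 1)%:~R * q i by rewrite rmorphD /=; lra.
move: z1 z2; rewrite !ltr_pM2r// !ltr_int ltzD1 => z1 z2.
by move: (lt_le_trans z1 z2); rewrite ltxx.
Qed.

(** An equivalent real norm of complex numbers, convenient for measurability. *)
Definition norm1 (z : C) : R := `|complex.Re z| + `|complex.Im z|.

Lemma norm1_ge0 z : 0 <= norm1 z. Proof. exact: addr_ge0. Qed.

Lemma norm_le_norm1 z : `|z| <= norm1 z. Proof. exact: Rcomplex_norm_le. Qed.

Lemma norm1_le z : norm1 z <= 2 * `|z|.
Proof. by rewrite mulr2n mulrDl mul1r lerD ?norm_Re_le ?norm_Im_le. Qed.

Lemma measurable_norm1 E h : cmeas E h ->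
  measurable_fun (vot @^-1` E) ((fun y => norm1 (h y)) \o vot : T -> measurableTypeR R).
Proof.
by move=> [mr mi]; apply: measurable_funD; apply: measurableT_comp => //;
  exact: normr_measurable.
Qed.

Lemma cmeas_off_lattice h : (forall x, ~ lattice q x -> {for x, continuous h}) ->
  (forall x, lattice q x -> h x = 0) -> cmeas setT h.
Proof.
move=> hc h0.
have mU := open_measurable_vec open_off_lattice.
have mL : measurable (vot @^-1` lattice q).
  by rewrite -[lattice q]setCK preimage_setC; exact: measurableC.
have [ur ui] := cmeas_continuous open_off_lattice hc.
have [lr li] := cmeas_ext (fun x xl => esym (h0 x xl)) (cmeas_cst (lattice q) 0).
have E : [set: T] = (vot @^-1` (~` lattice q)) `|` (vot @^-1` lattice q).
  by rewrite preimage_setC setUC setUv.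
have -> : [set: V] = (~` lattice q) `|` lattice q by rewrite setUC setUv.
by split; apply/measurable_funU.
Qed.

(** The integrals of [h] over the reflected and translated cells are uniformly
    bounded by [c]. *)
Definition kernel_bound (c : R) h := forall x,
  (\int[leb]_(t in vot @^-1` cell q) (norm1 (h (x - vot t)%R))%:E <= c%:E)%E.

Lemma kernel_boundP (lambda : R) : (2 <= n)%N -> 0 < lambda < n%:R - 1 ->
  exists2 K : R, 0 <= K & forall (A : R) h, 0 <= A -> per q h ->
    (forall x, ~ lattice q x -> {for x, continuous h}) ->
    (forall x, lattice q x -> h x = 0) ->
    (forall x, centered_cell q x -> x != 0 -> `|h x| * enorm x `^ lambda <= A) ->
    kernel_bound (K * A) h.
Proof.
move=> n2 ln; have [K K0 HK] := kernel_integral_bound q0 n2 ln.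
exists (2 * K); first exact: mulr_ge0.
move=> A h A0 ph hc h0 hA x.
have mh := measurable_norm1 (cmeas_off_lattice hc h0).
rewrite (@ge0_integral_cell_conv _ _ q q0 (fun y => (norm1 (h y))%:E)).
- have := HK (2 * A) (fun y => norm1 (h y)).
  rewrite [2 * K * A]mulrC mulrCA mulrA; apply.
  + exact: measurable_funTS.
  + by move=> y; exact: norm1_ge0.
  + rewrite h0 ?/norm1/= ?normr0 ?addr0//.
    by exists 0 => //; exact: qmul0.
  + exact: mulr_ge0.
  + move=> y yc y0; apply: le_trans (ler_wpM2l (ler0n _ 2) (hA y yc y0)).
    by rewrite mulrA ler_wpM2r ?powR_ge0// norm1_le.
- exact/measurable_EFinP.
- by move=> y; rewrite lee_fin norm1_ge0.
- by move=> y z; rewrite ph.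
Qed.

Section convolution.
Variables (h : V -> C) (c : R).
Hypotheses (mh : cmeas setT h) (hc : kernel_bound c h).

Lemma cmeas_reflect x E : cmeas E (fun y => h (x - y)).
Proof.
have [mr mi] := mh; split; apply: measurable_funTS.
  exact: (@measurable_vec_reflect _ _ _ _ (fun y => complex.Re (h y) : measurableTypeR R)).
exact: (@measurable_vec_reflect _ _ _ _ (fun y => complex.Im (h y) : measurableTypeR R)).
Qed.

Lemma kernel_bound_sub x E : measurable (vot @^-1` E) -> E `<=` cell q ->
  (\int[leb]_(t in vot @^-1` E) (norm1 (h (x - vot t)%R))%:E <= c%:E)%E.
Proof.
move=> mE EQ; apply: le_trans (hc x).
apply: ge0_subset_integral => //; first exact: measurable_cell.
- by apply/measurable_EFinP; exact: (measurable_norm1 (cmeas_reflect x _)).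
- by move=> t _; rewrite lee_fin norm1_ge0.
- by move=> t; exact: EQ.
Qed.

Lemma conv_bound x E psi (P : R) : measurable (vot @^-1` E) -> E `<=` cell q ->
  cmeas E psi -> 0 <= P -> (forall y, E y -> `|psi y| <= P) ->
  cint E (fun y => h (x - y) * psi y) /\
  `|vol E (fun y => h (x - y) * psi y)| <= 2 * (P * c).
Proof.
move=> mE EQ mpsi P0 psiP.
apply: (@vol_bound _ _ E _ (fun y => norm1 (h (x - y)))) => //.
- by apply: cmeasM => //; exact: cmeas_reflect.
- exact: (measurable_norm1 (cmeas_reflect x _)).
- by move=> y _; exact: norm1_ge0.
- exact: kernel_bound_sub.
- move=> y Ey; rewrite Rcomplex_normM mulrC.
  by apply: ler_pM => //; [exact: psiP|exact: norm_le_norm1].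
Qed.

(** The closed cell. *)
Definition cube : set V := [set x | forall i, x ord0 i \in `[0, q i]].

Lemma cube_compact : compact cube.
Proof.
apply: (@rV_compact _ _ (fun i => `[0, q i]%classic)) => i.
exact: segment_compact.
Qed.

Lemma cell_cube : cell q `<=` cube.
Proof. by move=> x xq i; rewrite in_itv/=; have /andP[/ltW -> /ltW ->] := xq i. Qed.

Hypothesis ph : per q h.

(** Moving the translation from the kernel to the periodic density. *)
Lemma conv_translate psi x v : cmeas setT psi -> per q psi ->
  vol (cell q) (fun y => h (x + v - y) * psi y) =
  vol (cell q) (fun y => h (x - y) * psi (y + v)).
Proof.
move=> mpsi ppsi.
rewrite -(@vol_translate _ _ q (fun y => h (x + v - y) * psi y) v q0).
- by apply: eq_vol => y _; rewrite opprD addrACA subrr addr0.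
- by apply: cmeasM => //; exact: cmeas_reflect.
- move=> y z; rewrite ppsi; congr (_ * _).
  by rewrite opprD addrA -qmulN ph.
Qed.

Lemma conv_cint psi x v : continuous psi -> per q psi ->
  cint (cell q) (fun y => h (x - y) * psi (y + v)).
Proof.
move=> cpsi ppsi.
have cpsi' (y : V) : {for y, continuous (fun y : V => psi (y + v))}.
  have /continuous_atP H := cpsi (y + v).
  apply/continuous_atP => e /H[d d0 dP]; exists d => // w wd.
  by rewrite addrAC; exact: dP.
have [M HM] := compact_norm_bounded cube_compact (fun y _ => cpsi' y).
apply: (proj1 (@conv_bound x (cell q) _ `|M| _ _ _ _ _)) => //.
- exact: measurable_cell.
- apply: cmeasS (@subsetT _ _) (cmeas_continuous openT (fun y _ => cpsi' y)) => //.
  by rewrite preimage_setT.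
- by move=> y yQ; apply: le_trans (HM y (cell_cube yQ)) (ler_norm _).
Qed.

Lemma conv_continuous psi x : continuous psi -> per q psi ->
  {for x, continuous (fun x : V => vol (cell q) (fun y => h (x - y) * psi y))}.
Proof.
move=> cpsi ppsi.
have mpsi : cmeas setT psi := cmeas_continuous openT (fun y _ => cpsi y).
apply: (@continuous_vol _ _ (cell q) (fun y => norm1 (h (x - y))) c _ _ _ _ _ x
  (fun v y => h (x - y) * psi (y + v)) 1) => //.
- exact: measurable_cell.
- exact: (measurable_norm1 (cmeas_reflect x _)).
- by move=> y _; exact: norm1_ge0.
- by move=> v _; split; [exact: conv_cint|rewrite conv_translate].
move=> e e0.
have [d d0 H] := compact_uniform_continuous cube_compact (fun y _ => cpsi y) e0.
exists d => // v y vd yQ; rewrite addr0 -mulrBr Rcomplex_normM mulrC.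
by apply: ler_pM => //; [exact: H (cell_cube yQ) vd|exact: norm_le_norm1].
Qed.

(** The derivative falls on the density: [h] is only required to be integrable
    over the cell. *)
Lemma conv_is_derive psi psi' j x : continuous psi -> per q psi ->
  continuous psi' -> per q psi' -> (forall y, is_derive y (e_ j) psi (psi' y)) ->
  is_derive x (e_ j) (fun x : V => vol (cell q) (fun y => h (x - y) * psi y))
    (vol (cell q) (fun y => h (x - y) * psi' y)).
Proof.
move=> cpsi ppsi cpsi' ppsi' dpsi.
have mpsi : cmeas setT psi := cmeas_continuous openT (fun y _ => cpsi y).
apply: (@is_derive_vol _ _ (cell q) (fun y => norm1 (h (x - y))) c _ _ _ _ _ x (e_ j)
  (fun t y => h (x - y) * psi (y + t *: e_ j)) (fun y => h (x - y) * psi' y) 1) => //.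
- exact: measurable_cell.
- exact: (measurable_norm1 (cmeas_reflect x _)).
- by move=> y _; exact: norm1_ge0.
- by move=> t _; split; [exact: conv_cint|rewrite conv_translate].
- have := conv_cint x 0 cpsi' ppsi'.
  by apply: cint_ext => [|y _]; [exact: measurable_cell|rewrite addr0].
move=> e e0.
have [d d0 H] := compact_uniform_derive openT cube_compact (@subsetT _ _)
  (fun y _ => dpsi y) (fun y _ => cpsi' y) e0.
exists d => // t y td yQ; rewrite scale0r addr0 Rcomplex_scaleAr -!mulrBr.
rewrite Rcomplex_normM mulrC.
by apply: ler_pM => //; [exact: H (cell_cube yQ) td|exact: norm_le_norm1].
Qed.

End convolution.
End singular_kernel.

(** * Convolution with a smooth kernel *)

Section smooth_kernel.
Variables (R : realType) (n : nat) (q : 'I_n -> R).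
Hypothesis q0 : forall i, 0 < q i.
Local Notation V := 'rV[R]_n.
Local Notation C := (Rcomplex R).
Local Notation T := (n.-tuple (measurableTypeR R)).
Local Notation vot := (@vec_of_tuple R n).
Local Notation leb := (lebesgue_tuple R n).
Local Notation vol := (@volume_integral R n).
Local Notation e_ j := (delta_mx 0 j : 'rV[R]_n).
Variables (E N W G : set V).
Hypotheses (oE : open E) (EQ : E `<=` cell q) (EN : E `<=` N) (cN : compact N)
  (oW : open W) (oG : open G) (WNG : forall x y, W x -> N y -> G (x - y)).
Implicit Types (g theta : V -> C).

Let mE : measurable (vot @^-1` E) := open_measurable_vec oE.

Let k1 : V -> R := fun=> 1.

Lemma volume_sub_cell :
  (\int[leb]_(t in vot @^-1` E) (k1 (vot t))%:E <= (\prod_i q i)%:E)%E.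
Proof.
rewrite /k1 integral_cst// mul1e.
apply: (@le_trans _ _ (leb (vot @^-1` cell q))).
  by apply: le_measure; rewrite ?inE//; [exact: measurable_cell|move=> t; exact: EQ].
by rewrite lebesgue_cell.
Qed.

Let mk1 : measurable_fun (vot @^-1` E) (k1 \o vot : T -> measurableTypeR R).
Proof. exact: measurable_cst. Qed.

Let k10 y : E y -> 0 <= k1 y.
Proof. by move=> _; exact: ler01. Qed.

Lemma reflect_compact x : compact [set x - y | y in N].
Proof.
have H : continuous (fun y : V => x - y).
  move=> y; apply/continuous_atP => e e0; exists e => // v ve.
  have -> : x - (y + v) - (x - y) = - v :> V.
    by apply/rowP => i; rewrite !mxE; ring.
  by rewrite normrN ltW.
exact: (continuous_compact (continuous_subspaceT H) cN).
Qed.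

Lemma cmeas_smooth_reflect g x : W x -> (forall z, G z -> {for z, continuous g}) ->
  cmeas E (fun y => g (x - y)).
Proof.
move=> Wx cg; apply: cmeas_continuous => // y Ey.
have /continuous_atP H := cg _ (WNG Wx (EN Ey)).
apply/continuous_atP => e /H[d d0 dP]; exists d => // v vd.
by rewrite opprD addrA; apply: dP; rewrite normrN.
Qed.

Lemma smooth_conv_bound g theta x (B P : R) : W x ->
  (forall z, G z -> {for z, continuous g}) -> cmeas E theta ->
  0 <= B -> (forall y, E y -> `|g (x - y)| <= B) ->
  0 <= P -> (forall y, E y -> `|theta y| <= P) ->
  cint E (fun y => g (x - y) * theta y) /\
  `|vol E (fun y => g (x - y) * theta y)| <= 2 * (B * P * \prod_i q i).
Proof.
move=> Wx cg mt B0 gB P0 tP.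
apply: (vol_bound mE _ mk1 k10 volume_sub_cell).
- by apply: cmeasM => //; exact: cmeas_smooth_reflect.
- exact: mulr_ge0.
- by move=> y Ey; rewrite mulr1 Rcomplex_normM ler_pM// ?gB ?tP.
Qed.

Lemma smooth_conv_cint g theta x (P : R) : W x ->
  (forall z, G z -> {for z, continuous g}) -> cmeas E theta ->
  0 <= P -> (forall y, E y -> `|theta y| <= P) ->
  cint E (fun y => g (x - y) * theta y).
Proof.
move=> Wx cg mt P0 tP.
have [M HM] : exists M, forall z, [set x - y | y in N] z -> `|g z| <= M.
  apply: compact_norm_bounded; first exact: reflect_compact.
  by move=> _ [y Ny <-]; apply: cg; exact: WNG.
apply: (proj1 (@smooth_conv_bound g theta x `|M| P Wx cg mt _ _ P0 tP)) => // y Ey.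
by apply: le_trans (HM _ _) (ler_norm _); exists y => //; exact: EN.
Qed.

Lemma smooth_conv_continuous g theta x (P : R) : W x ->
  (forall z, G z -> {for z, continuous g}) -> cmeas E theta ->
  0 <= P -> (forall y, E y -> `|theta y| <= P) ->
  {for x, continuous (fun x : V => vol E (fun y => g (x - y) * theta y))}.
Proof.
move=> Wx cg mt P0 tP; have [d0 d00 dW] := open_ball_sub oW Wx.
have Wv v : `|v| < d0 -> W (x + v) by move=> vd; apply: dW; rewrite addrC addKr.
apply: (@continuous_vol _ _ E k1 _ mE mk1 k10 volume_sub_cell _ x
  (fun v y => g (x + v - y) * theta y) d0 d00).
  by move=> v /Wv Wxv; split => //; exact: smooth_conv_cint tP.
move=> e e0; have P1 : 0 < P + 1 by rewrite ltr_wpDl.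
have cgK z : [set x - y | y in N] z -> {for z, continuous g}.
  by move=> [y Ny <-]; apply: cg; exact: WNG.
have [d dp H] := compact_uniform_continuous (@reflect_compact x) cgK (divr_gt0 e0 P1).
exists d => // v y vd Ey; rewrite /k1 mulr1 addr0 -mulrBl Rcomplex_normM.
apply: (@le_trans _ _ (e / (P + 1) * (P + 1))); last by rewrite divfK// gt_eqF.
apply: ler_pM => //; last by rewrite (le_trans (tP y Ey))// lerDl.
by rewrite addrAC; apply: H => //; exists y => //; exact: EN.
Qed.

(** The derivative falls on the kernel, which is regular on the differences of
    points of [W] and [N]. *)
Lemma smooth_conv_is_derive g g' theta x j (P : R) : W x ->
  (forall z, G z -> {for z, continuous g}) ->
  (forall z, G z -> {for z, continuous g'}) ->
  (forall z, G z -> is_derive z (e_ j) g (g' z)) -> cmeas E theta ->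
  0 <= P -> (forall y, E y -> `|theta y| <= P) ->
  is_derive x (e_ j) (fun x : V => vol E (fun y => g (x - y) * theta y))
    (vol E (fun y => g' (x - y) * theta y)).
Proof.
move=> Wx cg cg' dg mt P0 tP; have [d0 d00 dW] := open_ball_sub oW Wx.
have v0 : 0 < `|e_ j| + 1 by rewrite ltr_wpDl.
apply: (@is_derive_vol _ _ E k1 _ mE mk1 k10 volume_sub_cell _ x (e_ j)
  (fun t y => g (x + t *: e_ j - y) * theta y) (fun y => g' (x - y) * theta y)
  (d0 / (`|e_ j| + 1))).
- exact: divr_gt0.
- move=> t td; split=> //; apply: smooth_conv_cint tP => //.
  apply: dW; rewrite addrC addKr normrZ.
  apply: (@le_lt_trans _ _ (`|t| * (`|e_ j| + 1))); first by rewrite ler_wpM2l// lerDl.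
  by rewrite -ltr_pdivlMr.
- exact: smooth_conv_cint tP.
move=> e e0; have P1 : 0 < P + 1 by rewrite ltr_wpDl.
have KG : [set x - y | y in N] `<=` G by move=> _ [y Ny <-]; exact: WNG.
have [d dp H] := compact_uniform_derive oG (@reflect_compact x) KG dg cg' (divr_gt0 e0 P1).
exists d => // t y td Ey; rewrite /k1 mulr1 scale0r addr0 Rcomplex_scaleAl -!mulrBl.
rewrite Rcomplex_normM.
apply: (@le_trans _ _ (e / (P + 1) * `|t| * (P + 1))).
  apply: ler_pM => //; last by rewrite (le_trans (tP y Ey))// lerDl.
  by rewrite [x + _ - y]addrAC; apply: H => //; exists y => //; exact: EN.
by rewrite mulrAC divfK// gt_eqF.
Qed.

End smooth_kernel.

(** * Derivatives of the periodic volume potential *)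

Lemma continuous_scale (R : realType) (T : topologicalType) (W : normedModType R)
    (a : T -> R) (f : T -> W) x : {for x, continuous a} -> {for x, continuous f} ->
  {for x, continuous (fun y => a y *: f y)}.
Proof. by move=> ca cf; exact: (cvgZ ca cf). Qed.

Lemma continuous_1B (R : realType) (T : topologicalType) (a : T -> R) x :
  {for x, continuous a} -> {for x, continuous (fun y => 1 - a y)}.
Proof. by move=> ca; apply: (cvgB _ ca); exact: cvg_cst. Qed.

Lemma open_cell (R : realType) (n : nat) (q : 'I_n -> R) : open (cell q).
Proof.
rewrite openE => x xq.
pose d := \big[Num.min/1]_i Num.min (x ord0 i) (q i - x ord0 i).
have d0 : 0 < d.
  rewrite /d; elim/big_ind: _ => // [a b a0 b0|i _]; first by rewrite lt_min a0.
  by have /andP[? ?] := xq i; rewrite lt_min subr_gt0; apply/andP.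
apply/nbhs_ballP; exists d => // y; rewrite -ball_normE /ball_/= => xy i.
have : d <= Num.min (x ord0 i) (q i - x ord0 i) by exact: bigmin_le_cond.
rewrite le_min => /andP[d1 d2].
have := le_lt_trans (coord_le_norm (x - y) i) xy.
by rewrite !mxE ltr_norml => /andP[? ?]; apply/andP; split; lra.
Qed.

(** The growth of the derivatives of order [k] allowed by the Roumieu norms. *)
Definition roumieu_ratio (R : realType) (rho : R) (k : nat) : R := k`!%:R / rho ^+ k.

Lemma roumieu_ratio_gt0 (R : realType) (rho : R) (rho0 : 0 < rho) k :
  0 < roumieu_ratio rho k.
Proof. by rewrite divr_gt0 ?exprn_gt0// ltr0n fact_gt0. Qed.

Section core.
Variables (R : realType) (n : nat) (q : 'I_n -> R).
Hypothesis q0 : forall i, 0 < q i.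
Local Notation V := 'rV[R]_n.
Local Notation C := (Rcomplex R).
Local Notation T := (n.-tuple (measurableTypeR R)).
Local Notation vot := (@vec_of_tuple R n).
Local Notation leb := (lebesgue_tuple R n).
Local Notation vol := (@volume_integral R n).
Local Notation e_ j := (delta_mx 0 j : 'rV[R]_n).
Implicit Types (w u v : seq 'I_n).

(** The derivative vanishes at a maximum. *)
Lemma is_derive_max (f : V -> R) x d (c : R) :
  (forall y, f y <= f x) -> is_derive x d f c -> c = 0.
Proof.
move=> fmax /is_deriveP fd; apply/eqP; apply: contraT => c0.
have c2 : 0 < `|c| / 2 by rewrite divr_gt0// normr_gt0.
have [e e0 H] := fd _ c2.
pose t := Num.sg c * (e / 2).
have tE : `|t| = e / 2.
  by rewrite normrM normr_sg c0 mul1r gtr0_norm// divr_gt0.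
have te : `|t| < e by rewrite tE ltr_pdivrMr// ltr_pMr// ltr1n.
have := H t te; have := fmax (x + t *: d).
have -> : t *: c = `|c| * (e / 2) :> R.
  by rewrite -[t *: c]/(t * c) /t mulrAC -normrEsg.
rewrite tE ler_norml => fm /andP[+ _].
have c1 : 0 < `|c| by rewrite normr_gt0.
have := mulr_gt0 c1 e0; lra.
Qed.

(* [D] is a periodic open set and the density lives on [cell q `&` D], which is
   covered by [O] and by the set [A] where the cutoff [chi] is 1; the kernel is
   smooth on [G], which contains the differences of points of [W] and [O]. *)
Variables (D O N W G A Z : set V) (chi : V -> R) (dchi : 'I_n -> V -> R).
Hypotheses (oD : open D) (oO : open O) (ON : O `<=` N) (cN : compact N)
  (oW : open W) (oG : open G) (WNG : forall x y, W x -> N y -> G (x - y))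
  (pD : forall x z, D x -> D (x + qmul q z)).
Hypotheses (c1chi : c1 chi dchi) (chi01 : forall x, 0 <= chi x <= 1)
  (pchi : forall x z, chi (x + qmul q z) = chi x)
  (chiA : forall x, A x -> chi x = 1)
  (cZ : closed Z) (ZD : Z `<=` D) (chiZ : forall x, ~ Z x -> chi x = 0)
  (DOA : forall x, cell q x -> D x -> ~ O x -> A x).

Let S : set V := cell q `&` D.
Let E : set V := S `&` O.

Lemma dchiA j x : A x -> dchi j x = 0.
Proof.
move=> Ax; have [dc _] := (proj2 c1chi) j x.
apply: is_derive_max dc => y; rewrite (chiA Ax).
by have /andP[] := chi01 y.
Qed.

Lemma dchiZ j x : ~ Z x -> dchi j x = 0.
Proof.
move=> Zx; have [dc _] := (proj2 c1chi) j x.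
apply/eqP; rewrite -oppr_eq0; apply/eqP.
apply: (@is_derive_max (fun y => - chi y) x (e_ j)).
  by move=> y; rewrite (chiZ Zx) oppr0 oppr_le0; have /andP[] := chi01 y.
Qed.

Lemma dchi_per j x z : dchi j (x + qmul q z) = dchi j x.
Proof.
have [d1 _] := (proj2 c1chi) j (x + qmul q z).
have [/is_deriveP d2 _] := (proj2 c1chi) j x.
have d3 : is_derive (x + qmul q z) (e_ j) chi (dchi j x).
  apply/is_deriveP => e /d2[d d0 dP]; exists d => // t /dP.
  by rewrite [x + _ + _]addrAC !pchi.
by have [_ <-] := d1; have [_ <-] := d3.
Qed.

Let oS : open S := openI (@open_cell _ _ q) oD.
Let oE : open E := openI oS oO.
Let mS : measurable (vot @^-1` S) := open_measurable_vec oS.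
Let mQ : measurable (vot @^-1` cell q) := measurable_cell q.
Let SQ : S `<=` cell q. Proof. by move=> x []. Qed.
Let EQ : E `<=` cell q. Proof. by move=> x [[]]. Qed.
Let EN : E `<=` N. Proof. by move=> x [_ /ON]. Qed.

Lemma dchi_bounded : exists2 Cd : R, 0 <= Cd & forall j y, E y -> `|dchi j y| <= Cd.
Proof.
have H j : exists M : R, 0 <= M /\ forall y, cube q y -> `|dchi j y| <= M.
  have cc y : cube q y -> {for y, continuous (fun y => dchi j y *: (1 : C))}.
    move=> _; apply: continuous_scale; last exact: cst_continuous.
    exact: (proj2 (proj2 c1chi j y)).
  have [M HM] := compact_norm_bounded (@cube_compact _ _ q) cc.
  exists `|M|; split=> // y yc; have := HM y yc.
  have -> : `|dchi j y *: (1 : C)| = `|dchi j y|.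
    rewrite normrZ (_ : `|1 : C| = 1) ?mulr1//.
    by rewrite Rcomplex_normE /= expr0n addr0 expr1n sqrtr1.
  by move=> /le_trans; apply; exact: ler_norm.
have [M HM] := choice H.
exists (\sum_j M j); first by apply: sumr_ge0 => j _; have [] := HM j.
move=> j y [[yq _] _]; have [_ HMj] := HM j.
apply: le_trans (HMj y (cell_cube yq)) _; rewrite (bigD1 j)//= lerDl.
by apply: sumr_ge0 => i _; have [] := HM i.
Qed.

Section densities.
Variables (h phi : V -> C) (c : R).
Hypotheses (mh : cmeas setT h) (hc : kernel_bound q c h)
  (ph : per q h) (sh : csmooth G h) (pphi : per q phi) (sphi : csmooth D phi).

Let psi w (y : V) : C := chi y *: wderiv w phi y.
Let theta j w (y : V) : C := dchi j y *: wderiv w phi y.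
Let eta (y : V) : C := (1 - chi y) *: phi y.

Let off_Z y : ~ Z y -> exists2 d : R, 0 < d & forall a : V, `|a| < d -> ~ Z (y + a).
Proof.
move=> Zy; have [d d0 H] := open_ball_sub (closed_openC cZ) Zy.
by exists d => // v vd; apply: H; rewrite addrC addKr.
Qed.

Let localized_continuous (f : V -> R) w : continuous f -> (forall y, ~ Z y -> f y = 0) ->
  continuous (fun y : V => f y *: wderiv w phi y).
Proof.
move=> cf fZ y; have [Zy|Zy] := pselect (Z y).
  by apply: continuous_scale; [exact: cf|exact: (csmooth_cont sphi (ZD Zy))].
have [d d0 H] := off_Z Zy; apply/continuous_atP => e e0; exists d => // v /H Zv.
by rewrite !fZ// !scale0r subrr normr0 ltW.
Qed.

Let cpsi w : continuous (psi w).
Proof. by apply: localized_continuous => //; exact: (proj1 c1chi). Qed.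

Let ctheta j w : continuous (theta j w).
Proof.
apply: localized_continuous; first by move=> y; exact: (proj2 (proj2 c1chi j y)).
by move=> y; exact: dchiZ.
Qed.

Let ppsi w : per q (psi w).
Proof. by move=> y z; rewrite /psi pchi (per_wderiv w pphi). Qed.

Let ptheta j w : per q (theta j w).
Proof. by move=> y z; rewrite /theta dchi_per (per_wderiv w pphi). Qed.

Let dpsi w j y : is_derive y (e_ j) (psi w) (psi (j :: w) y + theta j w y).
Proof.
have [Zy|Zy] := pselect (Z y).
  apply: is_derive_scaleM; first exact: (proj1 c1chi).
    exact: (proj1 (proj2 c1chi j y)).
  exact: (is_derive_wderiv w j sphi (ZD Zy)).
rewrite /psi /theta chiZ// dchiZ// !scale0r addr0.
have [d d0 H] := off_Z Zy.
apply: (@is_derive_near _ _ (fun=> 0) _ y (e_ j) 0 d d0).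
move=> x xy; rewrite /psi chiZ ?scale0r//.
by rewrite -[x](subrKC y); exact: H.
Qed.

Let I (f : V -> C) (x : V) : C := vol (cell q) (fun y => h (x - y) * f y).
Let J (g f : V -> C) (x : V) : C := vol E (fun y => g (x - y) * f y).

Let theta_I_J j w x : I (theta j w) x = J h (theta j w) x.
Proof.
apply: vol_restrict => // y yq nE; rewrite /theta; have [Zy|Zy] := pselect (Z y).
  rewrite dchiA ?scale0r ?mulr0//; apply: DOA => //; first exact: ZD.
  by move=> Oy; apply: nE; split=> //; split => //; exact: ZD.
by rewrite dchiZ// scale0r mulr0.
Qed.

Variable M0 : R.
Hypotheses (M00 : 0 <= M0) (phiM0 : forall y, S y -> `|phi y| <= M0).

Let chi_norm y : `|chi y| <= 1.
Proof. by have /andP[a b] := chi01 y; rewrite ger0_norm. Qed.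

Let chi_norm' y : `|1 - chi y| <= 1.
Proof. by have /andP[a b] := chi01 y; rewrite ger0_norm ?subr_ge0// gerBl. Qed.

Let cont1chi y : {for y, continuous (fun y : V => 1 - chi y)}.
Proof. by apply: continuous_1B; exact: (proj1 c1chi). Qed.

Let eta_bound y : E y -> `|eta y| <= M0.
Proof.
move=> [Sy _]; rewrite /eta normrZ -[leRHS]mul1r; apply: ler_pM => //.
exact: phiM0.
Qed.

Let meta : cmeas E eta.
Proof.
apply: cmeas_continuous => // y [[_ Dy] _]; apply: continuous_scale.
  exact: cont1chi.
exact: (@csmooth_cont _ _ D phi [::] y sphi Dy).
Qed.

Let mtheta j w : cmeas E (theta j w).
Proof. by apply: cmeas_continuous => // y _; exact: ctheta. Qed.

Let theta_bounded j w : exists2 P : R, 0 <= P & forall y, E y -> `|theta j w y| <= P.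
Proof.
have [M HM] := compact_norm_bounded (@cube_compact _ _ q) (fun y _ => @ctheta j w y).
exists `|M| => // y [[yq _] _]; exact: le_trans (HM y (cell_cube yq)) (ler_norm _).
Qed.

Let cwh u z : G z -> {for z, continuous (wderiv u h)}.
Proof. exact: csmooth_cont. Qed.

(** The boundary contributions to the derivative along a word [u ++ w] whose
    prefix [u] has already been moved to the kernel: each letter [k] of [w] may
    fall on the cutoff. *)
Fixpoint cutoff_terms u w (x : V) : C :=
  if w is k :: v then J (wderiv u h) (theta k v) x + cutoff_terms (rcons u k) v x
  else 0.

(** The derivatives of the potential, the density being split by the cutoff. *)
Definition potential_deriv w (x : V) : C :=
  I (psi w) x + cutoff_terms [::] w x + J (wderiv w h) eta x.

Let J_derive u f P x j : W x -> cmeas E f -> 0 <= P ->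
  (forall y, E y -> `|f y| <= P) ->
  is_derive x (e_ j) (J (wderiv u h) f) (J (wderiv (j :: u) h) f x).
Proof.
move=> Wx mf P0 fP.
apply: (smooth_conv_is_derive q0 oE EQ EN cN oW oG WNG Wx _ _ _ mf P0 fP) => z Gz.
- exact: cwh.
- exact: cwh.
- exact: is_derive_wderiv Gz.
Qed.

Let J_continuous u f P x : W x -> cmeas E f -> 0 <= P ->
  (forall y, E y -> `|f y| <= P) -> {for x, continuous (J (wderiv u h) f)}.
Proof.
move=> Wx mf P0 fP.
by apply: (smooth_conv_continuous q0 oE EQ EN cN oW WNG Wx _ mf P0 fP) => z Gz; exact: cwh.
Qed.

Let cutoff_terms_derive u w x j : W x ->
  is_derive x (e_ j) (cutoff_terms u w) (cutoff_terms (j :: u) w x).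
Proof.
move=> Wx; elim: w u => [|k v IH] u /=; first exact: is_derive_cst.
have [P P0 HP] := theta_bounded k v.
exact: (is_deriveD (@J_derive u _ P x j Wx (@mtheta k v) P0 HP) (IH (rcons u k))).
Qed.

Let cutoff_terms_continuous u w x : W x -> {for x, continuous (cutoff_terms u w)}.
Proof.
move=> Wx; elim: w u => [|k v IH] u /=; first exact: cst_continuous.
apply: (@continuousD _ C V); last exact: IH.
have [P P0 HP] := theta_bounded k v.
exact: J_continuous HP.
Qed.

Lemma potential_deriv_continuous w x : W x ->
  {for x, continuous (potential_deriv w)}.
Proof.
move=> Wx; apply: (@continuousD _ C V); last exact: J_continuous eta_bound.
apply: (@continuousD _ C V); last exact: cutoff_terms_continuous.
by apply: (@conv_continuous _ _ q q0 h c mh hc ph (psi w)); [exact: cpsi|exact: ppsi].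
Qed.

(** Differentiating the first term produces one more cutoff term: as the
    derivative of [chi] vanishes on [A] and outside [Z], its integral over the cell
    is an integral over [E], where the next derivatives act on the kernel. *)
Lemma potential_deriv_derive w j x : W x ->
  is_derive x (e_ j) (potential_deriv w) (potential_deriv (j :: w) x).
Proof.
move=> Wx; rewrite /potential_deriv /= addrA.
apply: is_deriveD; last exact: J_derive eta_bound.
apply: is_deriveD; last exact: cutoff_terms_derive.
rewrite -theta_I_J -volD//; last 2 first.
- have := conv_cint mh hc x 0 (@cpsi (j :: w)) (@ppsi (j :: w)).
  by apply: cint_ext => // y _; rewrite addr0.
- have := conv_cint mh hc x 0 (@ctheta j w) (@ptheta j w).
  by apply: cint_ext => // y _; rewrite addr0.
under eq_vol => y _ do rewrite -mulrDr.
apply: (@conv_is_derive _ _ _ q0 _ _ mh hc ph _ (fun y => psi (j :: w) y + theta j w y)).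
- exact: cpsi.
- exact: ppsi.
- by move=> y; apply: (@continuousD _ C V); [exact: cpsi|exact: ctheta].
- by move=> y z; rewrite ppsi ptheta.
- by move=> y; exact: dpsi.
Qed.

(** The potential of the density [phi] carried by [S]. *)
Definition potential (x : V) : C := vol S (fun y => h (x - y) * phi y).

Lemma potential_split x : potential x = potential_deriv [::] x.
Proof.
rewrite /potential_deriv /= addr0 /potential.
have mphi : cmeas S phi.
  apply: cmeas_continuous => // y [_ Dy].
  exact: (@csmooth_cont _ _ D phi [::] y sphi Dy).
have mchi : cmeas S (fun y => chi y *: phi y).
  by apply: cmeas_continuous => // y [_ Dy]; exact: (@cpsi ([::])).
have meta' : cmeas S eta.
  apply: cmeas_continuous => // y [_ Dy]; apply: continuous_scale.
    exact: cont1chi.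
  exact: (@csmooth_cont _ _ D phi [::] y sphi Dy).
have -> : I (psi [::]) x = vol S (fun y => h (x - y) * psi [::] y).
  apply: vol_restrict => // y yq nS; rewrite /psi chiZ ?scale0r ?mulr0// => Zy.
  by apply: nS; split => //; exact: ZD.
have -> : J h eta x = vol S (fun y => h (x - y) * eta y).
  apply/esym; apply: vol_restrict => // [y []//|y Sy nE].
  rewrite /eta chiA ?subrr ?scale0r ?mulr0//; apply: DOA; [exact: Sy.1|exact: Sy.2|].
  by move=> Oy; apply: nE; split.
rewrite -volD//.
- by apply: eq_vol => y _; rewrite -mulrDr /psi /eta -scalerDl subrKC scale1r.
- apply: (proj1 (conv_bound mh hc x mS SQ mchi M00 _)) => y Sy.
  by rewrite normrZ -[leRHS]mul1r; apply: ler_pM => //; exact: phiM0.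
- apply: (proj1 (conv_bound mh hc x mS SQ meta' M00 _)) => y Sy.
  by rewrite normrZ -[leRHS]mul1r; apply: ler_pM => //; exact: phiM0.
Qed.

Lemma potential_smooth : csmooth W potential /\
  forall w x, W x -> wderiv w potential x = potential_deriv w x.
Proof.
rewrite (_ : potential = potential_deriv [::]); last exact/funext/potential_split.
apply: csmooth_family => //.
- by move=> w x; exact: potential_deriv_continuous.
- by move=> w j x; exact: potential_deriv_derive.
Qed.

(** ** Factorial bounds *)

Variables (rho B M Cd : R).
Hypotheses (rho0 : 0 < rho) (B0 : 0 <= B) (M0' : 0 <= M) (Cd0 : 0 <= Cd).

Local Notation ratio := (roumieu_ratio rho).

Hypotheses (hB : forall w z, ord_sorted w -> G z -> `|wderiv w h z| <= B * ratio (size w))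
  (phiM : forall w y, ord_sorted w -> S y -> `|wderiv w phi y| <= M * ratio (size w))
  (dchiC : forall j y, E y -> `|dchi j y| <= Cd).

Let ratio_ge0 k : 0 <= ratio k.
Proof. exact: ltW (roumieu_ratio_gt0 rho0 k). Qed.

Let ratioM a b : ratio a * ratio b <= ratio (a + b).
Proof.
rewrite /roumieu_ratio mulf_div -exprD ler_pM2r ?invr_gt0 ?exprn_gt0//.
rewrite -natrM ler_nat; have := bin_fact (leq_addr b a).
by rewrite addKn => <-; rewrite leq_pmull// bin_gt0 leq_addr.
Qed.

Let vQ : R := \prod_i q i.

Let vQ0 : 0 <= vQ.
Proof. by apply: prodr_ge0 => i _; exact: ltW. Qed.

(* Each of the [size w] terms carries [size u + size w - 1] derivatives of the
   kernel and of the density, one derivative being taken by the cutoff. *)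
Let cutoff_terms_bound u w x : W x -> ord_sorted (u ++ w) ->
  `|cutoff_terms u w x| <=
  (size w)%:R * (2 * (B * Cd * M * vQ) * ratio (size u + size w).-1).
Proof.
move=> Wx; elim: w u => [|k v IH] u suw /=; first by rewrite normr0 mul0r.
have [su sv] := ord_sorted_infix (erefl _) suw.
rewrite (le_trans (ler_normD _ _))// -natr1 mulrDl mul1r addrC addnS /=.
apply: lerD; last first.
  have thP y : E y -> `|theta k v y| <= Cd * (M * ratio (size v)).
    move=> Ey; rewrite normrZ ler_pM ?normr_ge0 ?dchiC//.
    by apply: phiM => //; have [] := Ey.
  have [_] := smooth_conv_bound q0 oE EQ EN WNG Wx (cwh (u:=u)) (@mtheta k v)
    (mulr_ge0 B0 (ratio_ge0 (size u)))
    (fun y Ey => hB su (WNG Wx (EN Ey)))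
    (mulr_ge0 Cd0 (mulr_ge0 M0' (ratio_ge0 (size v)))) thP.
  move=> /le_trans; apply.
  have -> : 2 * (B * ratio (size u) * (Cd * (M * ratio (size v))) * \prod_i q i) =
      2 * (B * Cd * M * vQ) * (ratio (size u) * ratio (size v)).
    by rewrite -/vQ; ring.
  by apply: ler_wpM2l (ratioM _ _); rewrite !mulr_ge0.
have := IH (rcons u k); rewrite cat_rcons => /(_ suw).
by rewrite size_rcons addSn.
Qed.

Lemma potential_bound w x : ord_sorted w -> W x ->
  `|wderiv w potential x| <=
  (2 * c + 2 * B * vQ * (rho * Cd + 1)) * M * ratio (size w).
Proof.
move=> sw Wx; rewrite (proj2 potential_smooth)// /potential_deriv.
have psiP y : cell q y -> `|psi w y| <= M * ratio (size w).
  move=> yq; rewrite /psi; have [Zy|Zy] := pselect (Z y); last first.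
    by rewrite chiZ// scale0r normr0 mulr_ge0.
  rewrite normrZ -[leRHS]mul1r; apply: ler_pM => //; apply: phiM => //.
  by split => //; exact: ZD.
have mpsi : cmeas (cell q) (psi w).
  apply: cmeasS (@subsetT _ _) (cmeas_continuous openT (fun y _ => @cpsi w y)) => //.
  by rewrite preimage_setT.
have [_ bI] := conv_bound mh hc x mQ (@subset_refl _ _) mpsi
  (mulr_ge0 M0' (ratio_ge0 _)) psiP.
have bC := @cutoff_terms_bound [::] w x Wx sw.
have etaP y : E y -> `|eta y| <= M.
  move=> [Sy _]; rewrite /eta normrZ -[leRHS]mul1r; apply: ler_pM => //.
  have := @phiM [::] y isT Sy.
  by rewrite /roumieu_ratio /= expr0 divr1 mulr1.
have [_ bJ] := smooth_conv_bound q0 oE EQ EN WNG Wx (cwh (u:=w)) meta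
    (mulr_ge0 B0 (ratio_ge0 (size w)))
    (fun y Ey => hB sw (WNG Wx (EN Ey))) M0' etaP.
have bC' : `|cutoff_terms [::] w x| <= 2 * (B * Cd * M * vQ) * (rho * ratio (size w)).
  apply: le_trans bC _; rewrite add0n.
  have K0 : 0 <= 2 * (B * Cd * M * vQ) by rewrite !mulr_ge0.
  case: (size w) => [|m].
    by rewrite mul0r; apply: mulr_ge0 => //; apply: mulr_ge0; [exact: ltW|].
  rewrite mulrCA; apply: ler_wpM2l => //.
  rewrite le_eqVlt; apply/orP; left; apply/eqP; rewrite /roumieu_ratio /= factS natrM exprS.
  by field; rewrite expf_neq0 gt_eqF.
apply: (@le_trans _ _ (2 * (M * ratio (size w) * c) +
  2 * (B * Cd * M * vQ) * (rho * ratio (size w)) +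
  2 * (B * ratio (size w) * M * vQ))).
  rewrite (le_trans (ler_normD _ _))// lerD// (le_trans (ler_normD _ _))// lerD//.
by rewrite le_eqVlt; apply/orP; left; apply/eqP; ring.
Qed.

End densities.
End core.

(** * The bilinear estimate *)

Section estimate.
Variables (R : realType) (n : nat) (q : 'I_n -> R) (lambda rho : R).
Hypotheses (q0 : forall i, 0 < q i) (n2 : (2 <= n)%N)
  (lambdaP : 0 < lambda < n%:R - 1) (rho0 : 0 < rho).
Local Notation V := 'rV[R]_n.
Local Notation C := (Rcomplex R).
Local Notation vot := (@vec_of_tuple R n).
Local Notation ratio := (roumieu_ratio rho).

(** Normalized kernels, defined everywhere, with quantitative bounds. *)
Definition good_kernel (G : set V) (a B : R) (h : V -> C) : Prop :=
  [/\ per q h, (forall x, ~ lattice q x -> {for x, continuous h}),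
    (forall x, lattice q x -> h x = 0),
    (forall x, centered_cell q x -> x != 0 -> `|h x| * enorm x `^ lambda <= a) &
    csmooth G h /\
    forall w z, ord_sorted w -> G z -> `|wderiv w h z| <= B * ratio (size w)].

(** Normalized densities on the periodic open set [D]. *)
Definition good_density (D : set V) (M : R) (phi : V -> C) : Prop :=
  [/\ per q phi, csmooth D phi &
    forall w y, ord_sorted w -> cell q y -> D y ->
      `|wderiv w phi y| <= M * ratio (size w)].

(** The geometric situation of the cutoff: the periodic open set [D] is covered,
    within the cell, by its compact subset [A] and by the relatively compact open
    set [O]; the differences of points of [W] and [N], which contains [O], stay
    in [G]. *)
Definition cutoff_geometry (D O N W G A : set V) : Prop :=
  [/\ open D, (forall x z, D x -> D (x + qmul q z)), open O, O `<=` N & compact N] /\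
  [/\ open W, open G & forall x y, W x -> N y -> G (x - y)] /\
  [/\ compact A, A `<=` D & forall x, cell q x -> D x -> ~ O x -> A x].

(** The bilinear estimate: the constant [K] depends on the geometry only, not on
    the kernel or on the density. *)
Lemma potential_estimate D O N W G A : cutoff_geometry D O N W G A ->
  exists2 K : R, 0 <= K & forall a B M h phi, 0 <= a -> 0 <= B -> 0 <= M ->
    good_kernel G a B h -> good_density D M phi ->
    [/\ csmooth W (potential q D h phi),
      (forall w x, ord_sorted w -> W x ->
        `|wderiv w (potential q D h phi) x| <= K * (a + B) * M * ratio (size w)) &
      forall x, cint (cell q `&` D) (fun y => h (x - y) * phi y)].
Proof.
move=> [[oD pD oO ON cN] [[oW oG WNG] [cA AD DOA]]].
have [chi [dchi [Z [c1chi chi01 pchi chiA [cZ ZD chiZ]]]]] :=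
  periodic_cutoff q0 oD pD cA AD.
have [Cd Cd0 dchiC] := @dchi_bounded _ _ q D O _ _ c1chi.
have [K0 K00 HK] := kernel_boundP q0 n2 lambdaP.
pose vQ : R := \prod_i q i.
have vQ0 : 0 <= vQ by apply: prodr_ge0 => i _; exact: ltW.
pose K1 := 2 * K0; pose K2 := 2 * (vQ * (rho * Cd + 1)).
have K10 : 0 <= K1 by exact: mulr_ge0.
have K20 : 0 <= K2.
  by rewrite mulr_ge0// mulr_ge0// addr_ge0// mulr_ge0// ltW.
exists (K1 + K2); first exact: addr_ge0.
move=> a B M h phi a0 B0 M0 [ph hc h0 ha [sh hB]] [pphi sphi phiM].
have mh := cmeas_off_lattice q0 hc h0.
have kb := HK a h a0 ph hc h0 ha.
have phiM0 y : (cell q `&` D) y -> `|phi y| <= M.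
  move=> [yq Dy]; have := phiM [::] y isT yq Dy.
  by rewrite /roumieu_ratio /= expr0 divr1 mulr1.
have phiM' w y : ord_sorted w -> (cell q `&` D) y ->
    `|wderiv w phi y| <= M * ratio (size w).
  by move=> sw [yq Dy]; exact: phiM.
split.
- exact: (proj1 (potential_smooth q0 oD oO ON cN oW oG WNG c1chi chi01 pchi
    chiA cZ ZD chiZ DOA mh kb ph sh pphi sphi M0 phiM0)).
- move=> w x sw Wx.
  have := potential_bound q0 oD oO ON cN oW oG WNG c1chi chi01 pchi
    chiA cZ ZD chiZ DOA mh kb ph sh pphi sphi M0 phiM0 rho0 B0 M0 Cd0 hB phiM'
    dchiC sw Wx.
  move=> /le_trans; apply; rewrite ler_wpM2r ?(ltW (roumieu_ratio_gt0 rho0 _))//.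
  rewrite ler_wpM2r// -/vQ.
  have -> : 2 * (K0 * a) + 2 * B * vQ * (rho * Cd + 1) = K1 * a + K2 * B.
    by rewrite /K1 /K2; ring.
  by rewrite mulrDl lerD// ler_wpM2l// ?lerDl// lerDr.
- move=> x.
  have oS : open (cell q `&` D) by apply: openI => //; exact: open_cell.
  have mphi : cmeas (cell q `&` D) phi.
    apply: cmeas_continuous => // y [_ Dy].
    exact: (@csmooth_cont _ _ D phi [::] y sphi Dy).
  apply: (proj1 (conv_bound mh kb x (open_measurable_vec oS) _ mphi M0 phiM0)).
  by move=> y [].
Qed.

(** ** From the function spaces to normalized kernels and densities *)

Lemma roumieu_bound (U K : set V) (f : V -> C) (B : R) w x : open U -> csmooth U f ->
  (roumieu_norm rho U K f <= B%:E)%E -> K x -> U x -> ord_sorted w ->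
  `|wderiv w f x| <= B * ratio (size w).
Proof.
move=> oU sf fB Kx Ux sw; pose beta j := count_mem j w.
have wE : w = mword beta by exact: sorted_mword.
have sE : mlength beta = size w by rewrite -size_mword -wE.
have r0 := roumieu_ratio_gt0 rho0 (size w).
have ri : rho ^+ size w / (size w)`!%:R = (ratio (size w))^-1.
  by rewrite /roumieu_ratio invf_div.
have L : (((ratio (size w))^-1)%:E * `|wderiv w f x|%:E <= B%:E)%E.
  apply: le_trans fB; apply: le_trans (ereal_sup_ubound _); last by exists beta.
  rewrite sE ri; apply: lee_wpmul2l; first by rewrite lee_fin invr_ge0 ltW.
  apply: ereal_sup_ubound; exists x => //.
  by rewrite (cl_derivE beta sf Ux (subset_closure Ux)) mderivE -wE.
by move: L; rewrite -EFinM lee_fin mulrC ler_pdivrMr.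
Qed.

Lemma roumieu_norm_le (U K : set V) (f : V -> C) (B : R) :
  (forall beta x, K x -> `|cl_deriv U beta f x| <= B * ratio (mlength beta)) ->
  (roumieu_norm rho U K f <= B%:E)%E.
Proof.
move=> H; apply: ub_ereal_sup => _ [beta _ <-].
have r0 := roumieu_ratio_gt0 rho0 (mlength beta).
apply: (@le_trans _ _ (((ratio (mlength beta))^-1)%:E *
    (B * ratio (mlength beta))%:E)%E).
  rewrite (_ : rho ^+ _ / _ = (ratio (mlength beta))^-1); last by rewrite /roumieu_ratio invf_div.
  apply: lee_wpmul2l; first by rewrite lee_fin invr_ge0 ltW.
  by apply: ub_ereal_sup => _ [x Kx <-]; rewrite lee_fin H.
by rewrite -EFinM lee_fin mulrC mulfK// gt_eqF.
Qed.

Lemma roumieu_norm_ge0 (U K : set V) (f : V -> C) : K !=set0 -> (0 <= roumieu_norm rho U K f)%E.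
Proof.
move=> [x Kx]; apply: le_trans (ereal_sup_ubound _); last by exists (fun=> 0%N).
apply: mule_ge0; first by rewrite lee_fin divr_ge0// exprn_ge0// ltW.
by apply: le_trans (ereal_sup_ubound _); last (by exists x); rewrite lee_fin.
Qed.

Lemma A0_norm_ge0 (mu : R) (h : V -> C) : (0 <= A0_norm q mu h)%E.
Proof.
pose i0 : 'I_n := Ordinal (ltnW n2).
apply: le_trans (ereal_sup_ubound _); last first.
  exists (\row_i (q i / 4)) => //; split.
    by move=> i; rewrite mxE; have := q0 i; move=> ?; apply/andP; split; lra.
  move=> /= /rowP/(_ i0); rewrite !mxE => /eqP.
  by rewrite mulf_eq0 invr_eq0 pnatr_eq0 orbF gt_eqF.
by rewrite lee_fin mulr_ge0// powR_ge0.
Qed.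

(** The kernel with the value 0 on the lattice. *)
Definition lattice_zero (h : V -> C) (x : V) : C :=
  if `[< lattice q x >] then 0 else h x.

Lemma lattice_shift x z : lattice q (x + qmul q z) <-> lattice q x.
Proof.
split=> -[z' _ zE].
  by exists (z' - z) => //; rewrite qmulD qmulN zE addrK.
by exists (z' + z) => //; rewrite qmulD zE.
Qed.

Lemma lattice_zero_off h x : ~ lattice q x -> lattice_zero h x = h x.
Proof. by move=> nx; rewrite /lattice_zero asboolF. Qed.

Lemma lattice_zero_good (G : set V) (a B : R) h : open G ->
  closure G `&` lattice q = set0 ->
  (forall x, ~ lattice q x -> {for x, continuous h}) ->
  periodic_on q (~` lattice q) h -> csmooth G h ->
  (A0_norm q lambda h <= a%:E)%E -> (roumieu_norm rho G (closure G) h <= B%:E)%E ->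
  good_kernel G a B (lattice_zero h).
Proof.
move=> oG Gl hc ph sh ha hB.
have off x : ~ lattice q x -> h x = lattice_zero h x.
  by move=> /lattice_zero_off ->.
have Goff x : G x -> ~ lattice q x.
  by move=> Gx lx; rewrite -[False]/(set0 x) -Gl; split => //; exact: subset_closure.
have [sz dz] := @csmooth_eq _ _ G h (lattice_zero h) oG (fun x Gx => off x (Goff x Gx)) sh.
split.
- move=> x z; rewrite /lattice_zero.
  case: asboolP => [/lattice_shift lx|nx]; first by rewrite asboolT.
  have nx' : ~ lattice q x by move=> /lattice_shift.
  by rewrite asboolF// ph.
- move=> x nx; apply: (continuous_near_eq (open_off_lattice q0) nx _ (hc x nx)).
  by move=> y; exact: off.
- by move=> x lx; rewrite /lattice_zero asboolT.
- move=> x xc x0; have nx : ~ lattice q x.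
    move=> [z _ zx]; move/eqP: x0; apply; rewrite -zx; apply/rowP => i.
    rewrite !mxE; have := xc i; rewrite -zx !mxE => /andP[z1 z2].
    suff -> : z ord0 i = 0 by rewrite mulr0.
    have qi := q0 i.
    have z3 : (z ord0 i)%:~R < 1 :> R by rewrite -(ltr_pM2l qi); lra.
    have z4 : -1 < (z ord0 i)%:~R :> R by rewrite -(ltr_pM2l qi); lra.
    move: z3 z4; rewrite -[1 in X in X -> _]/((1 : int)%:~R) ltr_int.
    rewrite -[- 1](rmorphN1 (intr : int -> R)) ltr_int.
    lia.
  rewrite lattice_zero_off// -lee_fin; apply: le_trans ha.
  by apply: ereal_sup_ubound; exists x => //; split => //; exact/eqP.
- split=> // w z sw Gz; rewrite dz//.
  exact: (roumieu_bound oG sh hB (subset_closure Gz) Gz sw).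
Qed.

(** The representative of a point in the half-open cell. *)
Definition cell_repr (x : V) : V :=
  x - qmul q (\row_i Num.floor (x ord0 i / q i)).

Lemma cell_repr_per x z : cell_repr (x + qmul q z) = cell_repr x.
Proof.
apply/rowP => i; rewrite !mxE mulrDl mulrAC divff ?gt_eqF// mul1r floorDrz ?intr_int//.
by rewrite intrKfloor rmorphD/=; ring.
Qed.

Lemma cell_repr_id x : cell q x -> cell_repr x = x.
Proof.
move=> xq; apply/rowP => i; rewrite !mxE; have /andP[x0 x1] := xq i.
suff -> : Num.floor (x ord0 i / q i) = 0 by rewrite mulr0 subr0.
by apply: floor_def; rewrite add0r ler_pdivlMr// ltr_pdivrMr// mul0r mul1r (ltW x0).
Qed.

Lemma per_cell_repr (v : V -> C) : per q (v \o cell_repr).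
Proof. by move=> x z; rewrite /= cell_repr_per. Qed.

End estimate.

(** * Continuity of the potential as a bilinear operator *)

Section countable_lattice.
Variables (R : realType) (n : nat) (q : 'I_n -> R).
Hypotheses (q0 : forall i, 0 < q i) (n0 : (0 < n)%N).
Local Notation V := 'rV[R]_n.
Local Notation C := (Rcomplex R).
Local Notation T := (n.-tuple (measurableTypeR R)).
Local Notation vot := (@vec_of_tuple R n).
Local Notation leb := (lebesgue_tuple R n).
Local Notation vol := (@volume_integral R n).

Lemma lattice_countable : countable (lattice q).
Proof. exact: sub_countable (card_image_le _ _) (countableP _). Qed.

Lemma countable_tuple_measurable (N : set T) : countable N -> measurable N.
Proof.
apply: countable_measurable => t.
rewrite (_ : [set t] = [set s | forall i, [set tnth t i] (tnth s i)]).
  by apply: (@measurable_tuple_box _ _ (fun i => [set tnth t i])) => i;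
    exact: measurable_set1.
apply/seteqP; split=> [_ -> //|s st].
by apply: eq_from_tnth => i; have := st i.
Qed.

(** No assumption on the values on the lattice: every function is measurable on a
    countable set. *)
Lemma cmeas_off_lattice_any (h : V -> C) :
  (forall x, ~ lattice q x -> {for x, continuous h}) -> cmeas setT h.
Proof.
move=> hc; have mU := open_measurable_vec (open_off_lattice q0).
have cL : countable (vot @^-1` lattice q).
  pose g (v : V) : T := [tuple v ord0 i | i < n].
  apply: sub_countable (_ : countable (g @` lattice q)).
    apply: subset_card_le => t Lt; exists (vot t) => //.
    by apply: eq_from_tnth => i; rewrite tnth_mktuple vec_of_tupleE.
  exact: sub_countable (card_image_le _ _) lattice_countable.
have mL := countable_tuple_measurable cL.
have any (f : T -> measurableTypeR R) : measurable_fun (vot @^-1` lattice q) f.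
  move=> _ B mB; apply: countable_tuple_measurable.
  by apply: sub_countable cL; apply: subset_card_le; exact: subIsetl.
have [ur ui] := cmeas_continuous (open_off_lattice q0) hc.
have -> : [set: V] = (~` lattice q) `|` lattice q by rewrite setUC setUv.
by split; rewrite preimage_setU; apply/measurable_funU.
Qed.

(** The points where the reflected kernel is singular have one coordinate in a
    countable set, hence form a null set. *)
Lemma reflected_lattice_null (x : V) : exists N : set V,
  [/\ measurable (vot @^-1` N), leb (vot @^-1` N) = 0%E &
      forall y, lattice q (x - y) -> N y].
Proof.
pose i0 : 'I_n := Ordinal n0.
pose B : set R := range (fun z : int => x ord0 i0 - q i0 * z%:~R).
have cB : countable B by exact: sub_countable (card_image_le _ _) (countableP _).
have mB : measurable (B : set (measurableTypeR R)).
  have m1 (t : measurableTypeR R) : measurable [set t] by exact: measurable_set1.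
  exact: countable_measurable m1 cB.
exists [set y | B (y ord0 i0)]; split.
- rewrite (_ : _ @^-1` _ = [set t : T | B (tnth t i0)]).
    exact: measurable_coord_preimage.
  by apply/seteqP; split=> t /=; rewrite vec_of_tupleE.
- exact: coord_countable_null.
- move=> y [z _ zy]; exists (z ord0 i0) => //.
  have := congr1 (fun a : V => a ord0 i0) zy; rewrite !mxE => ->.
  by rewrite opprB addrCA subrr addr0.
Qed.

(** Integrability is insensitive to null sets. *)
Lemma cint_eq_null (E N : set V) (f g : V -> C) : measurable (vot @^-1` E) ->
  measurable (vot @^-1` N) -> leb (vot @^-1` N) = 0%E -> cmeas E f -> cint E g ->
  (forall y, E y -> ~ N y -> f y = g y) -> cint E f.
Proof.
move=> mE mN N0 [fr fi] gI fg; have [gr gi] := cint_meas gI.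
have key (p : C -> R) :
    measurable_fun (vot @^-1` E) (fun t => p (f (vot t)) : measurableTypeR R) ->
    measurable_fun (vot @^-1` E) (fun t => p (g (vot t)) : measurableTypeR R) ->
    leb.-integrable (vot @^-1` E) (fun t => (p (g (vot t)))%:E) ->
    leb.-integrable (vot @^-1` E) (fun t => (p (f (vot t)))%:E).
  move=> mf mg /integrableP[_ I]; apply/integrableP; split; first exact/measurable_EFinP.
  apply: le_lt_trans I; rewrite le_eqVlt; apply/orP; left; apply/eqP.
  apply: ae_eq_integral => //.
  - by apply: measurableT_comp => //; exact/measurable_EFinP.
  - by apply: measurableT_comp => //; exact/measurable_EFinP.
  - exists (vot @^-1` N); split => // t /= /not_implyP[Dt H].
    by apply: contrapT => nN; apply: H; rewrite fg.
by case: gI => Ir Ii; split; [exact: (key _ fr gr Ir)|exact: (key _ fi gi Ii)].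
Qed.

End countable_lattice.

Section operator.
Variables (R : realType) (n : nat) (q : 'I_n -> R) (lambda rho : R).
Hypotheses (q0 : forall i, 0 < q i) (n2 : (2 <= n)%N)
  (lambdaP : 0 < lambda < n%:R - 1) (rho0 : 0 < rho).
Local Notation V := 'rV[R]_n.
Local Notation C := (Rcomplex R).
Local Notation vot := (@vec_of_tuple R n).
Local Notation vol := (@volume_integral R n).
Local Notation good_kernel := (@good_kernel R n q lambda rho).
Local Notation good_density := (@good_density R n q rho).
Local Notation ratio := (roumieu_ratio rho).

(** The part of the membership in the kernel space that is stable under
    subtraction and independent of the norms. *)
Definition kernel_regular (G : set V) (u : V -> C) : Prop :=
  [/\ forall x, ~ lattice q x -> {for x, continuous u},
      periodic_on q (~` lattice q) u & csmooth G u].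

Lemma space_H_regular G u : nf_mem (space_H q lambda rho G) u -> kernel_regular G u.
Proof.
move=> [[/= [uc _] up _ _] [[_ uG _] _]]; split => //.
exact/csmoothP.
Qed.

Lemma kernel_regularB G u v : open G -> kernel_regular G u -> kernel_regular G v ->
  kernel_regular G (u \- v)%R.
Proof.
move=> oG [uc up us] [vc vp vs]; split.
- move=> x nx; apply: (@continuousB _ C V); [exact: uc|exact: vc].
- by move=> x z nx; rewrite /= up// vp.
- exact: (proj1 (csmoothB oG us vs)).
Qed.

Lemma space_H_kernel G u (a : R) : open G -> closure G `&` lattice q = set0 ->
  closure G !=set0 -> kernel_regular G u ->
  (nf_norm (space_H q lambda rho G) u <= a%:E)%E -> good_kernel G a a (lattice_zero q u).
Proof.
move=> oG Gl G0 [uc up us] /= ua.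
have r0 := roumieu_norm_ge0 rho0 G u G0.
have s0 : (0 <= \sum_(j < n) A0_norm q (lambda + 1) (partial j u))%E.
  by apply: sume_ge0 => j _; exact: A0_norm_ge0.
have A00 := A0_norm_ge0 q0 n2 lambda u.
apply: lattice_zero_good => //; apply: le_trans ua; rewrite /A1_norm.
  by rewrite -addeA leeDl// adde_ge0.
by rewrite leeDr// adde_ge0.
Qed.

Lemma space_H_norm_ge0 G u : closure G !=set0 ->
  (0 <= nf_norm (space_H q lambda rho G) u)%E.
Proof.
move=> G0; rewrite /= /A1_norm; apply: adde_ge0; last exact: roumieu_norm_ge0.
apply: adde_ge0; first exact: A0_norm_ge0.
by apply: sume_ge0 => j _; exact: A0_norm_ge0.
Qed.

Lemma space_H_norm_fin G u : nf_mem (space_H q lambda rho G) u -> 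
  (nf_norm (space_H q lambda rho G) u < +oo)%E.
Proof.
move=> [[/= _ _ [_ _ u0] uj] [_ ur]]; rewrite /A1_norm.
apply: lte_add_pinfty => //; apply: lte_add_pinfty => //.
by apply: lte_sum_pinfty => j _; have [] := uj j.
Qed.

(* The interior and the exterior potentials are treated together: [F] is the space
   of densities, [P] the operator, and [regular] the part of the membership in [F]
   that is independent of the norm and stable under subtraction. *)
Variables (D O N W G A Om1 : set V) (F : nfspace R n)
  (P : (V -> C) -> (V -> C) -> (V -> C)) (regular : (V -> C) -> Prop).
Hypotheses (sep : cutoff_geometry q D O N W G A)
  (Gl : closure G `&` lattice q = set0) (G0 : closure G !=set0)
  (Om1W : closure Om1 `<=` W)
  (clW : closure (periodization q Om1) `<=` periodization q W).
Hypotheses (PE : forall u v x, P u v x = vol (cell q `&` D) (fun y => u (x - y) * v y))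
  (Freg : forall v, nf_mem F v -> regular v)
  (regB : forall v w, regular v -> regular w -> regular (v \- w)%R)
  (Fdens : forall v (M : R), regular v -> (nf_norm F v <= M%:E)%E ->
     good_density D M (v \o cell_repr q))
  (Fge0 : forall v, (0 <= nf_norm F v)%E)
  (Ffin : forall v, nf_mem F v -> (nf_norm F v < +oo)%E).

Let H := roumieu_per q rho Om1.
Let EH := space_H q lambda rho G.
Let U := periodization q Om1.
Let S := cell q `&` D.
Let tu (u : V -> C) := lattice_zero q u.
Let tv (v : V -> C) := v \o cell_repr q.
Let pot := potential q D.

Let oG : open G. Proof. by have [_ [[]]] := sep. Qed.
Let oW : open W. Proof. by have [_ [[]]] := sep. Qed.
Let oS : open S. Proof. by apply: openI; [exact: open_cell|have [[]] := sep]. Qed.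
Let mS : measurable (vot @^-1` S) := open_measurable_vec oS.
Let oPW : open (periodization q W). Proof. exact: open_periodization. Qed.

Let Om1U : closure Om1 `<=` closure U.
Proof.
apply: closure_subset => x xO; apply/periodizationP; exists 0.
by rewrite qmul0 subr0.
Qed.

Let tv_eq v y : S y -> tv v y = v y.
Proof. by move=> [yq _]; rewrite /tv /= cell_repr_id. Qed.

Let tuB u v x : tu (u \- v)%R x = tu u x - tu v x.
Proof. by rewrite /tu /lattice_zero; case: ifP => // _; rewrite subrr. Qed.

Let pot_per h phi : per q h -> per q (pot h phi).
Proof. by move=> ph x z; apply: eq_vol => y _; rewrite addrAC ph. Qed.

Let mem_bound (u : V -> C) : nf_mem EH u -> exists2 a : R, 0 <= a & good_kernel G a a (tu u).
Proof.
move=> uE; have f0 := space_H_norm_ge0 u G0; have ff := space_H_norm_fin uE.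
have ffin : nf_norm EH u \is a fin_num by rewrite ge0_fin_numE.
exists (fine (nf_norm EH u)); first exact: fine_ge0.
by apply: space_H_kernel => //; [exact: space_H_regular|rewrite fineK].
Qed.

Let mem_density (v : V -> C) : nf_mem F v -> exists2 M : R, 0 <= M & good_density D M (tv v).
Proof.
move=> vF; have f0 := Fge0 v; have ff := Ffin vF.
have ffin : nf_norm F v \is a fin_num by rewrite ge0_fin_numE.
exists (fine (nf_norm F v)); first exact: fine_ge0.
by apply: Fdens; [exact: Freg|rewrite fineK].
Qed.

(* Passing to the normalized kernel and density does not change the potential. *)
Let raw u v (a M : R) x : nf_mem EH u -> nf_mem F v -> 0 <= a -> 0 <= M ->
  good_kernel G a a (tu u) -> good_density D M (tv v) ->
  cint S (fun y => u (x - y) * v y) /\ P u v x = pot (tu u) (tv v) x.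
Proof.
move=> uE vF a0 M0 gu gv.
have [K _ /(_ a a M (tu u) (tv v) a0 a0 M0 gu gv)[_ _ ci]] :=
  potential_estimate q0 n2 lambdaP rho0 sep.
have [N' [mN N0 Nlat]] := reflected_lattice_null q (ltnW n2) x.
have eqN y : S y -> ~ N' y -> u (x - y) * v y = tu u (x - y) * tv v y.
  move=> Sy nN; rewrite tv_eq// /tu lattice_zero_off// => /Nlat.
  exact: nN.
have [uc _ _] := space_H_regular uE.
have mu := cmeas_off_lattice_any q0 uc.
have mtv : cmeas S (tv v).
  have [_ sv _] := gv; apply: cmeas_continuous => // y [_ Dy].
  exact: (@csmooth_cont _ _ D _ [::] y sv Dy).
have mv : cmeas S v by apply: cmeas_ext mtv => y; exact: tv_eq.
have mraw : cmeas S (fun y => u (x - y) * v y).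
  by apply: cmeasM => //; exact: cmeas_reflect.
split; first exact: (cint_eq_null mS mN N0 mraw (ci x)).
by rewrite PE; exact: (vol_eq_null mS mraw (cint_meas (ci x)) mN N0).
Qed.

Let potD u v u' v' x :
  (forall z, cint S (fun y => tu u (z - y) * tv v y)) ->
  (forall z, cint S (fun y => tu u' (z - y) * tv v' y)) ->
  (forall z, cint S (fun y => tu u' (z - y) * tv v y)) ->
  (forall z, cint S (fun y => tu u (z - y) * tv v' y)) ->
  pot (tu u) (tv v) x - pot (tu u') (tv v') x =
  pot (tu (u \- u')%R) (tv (v \- v')%R) x + pot (tu (u \- u')%R) (tv v') x +
  pot (tu u') (tv (v \- v')%R) x.
Proof.
move=> c1 c2 c3 c4.
have -> : pot (tu (u \- u')%R) (tv (v \- v')%R) x =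
    pot (tu u) (tv v) x - pot (tu u) (tv v') x -
    (pot (tu u') (tv v) x - pot (tu u') (tv v') x).
  rewrite /pot /potential -!volB//; [|exact: cintB..].
  by apply: eq_vol => y _; rewrite tuB /tv /=; ring.
have -> : pot (tu (u \- u')%R) (tv v') x =
    pot (tu u) (tv v') x - pot (tu u') (tv v') x.
  rewrite /pot /potential -!volB//.
  by apply: eq_vol => y _; rewrite tuB /tv /=; ring.
have -> : pot (tu u') (tv (v \- v')%R) x =
    pot (tu u') (tv v) x - pot (tu u') (tv v') x.
  rewrite /pot /potential -!volB//.
  by apply: eq_vol => y _; rewrite /tv /=; ring.
by ring.
Qed.

Let smooth_mem (f : V -> C) (B : R) : per q f -> csmooth W f ->
  (forall w x, ord_sorted w -> W x -> `|wderiv w f x| <= B * ratio (size w)) ->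
  nf_mem H f.
Proof.
move=> pf sW fB; have sf := per_csmooth pf sW.
have mwE beta x : closure U x -> cl_deriv U beta f x = wderiv (mword beta) f x.
  by move=> cx; rewrite (cl_derivE beta sf (clW cx) cx) mderivE.
have bW beta x : periodization q W x ->
    `|wderiv (mword beta) f x| <= B * ratio (mlength beta).
  move=> /periodizationP[z Wz]; rewrite -(per_sub x z (per_wderiv (mword beta) pf)).
  by rewrite -size_mword; apply: fB => //; exact: mword_sorted.
split; last first.
  apply: (@le_lt_trans _ _ B%:E); last by rewrite ltry.
  apply: roumieu_norm_le => // beta x /Om1U cx; rewrite mwE//.
  by apply: bW; exact: clW.
split.
- split.
  + apply: continuous_in_subspaceT => x; rewrite inE => cx.
    exact: (@csmooth_cont _ _ _ f [::] x sf (clW cx)).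
  + apply/csmoothP; apply: csmooth_sub sf => x Ux.
    by apply: clW; exact: subset_closure.
  + move=> beta; exists (mderiv beta f); split=> //.
    apply: continuous_in_subspaceT => x; rewrite inE => cx; rewrite mderivE.
    exact: (csmooth_cont sf (clW cx)).
- by move=> x z _; exact: pf.
- move=> beta; exists (B * ratio (mlength beta)) => x cx; rewrite mwE//.
  by apply: bW; exact: clW.
Qed.

Let smooth_norm (f : V -> C) (B : R) : csmooth (periodization q W) f ->
  (forall w x, ord_sorted w -> W x -> `|wderiv w f x| <= B * ratio (size w)) ->
  (nf_norm H f <= B%:E)%E.
Proof.
move=> sf fB; apply: roumieu_norm_le => // beta x cx.
rewrite (cl_derivE beta sf (clW (Om1U cx)) (Om1U cx)) mderivE -size_mword.
by apply: fB; [exact: mword_sorted|exact: Om1W].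
Qed.

Lemma operator_maps_into : maps_into EH F H P.
Proof.
move=> u v uE vF; have [a a0 gu] := mem_bound uE; have [M M0 gv] := mem_density vF.
have [K _ HK] := potential_estimate q0 n2 lambdaP rho0 sep.
have [s b _] := HK a a M _ _ a0 a0 M0 gu gv.
rewrite (_ : P u v = pot (tu u) (tv v)).
  by apply: smooth_mem s b; apply: pot_per; have [] := gu.
by apply/funext => x; have [] := raw x uE vF a0 M0 gu gv.
Qed.

Lemma operator_bilinear : bilinear_into EH F H P.
Proof.
split=> a u1 u2 u3 E1 E2 E3 x _; rewrite !PE.
- have [a1 a10 g1] := mem_bound E1; have [a2 a20 g2] := mem_bound E2.
  have [M M0 g3] := mem_density E3.
  have [I1 _] := raw x E1 E3 a10 M0 g1 g3; have [I2 _] := raw x E2 E3 a20 M0 g2 g3.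
  rewrite -volZ// -volD//; last exact: cintZ.
  by apply: eq_vol => y _; ring.
- have [a1 a10 g1] := mem_bound E1; have [M2 M20 g2] := mem_density E2.
  have [M3 M30 g3] := mem_density E3.
  have [I1 _] := raw x E1 E2 a10 M20 g1 g2; have [I2 _] := raw x E1 E3 a10 M30 g1 g3.
  rewrite -volZ// -volD//; last exact: cintZ.
  by apply: eq_vol => y _; ring.
Qed.

Lemma operator_continuous : continuous_into EH F H P.
Proof.
move=> u0 v0 uE0 vF0 eps eps0.
have [a0 a00 gu0] := mem_bound uE0; have [M0 M00 gv0] := mem_density vF0.
have [K K0 HK] := potential_estimate q0 n2 lambdaP rho0 sep.
pose T0 := K * (2 + 2 * M0 + 2 * a0).
have T00 : 0 <= T0 by rewrite mulr_ge0// !addr_ge0// mulr_ge0.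
pose d := Num.min 1 (eps / (2 * (T0 + 1))).
have T1 : 0 < 2 * (T0 + 1) by rewrite mulr_gt0// ltr_wpDl.
have d0 : 0 < d by rewrite lt_min ltr01 divr_gt0.
have d1 : d <= 1 by rewrite ge_min lexx.
have dT : T0 * d <= eps / 2.
  apply: (@le_trans _ _ (T0 * (eps / (2 * (T0 + 1))))).
    by apply: ler_wpM2l => //; rewrite ge_min lexx orbT.
  have -> : eps / (2 * (T0 + 1)) = eps / 2 / (T0 + 1).
    by field; rewrite gt_eqF// ltr_wpDl.
  rewrite mulrA ler_pdivrMr ?ltr_wpDl// mulrC ler_pM2l ?divr_gt0//.
  by rewrite lerDl.
exists d => // u v uE vF duv.
have [a ap gu] := mem_bound uE; have [M Mp gv] := mem_density vF.
have du : (nf_norm EH (u \- u0)%R <= d%:E)%E.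
  apply: le_trans (ltW duv); rewrite leeDl//; exact: Fge0.
have dv : (nf_norm F (v \- v0)%R <= d%:E)%E.
  apply: le_trans (ltW duv); rewrite leeDr//; exact: space_H_norm_ge0.
have gdu : good_kernel G d d (tu (u \- u0)%R).
  apply: space_H_kernel => //; apply: kernel_regularB => //; exact: space_H_regular.
have gdv : good_density D d (tv (v \- v0)%R).
  by apply: Fdens dv; apply: regB; exact: Freg.
have [_ _ c1] := HK _ _ _ _ _ ap ap Mp gu gv.
have [_ _ c2] := HK _ _ _ _ _ a00 a00 M00 gu0 gv0.
have [_ _ c3] := HK _ _ _ _ _ a00 a00 Mp gu0 gv.
have [_ _ c4] := HK _ _ _ _ _ ap ap M00 gu gv0.
have [s1 b1 _] := HK _ _ _ _ _ (ltW d0) (ltW d0) (ltW d0) gdu gdv.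
have [s2 b2 _] := HK _ _ _ _ _ (ltW d0) (ltW d0) M00 gdu gv0.
have [s3 b3 _] := HK _ _ _ _ _ a00 a00 (ltW d0) gu0 gdv.
set f1 := potential _ _ _ _ in s1 b1; set f2 := potential _ _ _ _ in s2 b2.
set f3 := potential _ _ _ _ in s3 b3.
have -> : (P u v \- P u0 v0)%R = ((f1 \+ f2) \+ f3)%R.
  apply/funext => x /=; have [_ ->] := raw x uE vF ap Mp gu gv.
  have [_ ->] := raw x uE0 vF0 a00 M00 gu0 gv0.
  exact: potD.
have [pdu _ _ _ _] := gdu; have [pu0 _ _ _ _] := gu0.
have p1 : csmooth (periodization q W) f1 by apply: per_csmooth s1; exact: pot_per.
have p2 : csmooth (periodization q W) f2 by apply: per_csmooth s2; exact: pot_per.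
have p3 : csmooth (periodization q W) f3 by apply: per_csmooth s3; exact: pot_per.
have [s12 _] := csmoothD oPW p1 p2; have [s123 _] := csmoothD oPW s12 p3.
have [sW12 w12] := csmoothD oW s1 s2; have [_ w123] := csmoothD oW sW12 s3.
apply: (@le_lt_trans _ _ (eps / 2)%:E); last first.
  by rewrite lte_fin ltr_pdivrMr// ltr_pMr// ltr1n.
apply: smooth_norm => // w x sw Wx; rewrite w123// w12//.
rewrite (le_trans (ler_normD _ _))//.
apply: (@le_trans _ _ (K * (d + d) * d * ratio (size w) +
    K * (d + d) * M0 * ratio (size w) + K * (a0 + a0) * d * ratio (size w))).
  rewrite lerD ?b3// (le_trans (ler_normD _ _))// lerD ?b1 ?b2//.
rewrite -!mulrDl ler_wpM2r ?(ltW (roumieu_ratio_gt0 rho0 _))//.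
apply: le_trans dT; rewrite /T0.
have -> : K * (2 + 2 * M0 + 2 * a0) * d =
  K * (d + d) + K * (d + d) * M0 + K * (a0 + a0) * d by ring.
rewrite !lerD2r -[leRHS]mulr1; apply: ler_wpM2l => //.
by rewrite mulr_ge0// addr_ge0// ltW.
Qed.

End operator.

(** * Geometry of the periodic sets *)

Section geometry.
Variables (R : realType) (n : nat) (q : 'I_n -> R).
Hypotheses (q0 : forall i, 0 < q i).
Local Notation V := 'rV[R]_n.

Lemma closureP (A : set V) (x : V) :
  closure A x <-> forall e : R, 0 < e -> exists2 y, A y & `|y - x| < e.
Proof.
split=> [cx e e0|H B].
  have [|y [Ay xy]] := cx (ball x e); first exact: nbhsx_ballx.
  by exists y => //; move: xy; rewrite -ball_normE /ball_/= distrC.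
move=> /nbhs_ballP[e /= e0 eB]; have [y Ay yx] := H e e0.
by exists y; split => //; apply: eB; rewrite -ball_normE /ball_/= distrC.
Qed.

(** A lattice translation that brings a point of the closed cell into the open
    cell is trivial. *)
Lemma cube_cell_shift x z : cube q x -> cell q (x - qmul q z) -> z = 0.
Proof.
move=> xq zq; apply/rowP => i; rewrite mxE -[_ 0 i]/(z ord0 i); have := zq i; have := xq i.
rewrite in_itv/= !mxE => /andP[x0 x1] /andP[z0 z1]; have qi := q0 i.
have z3 : (z ord0 i)%:~R < 1 :> R by rewrite -(ltr_pM2l qi); lra.
have z4 : -1 < (z ord0 i)%:~R :> R by rewrite -(ltr_pM2l qi); lra.
move: z3 z4; rewrite -[1 in X in X -> _]/((1 : int)%:~R) ltr_int.
rewrite -[- 1](rmorphN1 (intr : int -> R)) ltr_int; lia.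
Qed.

Lemma cube_periodization A x : A `<=` cell q -> cube q x -> periodization q A x -> A x.
Proof.
move=> Aq xq /periodizationP[z Az].
by have z0 := cube_cell_shift xq (Aq _ Az); move: Az; rewrite z0 qmul0 subr0.
Qed.

Lemma sub_periodization A : A `<=` periodization q A.
Proof. by move=> x Ax; apply/periodizationP; exists 0; rewrite qmul0 subr0. Qed.

Lemma compact_in_cell A : closed A -> A `<=` cell q -> compact A.
Proof.
move=> cA Aq; apply: (subclosed_compact cA (@cube_compact _ _ q)).
by apply: subset_trans Aq _; exact: cell_cube.
Qed.

Lemma closure_periodization A : closure A `<=` cell q ->
  closure (periodization q A) `<=` periodization q (closure A).
Proof.
move=> Aq x /closureP cx.
have [d d0 dq] := compact_open_uniform (compact_in_cell (@closed_closure _ A) Aq)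
  (@open_cell R n q) Aq.
have near y z : A (y - qmul q z) -> `|y - x| < d -> cell q (x - qmul q z).
  move=> Ay yx; have -> : x - qmul q z = (y - qmul q z) + (x - y).
    by rewrite [RHS]addrC addrA subrK.
  by apply: dq; [exact: subset_closure|rewrite distrC].
have [y /periodizationP[z Ay] yx] := cx d d0.
apply/periodizationP; exists z; apply/closureP => e e0.
have [|y' /periodizationP[z' Ay'] yx'] := cx (Num.min d e).
  by rewrite lt_min d0.
move: yx'; rewrite lt_min => /andP[yd ye].
have zz : z' - z = 0.
  apply: (@cube_cell_shift (x - qmul q z)); first exact: cell_cube (near _ _ Ay yx).
  by rewrite qmulD qmulN opprB addrA subrK; exact: near Ay' yd.
have -> : z = z' by apply/esym/eqP; rewrite -subr_eq0 zz.
by exists (y' - qmul q z') => //; rewrite opprB addrA subrK.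
Qed.

Lemma closure_periodization_shift A x z : closure (periodization q A) x ->
  closure (periodization q A) (x + qmul q z).
Proof.
move=> /closureP cx; apply/closureP => e /cx[y /periodizationP[z' Ay] yx].
exists (y + qmul q z); last by rewrite opprD addrACA subrr addr0.
by apply/periodizationP; exists (z + z'); rewrite qmulD opprD addrA addrK.
Qed.

(** A set with empty boundary would be open and compact, hence stable under a
    uniform translation, which contradicts boundedness. *)
Lemma boundary_nonempty A : (0 < n)%N -> open A -> closure A `<=` cell q -> A !=set0 ->
  boundary A !=set0.
Proof.
move=> n0 oA Aq [x Ax]; apply: contrapT => /set0P/negP; rewrite negbK => /eqP bA.
have clA : closure A `<=` A.
  move=> y cy; apply: contrapT => nAy; have : boundary A y.
    by split => //; rewrite (proj1 (interior_id A) oA).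
  by rewrite bA.
have cA : compact A.
  have -> : A = closure A by apply/seteqP; split => //; exact: subset_closure.
  exact: compact_in_cell (@closed_closure _ A) Aq.
have [d d0 dA] := compact_open_uniform cA oA (@subset_refl _ A).
pose i0 : 'I_n := Ordinal n0.
pose v : V := \row_i (d / 2).
have vd : `|v| < d.
  rewrite [ltLHS]/Num.norm /= mx_normrE; apply/bigmax_ltP; split => // -[i j] _ /=.
  by rewrite mxE gtr0_norm; lra.
have step k : A (x + v *+ k).
  by elim: k => [|k IH]; rewrite ?mulr0n ?addr0// mulrSr addrA; exact: dA.
have := archi_boundP (ltW (divr_gt0 (q0 i0) d0)).
set k := Num.bound _ => kP.
have /andP[_] := Aq _ (subset_closure (step (k * 2)%N)) i0.
have /andP[x0 _] := Aq _ (subset_closure Ax) i0.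
have mE m : (v *+ m) ord0 i0 = d / 2 * m%:R.
  elim: m => [|m IH]; first by rewrite mulr0n mulr0 mxE.
  by rewrite mulrSr mxE IH mxE -(natr1 m) mulrDr mulr1.
rewrite mxE mE natrM; move: kP; rewrite ltr_pdivrMr//; lra.
Qed.

(** The open neighborhood of radius [e] in the sup norm. *)
Definition neighborhood (A : set V) (e : R) : set V :=
  [set x | exists2 t, A t & `|x - t| < e].

Lemma open_neighborhood A e : open (neighborhood A e).
Proof.
rewrite openE => x [t At xt]; apply/nbhs_ballP; exists (e - `|x - t|) => /=.
  by rewrite subr_gt0.
move=> y; rewrite -ball_normE /ball_/= => xy; exists t => //.
have -> : y - t = (x - t) - (x - y) by rewrite opprB [RHS]addrC addrA subrK.
by rewrite (le_lt_trans (ler_normB _ _))// addrC -ltrBrDr.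
Qed.

Lemma sub_neighborhood A e : 0 < e -> A `<=` neighborhood A e.
Proof. by move=> e0 x Ax; exists x => //; rewrite subrr normr0. Qed.

(** Compactness gives neighborhoods of [K] and of [B] whose differences stay
    in [G]. *)
Lemma separating_neighborhoods (K B G : set V) : compact K -> compact B ->
  B `<=` cell q -> open G -> [set t - s | t in K & s in B] `<=` G ->
  exists O N W : set V, [/\ open O, O `<=` N, compact N & B `<=` O] /\
    [/\ open W, K `<=` W & forall x y, W x -> N y -> G (x - y)].
Proof.
move=> cK cB Bq oG KBG.
pose sub (p : V * V) : V := p.1 - p.2.
have csub : continuous sub by move=> p; apply: continuousB; [exact: cvg_fst|exact: cvg_snd].
have cKB : compact (sub @` (K `*` B)).
  apply: continuous_compact; last exact: compact_setX.
  exact: continuous_subspaceT.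
have KBG' : sub @` (K `*` B) `<=` G.
  by move=> _ [[t s] /= [Kt Bs] <-]; apply: KBG; exists t => //; exists s.
have [d d0 dG] := compact_open_uniform cKB oG KBG'.
have [r r0 rq] := compact_open_uniform cB (@open_cell R n q) Bq.
pose e := Num.min r (d / 4).
have e0 : 0 < e by rewrite lt_min r0 divr_gt0.
have ed : e <= d / 4 by rewrite ge_min lexx orbT.
exists (neighborhood B e), (closure (neighborhood B e)), (neighborhood K e).
split; split; [exact: open_neighborhood|exact: subset_closure| |
  exact: sub_neighborhood|exact: open_neighborhood|exact: sub_neighborhood|].
- apply: (subclosed_compact (@closed_closure _ _) (@cube_compact _ _ q)).
  have cc : closed (cube q) := compact_closed (@norm_hausdorff _ _) (@cube_compact _ _ q).
  rewrite [X in _ `<=` X](proj1 (closure_id _) cc); apply: closure_subset.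
  move=> y [s Bs ys]; apply: cell_cube; rewrite -[y](subrK s) addrC; apply: rq => //.
  by apply: lt_le_trans ys _; rewrite ge_min lexx.
- move=> x y [t Kt xt] /closureP /(_ e e0)[y' [s Bs ys] yy].
  have -> : x - y = sub (t, s) + ((x - t) + (y' - y) - (y' - s)).
    rewrite /sub/= opprB.
    by rewrite [_ + (s - y')]addrC !addrA; apply/rowP => i; rewrite !mxE; ring.
  apply: dG; first by exists (t, s).
  rewrite (le_lt_trans (ler_normB _ _))//.
  have := ler_normD (x - t) (y' - y); lra.
Qed.

End geometry.

(** * The interior and the exterior potentials *)

Section densities.
Variables (R : realType) (n : nat) (q : 'I_n -> R) (rho : R) (Om : set 'rV[R]_n).
Hypotheses (q0 : forall i, 0 < q i) (rho0 : 0 < rho) (oOm : open Om)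
  (Omq : closure Om `<=` cell q).
Local Notation V := 'rV[R]_n.
Local Notation C := (Rcomplex R).

Lemma cell_periodization : cell q `&` periodization q Om = Om.
Proof.
apply/seteqP; split=> x.
  move=> [xq]; apply: (cube_periodization q0); last exact: cell_cube.
  by apply: subset_trans Omq; exact: subset_closure.
by move=> Ox; split; [apply: Omq; exact: subset_closure|exact: sub_periodization].
Qed.

Lemma cell_periodization_ext : cell q `&` periodization_ext q Om = cell q `\` closure Om.
Proof.
apply/seteqP; split=> x [xq nx]; split=> // cx; apply: nx.
  by apply: closure_subset cx; exact: sub_periodization.
apply: (cube_periodization q0 Omq (cell_cube xq)).
exact: closure_periodization.
Qed.

(** The density on [Om] is extended periodically. *)
Lemma good_density_periodization (v : V -> C) (M : R) : csmooth Om v ->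
  (roumieu_norm rho Om (closure Om) v <= M%:E)%E ->
  good_density q rho (periodization q Om) M (v \o cell_repr q).
Proof.
move=> sv vM; have pv := per_cell_repr q0 v.
have vE x : Om x -> v x = (v \o cell_repr q) x.
  by move=> Ox; rewrite /= cell_repr_id//; apply: Omq; exact: subset_closure.
have [sr dr] := csmooth_eq oOm vE sv.
split; [exact: pv|exact: per_csmooth|move=> w y sw yq Dy].
have Oy : Om y by rewrite -cell_periodization.
by rewrite dr//; apply: (roumieu_bound rho0 oOm sv vM) => //; exact: subset_closure.
Qed.

Lemma periodization_ext_shift x z : periodization_ext q Om x ->
  periodization_ext q Om (x + qmul q z).
Proof.
move=> nx cx; apply: nx; have := @closure_periodization_shift _ _ q Om _ (- z) cx.
by rewrite qmulN addrK.
Qed.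

Lemma open_periodization_ext : open (periodization_ext q Om).
Proof. by apply: closed_openC; exact: closed_closure. Qed.

Lemma good_density_periodization_ext (v : V -> C) (M : R) :
  let D := periodization_ext q Om in csmooth D v -> periodic_on q (closure D) v ->
  (roumieu_norm rho D (closure (cell q) `\` Om) v <= M%:E)%E ->
  good_density q rho D M (v \o cell_repr q).
Proof.
move=> D sv ppv vM; have pv := per_cell_repr q0 v; have oD := open_periodization_ext.
have vE x : D x -> v x = (v \o cell_repr q) x.
  move=> Dx; rewrite /= /cell_repr -qmulN ppv//; exact: subset_closure.
have [sr dr] := csmooth_eq oD vE sv.
split=> // w y sw yq Dy; rewrite dr//.
apply: (roumieu_bound rho0 oD sv vM) => //; split; first exact: subset_closure.
by move=> Oy; apply: Dy; apply/subset_closure/sub_periodization.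
Qed.

End densities.

Theorem theorem3p35 (R : realType) (n : nat) (hn : (2 <= n)%N)
    (q : 'I_n -> R) (hq : forall i, 0 < q i)
    (rho lambda : R) (hrho : 0 < rho) (hlambda : 0 < lambda < n%:R - 1)
    (Om Om1 G : set 'rV[R]_n)
    (Om_bounded : bounded_set Om) (Om_open : open Om)
    (Om_lipschitz : lipschitz_set Om) (Om_cell : closure Om `<=` cell q)
    (Om1_nonempty : Om1 !=set0) (Om1_open : open Om1)
    (Om1_Om : closure Om1 `<=` Om)
    (G_open : open G) (G_compact : compact (closure G))
    (G_nbhs : [set t - s | t in closure Om1 & s in boundary Om] `<=` G)
    (G_lattice : closure G `&` lattice q = set0) :
  let E := space_H q lambda rho G in
  let Fplus := roumieu rho Om in
  let Fminus := roumieu_per_ext q rho Om in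
  let H := roumieu_per q rho Om1 in
  [/\ maps_into E Fplus H (Pplus Om), bilinear_into E Fplus H (Pplus Om) &
      continuous_into E Fplus H (Pplus Om)] /\
  [/\ maps_into E Fminus H (Pminus q Om), bilinear_into E Fminus H (Pminus q Om) &
      continuous_into E Fminus H (Pminus q Om)].
Proof.
have Om_sub : Om `<=` closure Om := @subset_closure _ Om.
have intOm : interior Om = Om := proj1 (interior_id Om) Om_open.
have Om1_cell : closure Om1 `<=` cell q.
  by apply: subset_trans Om1_Om _; exact: subset_trans Om_sub Om_cell.
have bOm_cell : boundary Om `<=` cell q by move=> x [/Om_cell].
have cOm : compact (closure Om).
  exact: compact_in_cell (@closed_closure _ _) Om_cell.
have cOm1 : compact (closure Om1).
  exact: compact_in_cell (@closed_closure _ _) Om1_cell.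
have cbOm : compact (boundary Om).
  apply: compact_in_cell bOm_cell.
  by apply: closedI; [exact: closed_closure|apply: open_closedC; exact: open_interior].
have [x1 Ox1] := Om1_nonempty; have cx1 : closure Om1 x1 by exact: subset_closure.
have [b bOm] : boundary Om !=set0.
  apply: (boundary_nonempty hq) => //; first exact: ltnW.
  by exists x1; exact: Om1_Om.
have G0 : closure G !=set0.
  by exists (x1 - b); apply: subset_closure; apply: G_nbhs; exists x1 => //; exists b.
have [U [N [W [[oO ON cN bO] [oW Om1W WNG]]]]] :=
  separating_neighborhoods cOm1 cbOm bOm_cell G_open G_nbhs.
have clO (x : 'rV[R]_n) : closure Om x -> ~ U x -> Om x.
  by move=> cx nO; apply: contrapT => nx; apply: nO; apply: bO; split; rewrite ?intOm.
have clW : closure (periodization q Om1) `<=` periodization q W.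
  move=> x /(closure_periodization hq Om1_cell) /periodizationP[z /Om1W Wx].
  by apply/periodizationP; exists z.
have Om_cell' := subset_trans Om_sub Om_cell.
have geo_plus : cutoff_geometry q (periodization q Om) U N W G (closure Om `\` U).
  split; [|split]; split => //.
  - exact: open_periodization.
  - move=> x z /periodizationP[z' Ox]; apply/periodizationP; exists (z' + z).
    by rewrite qmulD opprD addrACA subrr addr0.
  - apply: (subclosed_compact _ cOm); last exact: subDsetl.
    by apply: closedI; [exact: closed_closure|exact: open_closedC].
  - by move=> x [cx nO]; apply: sub_periodization; exact: clO.
  - move=> x xq Dx nO; split => //; apply: Om_sub.
    exact: (cube_periodization hq Om_cell' (cell_cube xq) Dx).
have geo_minus : cutoff_geometry q (periodization_ext q Om) U N W G (cube q `\` (Om `|` U)).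
  split; [|split]; split => //.
  - exact: open_periodization_ext.
  - exact: periodization_ext_shift.
  - apply: (subclosed_compact _ (@cube_compact _ _ q)); last exact: subDsetl.
    apply: closedI; last by apply: open_closedC; exact: openU.
    exact: (compact_closed (@norm_hausdorff _ _) (@cube_compact _ _ q)).
  - move=> x [xq nO] cx; apply: nO.
    have := cube_periodization hq Om_cell xq (closure_periodization hq Om_cell cx).
    by move=> clx; have [|nO] := pselect (U x); [right|left; exact: clO].
  - move=> x xq Dx nO; split; first exact: cell_cube.
    move=> [Ox|//]; apply: Dx; apply: subset_closure; exact: sub_periodization.
have PEplus u v x : Pplus Om u v x =
    volume_integral (cell q `&` periodization q Om) (fun y => u (x - y) * v y).
  by rewrite cell_periodization.
have PEminus u v x : Pminus q Om u v x =
    volume_integral (cell q `&` periodization_ext q Om) (fun y => u (x - y) * v y).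
  by rewrite cell_periodization_ext.
have oD := @open_periodization_ext _ _ q Om.
pose regp (v : 'rV[R]_n -> Rcomplex R) := csmooth Om v.
pose regm (v : 'rV[R]_n -> Rcomplex R) := csmooth (periodization_ext q Om) v /\
  periodic_on q (closure (periodization_ext q Om)) v.
have regpF v : nf_mem (roumieu rho Om) v -> regp v by move=> [[_ /csmoothP]].
have regpB v w : regp v -> regp w -> regp (v \- w)%R.
  by move=> rv rw; have [] := csmoothB Om_open rv rw.
have regmF v : nf_mem (roumieu_per_ext q rho Om) v -> regm v.
  by move=> [[[_ /csmoothP sv _] pv _] _].
have regmB v w : regm v -> regm w -> regm (v \- w)%R.
  move=> [sv pv] [sw pw]; split; first by have [] := csmoothB oD sv sw.
  by move=> x z cx; rewrite /= pv// pw.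
have densp v (M : R) : regp v -> (nf_norm (roumieu rho Om) v <= M%:E)%E ->
    good_density q rho (periodization q Om) M (v \o cell_repr q).
  exact: good_density_periodization.
have densm v (M : R) : regm v -> (nf_norm (roumieu_per_ext q rho Om) v <= M%:E)%E ->
    good_density q rho (periodization_ext q Om) M (v \o cell_repr q).
  by move=> [sv pv]; exact: good_density_periodization_ext.
have gep v : (0 <= nf_norm (roumieu rho Om) v)%E.
  by apply: roumieu_norm_ge0 => //; exists b; case: bOm.
have gem v : (0 <= nf_norm (roumieu_per_ext q rho Om) v)%E.
  apply: roumieu_norm_ge0 => //; exists b; split.
    by apply: subset_closure; exact: bOm_cell.
  by case: bOm; rewrite intOm.
have finp v : nf_mem (roumieu rho Om) v -> (nf_norm (roumieu rho Om) v < +oo)%E by case.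
have finm v : nf_mem (roumieu_per_ext q rho Om) v ->
  (nf_norm (roumieu_per_ext q rho Om) v < +oo)%E by case.
split; split.
- exact: (operator_maps_into hq hn hlambda hrho geo_plus G_lattice G0
    clW PEplus regpF densp gep finp).
- exact: (operator_bilinear hq hn hlambda hrho _ geo_plus G_lattice G0
    PEplus regpF densp gep finp).
- exact: (operator_continuous hq hn hlambda hrho geo_plus G_lattice G0
    Om1W clW PEplus regpF regpB densp gep finp).
- exact: (operator_maps_into hq hn hlambda hrho geo_minus G_lattice G0
    clW PEminus regmF densm gem finm).
- exact: (operator_bilinear hq hn hlambda hrho _ geo_minus G_lattice G0
    PEminus regmF densm gem finm).
- exact: (operator_continuous hq hn hlambda hrho geo_minus G_lattice G0
    Om1W clW PEminus regmF regmB densm gem finm).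
Qed.
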